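(* Let $v\in V$ and let $\Gamma$ be a finite subgroup of $\mathcal{N}_{\langle v\rangle}$. Let $\mathcal{H}_i$ be the homogeneous component of degree $i$ of $\mathcal{H}$. Then for every $k\in\mathbb{Z}$ there is an isomorphism of $\langle G,\Gamma\rangle$-modules $$\bigoplus_{\{i\geq 0\,\mid\, G\cap\Gamma\subset\ker\theta_v^{k+i}\}}\mathcal{H}_i\otimes\theta_v^{k+i}\;\cong\;\mathrm{Ind}_{\langle G_v,\Gamma\rangle}^{\langle G,\Gamma\rangle}\bigl((\mathcal{H}_v\otimes_{gr}\theta_v)\otimes\theta_v^k\bigr).$$
   Context: Let $K$ be an algebraically closed field of characteristic $0$, $V$ a finite-dimensional $K$-vector space and $G\subset\mathrm{GL}(V)$ a finite group generated by (pseudo)reflections. Let $S$ be the graded algebra of polynomial functions on $V$, with $\mathrm{GL}(V)$ acting by $(gf)(v)=f(g^{-1}v)$, and $\mathcal{N}$ the normaliser of $G$ in $\mathrm{GL}(V)$. For a finite reflection group $W$ on $V$, $W$-harmonic polynomials are those annihilated by all $W$-invariant constant-coefficient differential operators without constant term. $\mathcal{H}$ is the space of $G$-harmonic polynomials (a graded $\langle G,\mathcal{N}\rangle$-stable subspace of $S$). For $v\in V$: $G_v$ is the subgroup of $G$ generated by reflections fixing $v$, $\mathcal{H}_v$ the $G_v$-harmonic polynomials, $\mathcal{N}_{\langle v\rangle}=\{n\in\mathcal{N}:n(v)\in Kv\}$, and $\theta_v:\mathcal{N}_{\langle v\rangle}\to K^\times$ is given by $n(v)=\theta_v(n)v$.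 Since $\theta_v$ is trivial on $G_v\cap\Gamma$, it defines a linear character of $\langle G_v,\Gamma\rangle$ (trivial on $G_v$), still denoted $\theta_v$; when $G\cap\Gamma\subset\ker\theta_v^j$, $\theta_v^j$ likewise defines a linear character of $\langle G,\Gamma\rangle$ trivial on $G$. For a graded module $X=\oplus_i X_i$ and a linear character $\theta$, $X\otimes_{gr}\theta=\oplus_i X_i\otimes\theta^i$. *)

(* Defs.v *)
From HB Require Import structures.
From mathcomp Require Import all_boot all_order all_algebra all_fingroup.
From mathcomp Require Import mpoly.

Set Implicit Arguments.
Unset Strict Implicit.
Unset Printing Implicit Defensive.

Import GRing.Theory.
Local Open Scope ring_scope.

Section Defs.
Variables (K : fieldType) (n : nat) (gT : finGroupType).
Variable rho : gT -> 'M[K]_n.   (* faithful representation gT -> GL(V), V = K^n (column vectors) *)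

Definition is_reflection (g : gT) : bool := \rank (rho g - 1%:M) == 1%N.

Definition refl_fixing (A : {set gT}) (v : 'cV[K]_n) : {set gT} :=
  [set g in A | is_reflection g && (rho g *m v == v)].

Definition Gsub (G : {set gT}) (v : 'cV[K]_n) : {set gT} := (<<refl_fixing G v>>)%g.

(* action of GL(V) on S = K[V] : (g f)(v) = f (g^-1 v) *)
Definition act (g : gT) (f : {mpoly K[n]}) : {mpoly K[n]} :=
  f \mPo [tuple \sum_(j < n) rho (g^-1)%g i j *: 'X_j | i < n].

Definition Dop (p f : {mpoly K[n]}) : {mpoly K[n]} :=
  \sum_(m <- msupp p) p@_m *: mderivm m f.

Definition harmonic (W : {set gT}) (f : {mpoly K[n]}) : Prop :=
  forall p : {mpoly K[n]}, p@_0%MM = 0 ->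
    (forall w q, w \in W -> act w (Dop p q) = Dop p (act w q)) ->
    Dop p f = 0.

Definition hcomp (i : nat) (f : {mpoly K[n]}) : {mpoly K[n]} := pihomog mdeg i f.

(* theta_v(x) for x with rho x v in K v (v <> 0): the scalar c with rho x v = c v *)
Definition theta (v : 'cV[K]_n) (x : gT) : K :=
  match [pick i : 'I_n | v i 0 != 0] with
  | Some i => (rho x *m v) i 0 / v i 0
  | None => 1
  end.

(* extension of theta_v to <A, Gamma> (A normalised by Gamma): theta(a * gam) = theta(gam) *)
Definition thetaExt (A Gamma : {set gT}) (v : 'cV[K]_n) (x : gT) : K :=
  match [pick gam in Gamma | (x * gam^-1)%g \in A] with
  | Some gam => theta v gam
  | None => 1
  end.

(* graded module twisted by characters: x . f = sum_i theta(x)^(k+i) (x f)_i ,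
   i.e. the action on (X (x)_gr theta) (x) theta^k *)
Definition twact (A Gamma : {set gT}) (v : 'cV[K]_n) (k : int) (x : gT)
    (f : {mpoly K[n]}) : {mpoly K[n]} :=
  \sum_(i < msize (act x f)) (thetaExt A Gamma v x) ^ (k + i%:Z) *: hcomp i (act x f).

(* Induced module Ind_Y^X (M) with M = (carrier PM, action aM of Y):
   functions f : X -> M with f (h x) = h . f(x) (h in Y), zero outside X;
   X acts by (y . f)(x) = f (x y). *)
Definition Ind_carrier (X Y : {set gT}) (PM : {mpoly K[n]} -> Prop)
    (aM : gT -> {mpoly K[n]} -> {mpoly K[n]}) (f : {ffun gT -> {mpoly K[n]}}) : Prop :=
  (forall x, x \notin X -> f x = 0) /\
  (forall x, x \in X -> PM (f x)) /\
  (forall h x, h \in Y -> x \in X -> f (h * x)%g = aM h (f x)).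

Definition Ind_act (y : gT) (f : {ffun gT -> {mpoly K[n]}}) : {ffun gT -> {mpoly K[n]}} :=
  [ffun x => f (x * y)%g].

End Defs.

Definition rep_iso (K : fieldType) (gT : finGroupType) (X : {set gT})
    (U W : lmodType K) (PU : U -> Prop) (aU : gT -> U -> U)
    (PW : W -> Prop) (aW : gT -> W -> W) : Prop :=
  exists phi : U -> W,
    [/\ forall (a : K) u1 u2, PU u1 -> PU u2 -> phi (a *: u1 + u2) = a *: phi u1 + phi u2,
        forall u, PU u -> PW (phi u),
        forall u1 u2, PU u1 -> PU u2 -> phi u1 = phi u2 -> u1 = u2,
        forall w, PW w -> exists2 u, PU u & phi u = w
      & forall x u, x \in X -> PU u -> phi (aU x u) = aW x (phi u)].

(* Main.v *)
(** The two sides are related by exponentials.  Let [lam] be a linear form whose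
    line is stable under [<G_v, Gamma>] with character [theta_v], and which is
    fixed by the same reflections of [G] as [v].  To a function [f] in the induced
    module attach the power series [sum_(x in G) x^-1 (exp(lam) f(x))], seen as a
    functional on constant coefficient operators, truncate it, and project it
    equivariantly onto the harmonic polynomials; the result is [harm_of_family f].
    An element [y] of [<G_v, Gamma>] maps [exp(lam)] to [exp(theta_v(y)^-1 lam)],
    which rescaling by [theta_v(y)] undoes: this is where the graded twist comes from.

    The [G]-harmonic polynomials are the derivatives of the product [J] of the
    linear forms defining the reflecting hyperplanes, one factor per reflection.
    This holds because semi-invariants are divisible by such products, so that the
    socle of the coinvariant algebra is a line, on which the pairing with [J] does
    not vanish.  For [f(x) = chi(x) J_(G_v)], where [chi] is the character of [J],
    the lowest term of the series is harmonic and semi-invariant, hence a nonzero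
    multiple of [J]; by differentiation, all harmonic polynomials are reached.  For
    [lam] with trivial stabiliser this also shows that the harmonic polynomials
    afford the regular representation, and comparing dimensions gives injectivity
    in general.  Finally, averaging over [<G_v, Gamma>] turns families on [G] into
    elements of the induced module, and kills exactly the degrees [i] for which
    [theta_v^(k+i)] is nontrivial on [G :&: Gamma]. *)

Require Import Defs.
From HB Require Import structures.
From mathcomp Require Import all_boot all_order all_algebra all_fingroup.
From mathcomp Require Import mpoly ring.
From Stdlib Require Import ClassicalEpsilon.
Set Implicit Arguments.
Unset Strict Implicit.
Unset Printing Implicit Defensive.
Import GRing.Theory.
Local Open Scope ring_scope.

(** * Linear substitutions and the differentiation pairing *)

(** A polynomial plays two roles. As a constant coefficient operator it is a symbol, moved by
    [lsub (rho g)]; as a function it is moved by the contragredient [lsub (dual_rep rho g)]. Columns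
    are linear symbols, and a row [lam] is a point at which symbols are evaluated. Multiplying
    functions by exp(lam) is then adjoint to the translation [trans lam] of symbols, so every
    statement about the infinite series becomes one about polynomials.

    Over the complex numbers an invariant Hermitian form would turn [v] into a linear form with the
    same stabiliser and the right character. Over [K] there is no such form: [lam] is taken generic
    among the semi-invariant forms, and positivity is used over the rationals, where sums of squares
    make sense. Elements that fix [lam] are controlled through the character by which they act on
    products of root forms, whether or not they are products of reflections fixing [lam]. The
    dimension [#|W|] comes from an orbit of [#|W|] distinct points. *)

Section Substitution.
Variables (K : fieldType) (n : nat).
Implicit Types (p q : {mpoly K[n]}) (B C : 'M[K]_n) (u : 'rV[K]_n).

Lemma mpoly_alg_ind (P : {mpoly K[n]} -> Prop) :
  (forall c, P c%:MP) -> (forall i, P 'X_i) ->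
  (forall p q, P p -> P q -> P (p + q)) ->
  (forall p q, P p -> P q -> P (p * q)) -> forall p, P p.
Proof.
move=> PC PX PD PM p; rewrite [p]mpolyE; apply: big_ind => [|//|m _].
  by rewrite -mpolyC0; apply: PC.
rewrite -mul_mpolyC; apply: (PM _ _ (PC _)); rewrite mpolyXE_id.
apply: big_ind => [|//|i _]; first by rewrite -mpolyC1; apply: PC.
elim: (m i) => [|k IH]; first by rewrite expr0 -mpolyC1; apply: PC.
by rewrite exprS; apply: PM.
Qed.

Lemma mpoly_lrmorph_ext (A : algType K) (f g : {lrmorphism {mpoly K[n]} -> A}) :
  (forall i, f 'X_i = g 'X_i) -> f =1 g.
Proof.
move=> fg; apply: mpoly_alg_ind => // [c|p q pE qE|p q pE qE].
- by rewrite -[c%:MP]mulr1 mul_mpolyC !linearZ /= !rmorph1.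
- by rewrite !raddfD; congr (_ + _).
- by rewrite !rmorphM; congr (_ * _).
Qed.

(** With linear forms as columns and points as rows, [lsub] is covariant in the matrix, and
    evaluating [lsub B p] at a row amounts to moving the row by [B] on the right. *)
Definition lin (c : 'cV[K]_n) : {mpoly K[n]} := \sum_(i < n) c i 0 *: 'X_i.

Definition lsub B : {mpoly K[n]} -> {mpoly K[n]} :=
  comp_mpoly [tuple \sum_(j < n) B j i *: 'X_j | i < n].

Definition trans u : {mpoly K[n]} -> {mpoly K[n]} :=
  comp_mpoly [tuple 'X_i + (u 0 i)%:MP | i < n].

HB.instance Definition _ B := GRing.LRMorphism.on (lsub B).
HB.instance Definition _ u := GRing.LRMorphism.on (trans u).

Lemma lin_is_linear : linear lin.
Proof.
move=> a c d; rewrite /lin scaler_sumr -big_split; apply: eq_bigr => i _ /=.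
by rewrite !mxE scalerDl scalerA.
Qed.
HB.instance Definition _ := GRing.isLinear.Build K 'cV[K]_n {mpoly K[n]} _ lin
  lin_is_linear.

Lemma lsubX B i : lsub B 'X_i = lin (col i B).
Proof.
rewrite /lsub comp_mpolyXU -tnth_nth tnth_mktuple; apply: eq_bigr => j _.
by rewrite mxE.
Qed.

Lemma transX u i : trans u 'X_i = 'X_i + (u 0 i)%:MP.
Proof. by rewrite /trans comp_mpolyXU -tnth_nth tnth_mktuple. Qed.

Lemma lsubC B c : lsub B c%:MP = c%:MP. Proof. exact: comp_mpolyC. Qed.
Lemma transC u c : trans u c%:MP = c%:MP. Proof. exact: comp_mpolyC. Qed.

Lemma lsubZ B a p : lsub B (a *: p) = a *: lsub B p.
Proof. exact: linearZ. Qed.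

Lemma lsub_lin B c : lsub B (lin c) = lin (B *m c).
Proof.
rewrite /lin linear_sum /=.
under eq_bigr => i _ do rewrite linearZ /= lsubX /lin scaler_sumr.
rewrite exchange_big; apply: eq_bigr => j _ /=.
by rewrite !mxE scaler_suml; apply: eq_bigr => i _; rewrite scalerA mxE mulrC.
Qed.

Lemma lsubM B C p : lsub (B *m C) p = lsub B (lsub C p).
Proof.
apply: (mpoly_lrmorph_ext (f := lsub (B *m C)) (g := lsub B \o lsub C)) => i /=.
rewrite !lsubX lsub_lin; congr lin; apply/colP => j; rewrite !mxE.
by apply: eq_bigr => l _; rewrite mxE.
Qed.

Lemma lsub1 p : lsub 1%:M p = p.
Proof.
apply: (mpoly_lrmorph_ext (f := lsub 1%:M) (g := idfun)) => i /=.
rewrite lsubX /lin (bigD1 i) //= big1 ?addr0 => [|j /negbTE ji].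
  by rewrite !mxE eqxx scale1r.
by rewrite !mxE ji scale0r.
Qed.

Lemma trans0 p : trans 0 p = p.
Proof.
apply: (mpoly_lrmorph_ext (f := trans 0) (g := idfun)) => i /=.
by rewrite transX mxE mpolyC0 addr0.
Qed.

Lemma trans_lin u c : trans u (lin c) = lin c + ((u *m c) 0 0)%:MP.
Proof.
rewrite /lin linear_sum /= mxE raddf_sum -big_split; apply: eq_bigr => i _ /=.
by rewrite linearZ /= transX scalerDr -!mul_mpolyC -mpolyCM mulrC [c i 0 * _]mulrC.
Qed.

Lemma trans_lsub u B p : trans u (lsub B p) = lsub B (trans (u *m B) p).
Proof.
apply: (mpoly_lrmorph_ext (f := trans u \o lsub B) (g := lsub B \o trans (u *m B))).
move=> i /=; rewrite lsubX trans_lin transX rmorphD /= lsubX lsubC.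
congr (_ + _%:MP); rewrite !mxE; apply: eq_bigr => j _; by rewrite !mxE.
Qed.

Lemma mcoeff0_lsub B p : (lsub B p)@_0%MM = p@_0%MM.
Proof.
elim/mpoly_alg_ind: p => [c|i|p q pE qE|p q pE qE].
- by rewrite lsubC.
- rewrite lsubX /lin raddf_sum /= mcoeffX mnm1_eq0.
  by apply: big1 => j _; rewrite mcoeffZ mcoeffX mnm1_eq0 mulr0.
- by rewrite !raddfD /= pE qE.
- by rewrite !rmorphM /= pE qE.
Qed.

Lemma mcoeff0_trans u p : (trans u p)@_0%MM = p.@[u 0].
Proof.
elim/mpoly_alg_ind: p => [c|i|p q pE qE|p q pE qE].
- by rewrite transC mevalC mcoeffC eqxx mulr1.
- by rewrite transX mcoeffD mcoeffX mnm1_eq0 mcoeffC eqxx mulr1 add0r mevalXU.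
- by rewrite !raddfD /= pE qE.
- by rewrite !rmorphM /= pE qE.
Qed.

Lemma meval_lsub B p (u : 'rV[K]_n) : (lsub B p).@[u 0] = p.@[(u *m B) 0].
Proof. by rewrite -!mcoeff0_trans trans_lsub mcoeff0_lsub. Qed.

Lemma meval_lin (u : 'rV[K]_n) c : (lin c).@[u 0] = (u *m c) 0 0.
Proof.
rewrite -mcoeff0_trans trans_lin mcoeffD mcoeffC eqxx mulr1 /lin raddf_sum big1 ?add0r //=.
by move=> j _; rewrite mcoeffZ mcoeffX mnm1_eq0 mulr0.
Qed.

Lemma lin_eq0 c : (lin c == 0) = (c == 0).
Proof.
apply/eqP/eqP => [c0|->]; last exact: linear0.
apply/colP => i; have := congr1 (mcoeff U_(i)%MM) c0; rewrite mcoeff0 mxE => <-.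
rewrite /lin raddf_sum (bigD1 i) //= mcoeffZ mcoeffX eqxx mulr1 big1 ?addr0 //.
by move=> j /negbTE ji; rewrite mcoeffZ mcoeffX eq_mnm1 ji mulr0.
Qed.

End Substitution.

Section Pairing.
Variables (K : fieldType) (n : nat).
Implicit Types (p q f : {mpoly K[n]}) (B C : 'M[K]_n) (u : 'rV[K]_n) (m : 'X_{1..n}).

(** Supports do not add, so linearity in the operator is proved over a range of monomials that is
    independent of [p]. *)
Lemma DopwE k p f : (msize p <= k)%N ->
  Dop p f = \sum_(m : 'X_{1..n < k}) p@_m *: mderivm m f.
Proof.
move=> lt_pk; pose F := fun m => p@_m *: mderivm m f.
have -> : \sum_(m : 'X_{1..n < k}) F m = \sum_(m <- map val (index_enum 'X_{1..n < k})) F m.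
  by rewrite big_map.
rewrite (bigID (mem (msupp p))) /= [X in _ = _ + X]big1 ?addr0; last first.
  by move=> m /memN_msupp_eq0 p0; rewrite /F p0 scale0r.
rewrite -big_filter; apply: perm_big; apply: uniq_perm => [||m].
- exact: msupp_uniq.
- by rewrite filter_uniq // map_inj_uniq ?index_enum_uniq //; apply: val_inj.
rewrite mem_filter /=; case: (boolP (m \in msupp p)) => //= mp.
by have mk := leq_trans (msize_mdeg_lt mp) lt_pk; apply/esym/mapP;
  exists (BMultinom mk); rewrite ?mem_index_enum.
Qed.

Lemma Dop_linear p : linear (Dop p).
Proof.
move=> c f g; rewrite /Dop scaler_sumr -big_split; apply: eq_bigr => m _ /=.
by rewrite linearP /= scalerDr !scalerA mulrC.
Qed.
HB.instance Definition _ p :=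
  GRing.isLinear.Build K {mpoly K[n]} {mpoly K[n]} _ (Dop p) (Dop_linear p).

Lemma Dop_linearl f : linear (fun p => Dop p f).
Proof.
move=> c p q; pose k := maxn (msize (c *: p + q)) (maxn (msize p) (msize q)).
rewrite !(@DopwE k) ?leq_max ?leqnn ?orbT //.
rewrite scaler_sumr -big_split; apply: eq_bigr => m _ /=.
by rewrite mcoeffD mcoeffZ scalerDl scalerA.
Qed.

Lemma DopDl p q f : Dop (p + q) f = Dop p f + Dop q f.
Proof. by have := Dop_linearl f 1 p q; rewrite !scale1r. Qed.
Lemma Dop0l f : Dop 0 f = 0.
Proof. by rewrite /Dop msupp0 big_nil. Qed.
Lemma DopZl c p f : Dop (c *: p) f = c *: Dop p f.
Proof. by have := Dop_linearl f c p 0; rewrite Dop0l !addr0. Qed.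
Lemma Dop_suml (I : Type) (r : seq I) (P : pred I) (F : I -> {mpoly K[n]}) f :
  Dop (\sum_(i <- r | P i) F i) f = \sum_(i <- r | P i) Dop (F i) f.
Proof. by apply: (big_morph (fun p => Dop p f)) => [p q|]; rewrite (DopDl, Dop0l). Qed.
Lemma DopBl p q f : Dop (p - q) f = Dop p f - Dop q f.
Proof. by rewrite -[- q]scaleN1r DopDl DopZl scaleN1r. Qed.

Lemma DopXm m f : Dop 'X_[m] f = mderivm m f.
Proof. by rewrite /Dop msuppX big_seq1 mcoeffX eqxx scale1r. Qed.

Lemma DopC c f : Dop c%:MP f = c *: f.
Proof. by rewrite -[c%:MP]mulr1 mul_mpolyC DopZl -mpolyX0 DopXm mderivm0m. Qed.

Lemma DopM p q f : Dop (p * q) f = Dop p (Dop q f).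
Proof.
rewrite [p]mpolyE mulr_suml !Dop_suml; apply: eq_bigr => m _.
rewrite -scalerAl !DopZl DopXm; congr (_ *: _).
rewrite [q]mpolyE mulr_sumr !Dop_suml linear_sum; apply: eq_bigr => m' _ /=.
by rewrite -scalerAr !DopZl linearZ /= mulrC -mpolyXD !DopXm mderivmDm.
Qed.

Lemma DopCA p q f : Dop p (Dop q f) = Dop q (Dop p f).
Proof. by rewrite -!DopM mulrC. Qed.

Lemma mderiv_lsub B i f :
  mderiv i (lsub B f) = lsub B (Dop (lsub B^T 'X_i) f).
Proof.
have E g : Dop (lsub B^T 'X_i) g = \sum_j B i j *: mderiv j g.
  rewrite lsubX /lin Dop_suml; apply: eq_bigr => j _.
  by rewrite DopZl DopXm mderivmU1m !mxE.
elim/mpoly_alg_ind: f => [c|k|p q pE qE|p q pE qE].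
- by rewrite lsubC mderivC E big1 ?raddf0 // => j _; rewrite mderivC scaler0.
- rewrite lsubX E [RHS]linear_sum /lin linear_sum /=.
  rewrite (bigD1 i) //= [X in _ + X]big1 ?addr0 => [|j ji]; last first.
    by rewrite linearZ /= mderivX mnm1E (negbTE ji) scale0r scaler0.
  rewrite [RHS](bigD1 k) //= [X in _ = _ + X]big1 ?addr0 => [|j jk]; last first.
    by rewrite linearZ /= mderivX mnm1E eq_sym (negbTE jk) scale0r !(scaler0, linear0).
  rewrite !linearZ /= !mderivX !mnm1E !eqxx !scale1r.
  have UU (l : 'I_n) : (U_(l) - U_(l) = 0 :> 'X_{1..n})%MM.
    by apply/mnmP => l'; rewrite mnmBE mnm0E subnn.
  by rewrite !UU !mpolyX0 rmorph1 mxE.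
- by rewrite !linearD /= pE qE.
- rewrite rmorphM mderivM pE qE !E -!rmorphM -rmorphD /=; congr lsub.
  rewrite mulr_suml mulr_sumr -big_split; apply: eq_bigr => j _ /=.
  by rewrite mderivM scalerDr -scalerAl -scalerAr.
Qed.

(** The chain rule, extended from variables to all symbols because products of symbols act by
    composition. *)
Lemma Dop_lsub B p f : Dop p (lsub B f) = lsub B (Dop (lsub B^T p) f).
Proof.
elim/mpoly_alg_ind: p f => [c|i|p q pE qE|p q pE qE] f.
- by rewrite lsubC !DopC linearZ.
- by rewrite {1}DopXm mderivmU1m mderiv_lsub.
- by rewrite !linearD /= !DopDl linearD pE qE.
- by rewrite rmorphM /= !DopM qE pE.
Qed.

(** The apolar form: multiplication by a symbol is adjoint to differentiation, and monomials are
    orthogonal with products of factorials as norms. *)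
Definition pair p f : K := (Dop p f)@_0%MM.

Lemma pair_linear p : linear_for *%R (pair p).
Proof. by move=> c f g; rewrite /pair !linearP. Qed.
HB.instance Definition _ p :=
  GRing.isLinear.Build K {mpoly K[n]} K _ (pair p) (pair_linear p).

Lemma pairZr c p f : pair p (c *: f) = c * pair p f.
Proof. exact: linearZ. Qed.

Lemma pairDl p q f : pair (p + q) f = pair p f + pair q f.
Proof. by rewrite /pair DopDl mcoeffD. Qed.
Lemma pairZl c p f : pair (c *: p) f = c * pair p f.
Proof. by rewrite /pair DopZl mcoeffZ. Qed.
Lemma pairBl p q f : pair (p - q) f = pair p f - pair q f.
Proof. by rewrite /pair DopBl mcoeffB. Qed.
Lemma pair_suml (I : Type) (r : seq I) (P : pred I) (F : I -> {mpoly K[n]}) f :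
  pair (\sum_(i <- r | P i) F i) f = \sum_(i <- r | P i) pair (F i) f.
Proof. by rewrite /pair Dop_suml raddf_sum. Qed.

Lemma pairM p q f : pair (p * q) f = pair p (Dop q f).
Proof. by rewrite /pair DopM. Qed.

Lemma pair_lsub B p f : pair p (lsub B f) = pair (lsub B^T p) f.
Proof. by rewrite /pair Dop_lsub mcoeff0_lsub. Qed.

Definition mfact m : nat := \prod_(i < n) (m i)`!.

Lemma pairX m f : pair 'X_[m] f = f@_m *+ mfact m.
Proof.
rewrite /pair DopXm mcoeff_mderivm addm0; congr (_ *+ _).
by apply: eq_bigr => i _; rewrite ffactnn.
Qed.

Lemma pairE p f : pair p f = \sum_(m <- msupp p) p@_m * (f@_m *+ mfact m).
Proof.
rewrite {1}[p]mpolyE pair_suml; apply: eq_bigr => m _.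
by rewrite pairZl pairX.
Qed.

Lemma mcoeff_hcomp d p m : (hcomp d p)@_m = if mdeg m == d then p@_m else 0.
Proof.
rewrite /hcomp pihomogE raddf_sum /= -big_filter.
case: ifP => md; last first.
  rewrite big_seq big1 // => m'; rewrite mem_filter => /andP[/eqP m'd _].
  by rewrite mcoeffZ mcoeffX; case: (eqVneq m' m) md => [<-|_]; rewrite ?m'd ?eqxx ?mulr0.
have [mp|mp] := boolP (m \in msupp p).
  rewrite (bigD1_seq m) ?filter_uniq ?msupp_uniq ?mem_filter ?md //=.
  rewrite mcoeffZ mcoeffX eqxx mulr1 big1 ?addr0 // => m' /negbTE m'm.
  by rewrite mcoeffZ mcoeffX m'm mulr0.
rewrite (memN_msupp_eq0 mp) big_seq big1 // => m'; rewrite mem_filter => /andP[_ m'p].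
rewrite mcoeffZ mcoeffX; case: (eqVneq m' m) m'p => [->|]; last by rewrite mulr0.
by rewrite (negbTE mp).
Qed.

Lemma pair_hcomp d p f : pair (hcomp d p) f = pair p (hcomp d f).
Proof.
rewrite [p]mpolyE /hcomp [pihomog _ _ _]raddf_sum !pair_suml; apply: eq_bigr => m _ /=.
rewrite linearZ /= !pairZl pairX [pihomog _ _ _]pihomogX mcoeff_hcomp.
by case: ifP => _; rewrite ?pairX // mul0rn /pair Dop0l mcoeff0.
Qed.

Section Char0.
Hypothesis charK0 : [pchar K] =i pred0.

Lemma natK_neq0 k : (0 < k)%N -> k%:R != 0 :> K.
Proof. by move=> k0; rewrite (iffLR (pcharf0P K) charK0) -lt0n. Qed.

Lemma mfact_neq0 m : (mfact m)%:R != 0 :> K.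
Proof. by apply: natK_neq0; apply: prodn_gt0 => i; rewrite fact_gt0. Qed.

Lemma pair_inj f : (forall p, pair p f = 0) -> f = 0.
Proof.
move=> f0; apply/mpolyP => m; have := f0 'X_[m]; rewrite pairX mcoeff0 -mulr_natr.
by move/eqP; rewrite mulf_eq0 (negbTE (mfact_neq0 m)) orbF => /eqP.
Qed.

Lemma pair_injl p : (forall f, pair p f = 0) -> p = 0.
Proof.
move=> p0; apply/mpolyP => m; have := p0 'X_[m]; rewrite mcoeff0 pairE.
have [mp|/memN_msupp_eq0 //] := boolP (m \in msupp p).
rewrite (bigD1_seq m) ?msupp_uniq //= big1 => [|m' /negbTE m'm]; last first.
  by rewrite mcoeffX eq_sym m'm mul0rn mulr0.
rewrite addr0 mcoeffX eqxx => /eqP; rewrite mulf_eq0 (negbTE (mfact_neq0 m)) orbF.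
by move/eqP.
Qed.

Lemma Dop_eq0P p f : (forall q, pair (q * p) f = 0) <-> Dop p f = 0.
Proof.
split=> [qp|pf q]; last by rewrite pairM pf linear0.
by apply: pair_inj => q; rewrite -pairM.
Qed.

End Char0.

End Pairing.

(** * Reflections and the product of their root forms *)

Section LinearForms.
Variables (K : fieldType) (n : nat).
Implicit Types (p q : {mpoly K[n]}) (c : 'cV[K]_n).

Definition dvdm (a b : {mpoly K[n]}) := exists q, b = a * q.

Definition dualrow c : 'rV[K]_n :=
  if [pick i | c i 0 != 0] is Some i then (c i 0)^-1 *: delta_mx 0 i else 0.

(** Substituting [hproj c] is reduction modulo [lin c], realised as a ring endomorphism of the
    polynomial ring. It takes the place of the primality of [lin c]. *)
Definition hproj c : 'M[K]_n := 1%:M - c *m dualrow c.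

Lemma dualrowE c : c != 0 -> dualrow c *m c = 1%:M.
Proof.
move=> c0; rewrite /dualrow; case: pickP => [i ci|c_0]; last first.
  by case/eqP: c0; apply/colP => i; rewrite mxE; apply/eqP; rewrite -[_ == _]negbK c_0.
apply/matrixP => a b; rewrite !ord1 -scalemxAl -rowE !mxE eqxx.
by rewrite mulVf.
Qed.

Lemma hproj_self c : c != 0 -> hproj c *m c = 0.
Proof. by move=> c0; rewrite mulmxBl mul1mx -mulmxA dualrowE // mulmx1 subrr. Qed.

Lemma hprojE c d : hproj c *m d = 0 -> exists a, d = a *: c.
Proof.
move/eqP; rewrite mulmxBl mul1mx subr_eq0 => /eqP ->; exists ((dualrow c *m d) 0 0).
by rewrite -mulmxA [X in c *m X]mx11_scalar mul_mx_scalar.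
Qed.

Lemma lsub_hproj c p : exists q, p - lsub (hproj c) p = lin c * q.
Proof.
elim/mpoly_alg_ind: p => [a|i|p q [p' pE] [q' qE]|p q [p' pE] [q' qE]].
- by exists 0; rewrite lsubC subrr mulr0.
- exists (dualrow c 0 i)%:MP; rewrite lsubX.
  have -> : 'X_i = lin (col i 1%:M) :> {mpoly K[n]} by rewrite -lsubX lsub1.
  rewrite -linearB -raddfB /= /hproj opprB addrC subrK mulrC mul_mpolyC -linearZ /=.
  by congr lin; apply/colP => j; rewrite !mxE big_ord1 mulrC.
- by exists (p' + q'); rewrite rmorphD opprD addrACA pE qE mulrDr.
- exists (p' * q + lsub (hproj c) p * q').
  by rewrite rmorphM /= mulrDr mulrA -pE mulrCA -qE mulrBl mulrBr addrA subrK.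
Qed.

Lemma dvdm_lin c p : c != 0 -> lsub (hproj c) p = 0 -> dvdm (lin c) p.
Proof. by move=> c0 p0; have [q] := lsub_hproj c p; rewrite p0 subr0; exists q. Qed.

(** Modulo [lin c] the form [lin d] stays nonzero, and polynomials form a domain; so the factors
    [lin c] are split off [p] one at a time. *)
Lemma dvdm_expM_lin c d m p : c != 0 -> hproj c *m d != 0 ->
  dvdm (lin c ^+ m) (lin d * p) -> dvdm (lin c ^+ m) p.
Proof.
move=> c0 cd; elim: m => [|m IH] [q pq]; first by exists p; rewrite expr0 mul1r.
have [|r pr] := IH; first by exists (lin c * q); rewrite pq exprSr mulrA.
have lc0 : lin c != 0 by rewrite lin_eq0.
have lm0 : lin c ^+ m != 0 by rewrite expf_neq0.
have E : lin d * r = lin c * q.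
  by apply: (mulfI lm0); rewrite mulrCA -pr pq exprSr mulrA.
have [|r' rr'] := @dvdm_lin c r c0.
  have := congr1 (lsub (hproj c)) E; rewrite !rmorphM /= !lsub_lin hproj_self //.
  rewrite linear0 mul0r => /eqP; rewrite mulf_eq0 lin_eq0 (negbTE cd) /=.
  by move/eqP.
by exists r'; rewrite pr rr' exprSr mulrA.
Qed.

(** Proportional forms may repeat, so each form must divide [p] with its full multiplicity. Removing
    one factor lowers the exponent of the forms proportional to it and, by coprimality, leaves the
    others alone. *)
Lemma dvdm_prod_lin (cs : seq 'cV[K]_n) p : {in cs, forall c, c != 0} ->
  {in cs, forall c, dvdm (lin c ^+ count [pred d | hproj c *m d == 0] cs) p} ->
  dvdm (\prod_(c <- cs) lin c) p.
Proof.
elim: cs p => [|c cs IH] p cs0 csp; first by exists p; rewrite big_nil mul1r.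
have c0 : c != 0 by apply: cs0; rewrite mem_head.
have [q] := csp c (mem_head _ _); rewrite /= hproj_self // eqxx exprS -mulrA => pE.
have [||r qr] := IH (lin c ^+ count [pred d | hproj c *m d == 0] cs * q).
- by move=> d dcs; apply: cs0; rewrite inE dcs orbT.
- move=> d dcs; have d0 : d != 0 by apply: cs0; rewrite inE dcs orbT.
  have := csp d; rewrite inE dcs orbT => /(_ isT) /=.
  rewrite pE; set p1 := _ * q; have [/hprojE [a ca]|dc] := eqVneq (hproj d *m c) 0.
    case=> r; rewrite add1n exprS ca linearZ /= -scalerAl -mulrA.
    have a0 : a != 0 by apply: contraNneq c0 => a0; rewrite ca a0 scale0r.
    move=> E; exists (a^-1 *: r); apply: (mulfI (x := lin d)); first by rewrite lin_eq0.
    by rewrite -scalerAr -scalerAr -E scalerA mulVf // scale1r.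
  by rewrite add0n => /dvdm_expM_lin; apply.
by exists r; rewrite big_cons pE qr mulrA.
Qed.

End LinearForms.

Section Reflections.
Variables (K : fieldType) (n : nat) (gT : finGroupType).
Hypothesis charK0 : [pchar K] =i pred0.
Implicit Types (sigma : gT -> 'M[K]_n) (W : {group gT}).

Definition faithful_rep sigma :=
  [/\ sigma 1%g = 1%:M, {morph sigma : x y / (x * y)%g >-> x *m y} & injective sigma].

Definition dual_rep sigma g : 'M[K]_n := (sigma g^-1)^T%g.

Lemma faithful_dual sigma : faithful_rep sigma -> faithful_rep (dual_rep sigma).
Proof.
rewrite /dual_rep; case=> s1 sM sI; split=> [|x y|x y /trmx_inj /sI /invg_inj //].
  by rewrite invg1 s1 trmx1.
by rewrite invMg sM trmx_mul.
Qed.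

Lemma dual_repK sigma : dual_rep (dual_rep sigma) =1 sigma.
Proof. by move=> g; rewrite /dual_rep invgK trmxK. Qed.

Variable sigma : gT -> 'M[K]_n.
Hypothesis rep : faithful_rep sigma.
Let rep1 : sigma 1%g = 1%:M. Proof. by case: rep. Qed.
Let repM x y : sigma (x * y)%g = sigma x *m sigma y. Proof. by case: rep. Qed.

Lemma repKV x : sigma x *m sigma x^-1%g = 1%:M.
Proof. by rewrite -repM mulgV rep1. Qed.
Lemma repVK x : sigma x^-1%g *m sigma x = 1%:M.
Proof. by rewrite -repM mulVg rep1. Qed.

(** For a reflection this spans the image of [sigma s - 1]; as a linear form it defines the
    reflecting hyperplane in the space of rows. *)
Definition root_vec s : 'cV[K]_n :=
  if [pick j | col j (sigma s - 1%:M) != 0] is Some j then col j (sigma s - 1%:M) else 0.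

Lemma mulcr_eq0 (c : 'cV[K]_n) (r : 'rV[K]_n) : c != 0 -> c *m r = 0 -> r = 0.
Proof. by move=> c0 cr0; rewrite -[r]mul1mx -(dualrowE c0) -mulmxA cr0 mulmx0. Qed.

Lemma root_vecP s : is_reflection sigma s ->
  root_vec s != 0 /\ exists2 r : 'rV[K]_n, r != 0 & sigma s = 1%:M + root_vec s *m r.
Proof.
move=> /eqP rk1; rewrite /root_vec; set A := sigma s - 1%:M in rk1 *.
have -> : sigma s = 1%:M + A by rewrite addrC subrK.
case: pickP => [j cj|A0]; last first.
  suff A_0 : A = 0 by rewrite A_0 mxrank0 in rk1.
  apply/matrixP => i j; have /negbFE/eqP/colP/(_ i) := A0 j; by rewrite !mxE.
split=> //; have rkj : \rank (row j A^T) = 1%N.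
  by rewrite rank_rV -tr_col -trmx0 (inj_eq trmx_inj) cj.
have := mxrank_leqif_sup (row_sub j A^T); rewrite rkj mxrank_tr rk1.
case=> _; rewrite eqxx => /esym/submxP [D AD]; exists D^T; last first.
  by rewrite -[A in LHS]trmxK AD trmx_mul -tr_col trmxK.
apply/eqP => D0; move: rk1; rewrite -mxrank_tr AD.
by rewrite -[D]trmxK D0 trmx0 mul0mx mxrank0.
Qed.

Lemma is_reflectionE s (c : 'cV[K]_n) (r : 'rV[K]_n) :
  c != 0 -> r != 0 -> sigma s = 1%:M + c *m r ->
  is_reflection sigma s /\ exists2 a, a != 0 & root_vec s = a *: c.
Proof.
move=> c0 r0 sE; have sR : is_reflection sigma s.
  rewrite /is_reflection sE addrC addKr eqn_leq (leq_trans (mulmx_max_rank _ _)) //=.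
  by rewrite lt0n mxrank_eq0; apply: contraNneq r0 => /(mulcr_eq0 c0) ->.
split=> //; have [v0 [r' r'0]] := root_vecP sR; rewrite sE => /addrI E.
have [i ri] : exists i, r' 0 i != 0.
  apply/existsP; apply: contraNT r'0; rewrite negb_exists => /forallP r'0.
  by apply/eqP/rowP => i; rewrite mxE; apply/eqP; rewrite -[_ == _]negbK r'0.
exists (r 0 i / r' 0 i); last first.
  apply/colP => k; have /matrixP/(_ k i) := E; rewrite !mxE !big_ord1 => Ek.
  by rewrite mulrAC [r 0 i * _]mulrC Ek mulfK.
apply: contraNneq v0 => a0; apply/eqP/colP => k; have /matrixP/(_ k i) := E.
rewrite !mxE !big_ord1; move/eqP: a0; rewrite mulf_eq0 invr_eq0 (negbTE ri) orbF => /eqP->.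
by rewrite mulr0 => /esym/eqP; rewrite mulf_eq0 (negbTE ri) orbF => /eqP.
Qed.

Lemma thetaE (v : 'cV[K]_n) x a : v != 0 -> sigma x *m v = a *: v -> theta sigma v x = a.
Proof.
move=> v0 xv; rewrite /theta; case: pickP => [i vi|v_0]; first by rewrite xv !mxE mulfK.
case/eqP: v0; apply/colP => i; rewrite mxE; apply/eqP; by rewrite -[_ == _]negbK v_0.
Qed.

Definition zeta s : K := theta sigma (root_vec s) s.

Lemma zetaE s (c : 'cV[K]_n) (r : 'rV[K]_n) : c != 0 -> r != 0 -> sigma s = 1%:M + c *m r ->
  zeta s = 1 + (r *m c) 0 0.
Proof.
move=> c0 r0 sE; have [sR [a a0 rE]] := is_reflectionE c0 r0 sE.
apply: thetaE; first by rewrite rE scaler_eq0 negb_or a0.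
rewrite rE sE -scalemxAr mulmxDl mul1mx -mulmxA [r *m c]mx11_scalar mul_mx_scalar.
by rewrite scalerA mulrC -scalerA scalerDl scale1r !mxE eqxx mulr1n.
Qed.

(* A unipotent element of the form [1 + c r] with [r c = 0] has infinite order
   in characteristic 0. *)
Lemma rank1_eigen1 s (c : 'cV[K]_n) (r : 'rV[K]_n) :
  sigma s = 1%:M + c *m r -> r *m c = 0 -> s = 1%g.
Proof.
move=> sE rc0; have sX k : sigma (s ^+ k)%g = 1%:M + k%:R *: (c *m r).
  elim: k => [|k IH]; first by rewrite expg0 rep1 scale0r addr0.
  rewrite expgS repM IH sE mulmxDl mul1mx mulmxDr mulmx1 -scalemxAr.
  rewrite -mulmxA [r *m (c *m r)]mulmxA rc0 mul0mx mulmx0 scaler0 addr0.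
  by rewrite -addrA -natr1 scalerDl scale1r.
have := sX #[s]%g; rewrite expg_order rep1 => /esym/eqP.
rewrite addrC -subr_eq0 addrK scaler_eq0 (negbTE (natK_neq0 charK0 (order_gt0 s))) /=.
move/eqP=> cr0; case: rep => _ _ inj; apply: inj; by rewrite sE cr0 addr0 rep1.
Qed.

End Reflections.

(** * Products of root forms and divisibility of semi-invariants *)

Section Jacobian.
Variables (K : fieldType) (n : nat) (gT : finGroupType).
Hypothesis charK0 : [pchar K] =i pred0.
Variable sigma : gT -> 'M[K]_n.
Hypothesis rep : faithful_rep sigma.
Implicit Types (W : {group gT}) (c : 'cV[K]_n) (p : {mpoly K[n]}).
Let rep1 : sigma 1%g = 1%:M. Proof. by case: rep. Qed.
Let repM x y : sigma (x * y)%g = sigma x *m sigma y. Proof. by case: rep. Qed.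
Local Notation rootv := (root_vec sigma).

Definition refls (W : {set gT}) := [set s in W | is_reflection sigma s].
Definition jac (W : {set gT}) : {mpoly K[n]} := \prod_(s in refls W) lin (rootv s).

Lemma jac_neq0 W : jac W != 0.
Proof.
by apply/prodf_neq0 => s; rewrite inE => /andP[_ /root_vecP[c0 _]]; rewrite lin_eq0.
Qed.

Lemma reflection_conj g s : is_reflection sigma s ->
  is_reflection sigma (s ^ g)%g /\
  exists a, sigma g^-1%g *m rootv s = a *: rootv (s ^ g)%g.
Proof.
case/root_vecP => c0 [r r0 sE].
have gc0 : sigma g^-1%g *m rootv s != 0.
  apply: contraNneq c0 => gc0; rewrite -[rootv s]mul1mx -(repKV rep g) -mulmxA gc0.
  by rewrite mulmx0.
have rg0 : r *m sigma g != 0.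
  apply: contraNneq r0 => rg0; rewrite -[r]mulmx1 -(repKV rep g) mulmxA rg0.
  by rewrite mul0mx.
have sgE : sigma (s ^ g)%g = 1%:M + (sigma g^-1%g *m rootv s) *m (r *m sigma g).
  by rewrite conjgE !repM sE mulmxDl mulmxDr mul1mx repVK // !mulmxA.
have [sR [a a0 E]] := is_reflectionE gc0 rg0 sgE; split=> //.
by exists a^-1; rewrite E scalerA mulVf // scale1r.
Qed.

Lemma refls_conj (W : {set gT}) g s : g \in 'N(W)%g -> (s ^ g \in refls W)%g = (s \in refls W).
Proof.
move=> gN; rewrite !inE memJ_norm //; congr (_ && _).
apply/idP/idP => [/(reflection_conj g^-1)[]|/(reflection_conj g)[//]].
by rewrite conjgK.
Qed.

Lemma lsub_jac_norm (W : {set gT}) g : g \in 'N(W)%g ->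
  exists a, lsub (sigma g) (jac W) = a *: jac W.
Proof.
move=> gN; have gN' : g^-1%g \in 'N(W)%g by rewrite groupV.
have P s : exists a, s \in refls W ->
    sigma g *m rootv s = a *: rootv (s ^ g^-1)%g.
  have [sR|_] := boolP (s \in refls W); last by exists 0.
  move: sR; rewrite inE => /andP[_ /(reflection_conj g^-1)[_ [a]]].
  by rewrite invgK; exists a.
suff [a aE] : exists a : gT -> K, forall s, s \in refls W ->
    sigma g *m rootv s = a s *: rootv (s ^ g^-1)%g.
  exists (\prod_(s in refls W) a s); rewrite rmorph_prod /=.
  under eq_bigr => s sR do rewrite lsub_lin aE // linearZ /=.
  rewrite scaler_prod; congr (_ *: _); rewrite /jac [RHS](reindex_inj (conjg_inj g^-1%g)).
  by apply: eq_bigl => s; rewrite refls_conj.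
(* The dual row reads the scalar off, which chooses it for all reflections at once. *)
exists (fun s => ((dualrow (rootv (s ^ g^-1)%g)) *m (sigma g *m rootv s)) 0 0).
move=> s sR; have [a /(_ sR) aE] := P s; rewrite aE; congr (_ *: _).
rewrite -scalemxAr dualrowE ?mxE ?mulr1 //.
have : (s ^ g^-1)%g \in refls W by rewrite refls_conj.
by rewrite inE => /andP[_ /root_vecP[]].
Qed.

(** A ratio of leading coefficients gives a total function; it is a character on the normaliser of
    [W]. *)
Definition jchi (W : {set gT}) g : K := mleadc (lsub (sigma g) (jac W)) / mleadc (jac W).

Lemma lsub_jac (W : {group gT}) g : g \in 'N(W)%g ->
  lsub (sigma g) (jac W) = jchi W g *: jac W.
Proof.
case/lsub_jac_norm => a aE; rewrite /jchi aE.
have [->|a0] := eqVneq a 0; first by rewrite !scale0r mlead0 mcoeff0 mul0r scale0r.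
by rewrite mleadZ // mcoeffZ mulfK // mleadc_eq0 jac_neq0.
Qed.

Lemma scale_vect_inj (V : lmodType K) (v : V) : v != 0 -> injective ( *:%R^~ v).
Proof.
move=> v0 a b /eqP; rewrite -subr_eq0 -scalerBl scaler_eq0 (negbTE v0) orbF subr_eq0.
by move/eqP.
Qed.

Lemma jchiM W : {in 'N(W)%g &, {morph jchi W : x y / (x * y)%g >-> x * y}}.
Proof.
move=> x y xN yN; apply: (scale_vect_inj (jac_neq0 W)).
rewrite -lsub_jac ?groupM // repM lsubM (lsub_jac yN) linearZ /= lsub_jac //.
by rewrite scalerA mulrC.
Qed.

Lemma jchi1 W : jchi W 1%g = 1.
Proof.
by apply: (scale_vect_inj (jac_neq0 W)); rewrite -lsub_jac ?group1 // rep1 lsub1 scale1r.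
Qed.

Lemma jchi_neq0 W g : g \in 'N(W)%g -> jchi W g != 0.
Proof.
move=> gN; apply/eqP => g0; have := oner_neq0 K.
by rewrite -(jchi1 W) -(mulgV g) jchiM ?groupV // g0 mul0r eqxx.
Qed.

Lemma refl_neq1 W s : s \in refls W -> s != 1%g.
Proof.
rewrite inE => /andP[_]; apply: contraTneq => ->.
by rewrite /is_reflection rep1 subrr mxrank0.
Qed.

Section HyperplaneStabilizer.
Variables (W : {group gT}) (c : 'cV[K]_n).
Hypothesis c0 : c != 0.

(** The elements acting trivially modulo [lin c], that is, the pointwise stabiliser of the
    hyperplane of rows killed by [c]. Its eigenvalue on [c] embeds it into the roots of unity. *)
Definition hstab := [set t in W | hproj c *m (sigma t - 1%:M) == 0].

Lemma hstabP t : t \in hstab -> exists r : 'rV[K]_n, sigma t = 1%:M + c *m r.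
Proof.
rewrite inE => /andP[_]; rewrite mulmxBl mul1mx -mulmxA subr_eq0 => /eqP E.
by exists (dualrow c *m (sigma t - 1%:M)); rewrite -E addrC subrK.
Qed.

Lemma hproj_rep t : t \in hstab -> hproj c *m sigma t = hproj c.
Proof.
by rewrite inE mulmxBr mulmx1 subr_eq0 => /andP[_ /eqP].
Qed.

Lemma hstab_group_set : group_set hstab.
Proof.
apply/group_setP; split=> [|x y xT yT]; first by rewrite inE group1 rep1 subrr mulmx0 eqxx.
rewrite inE repM mulmxBr mulmx1 mulmxA !hproj_rep // subrr eqxx andbT.
by move: xT yT; rewrite !inE => /andP[xW _] /andP[yW _]; rewrite groupM.
Qed.
Canonical hstab_group := Group hstab_group_set.

Local Notation zc := (theta sigma c).

Lemma hstab_eigen t : t \in hstab -> sigma t *m c = zc t *: c.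
Proof.
move=> /hstabP[r tE]; suff E : sigma t *m c = (1 + (r *m c) 0 0) *: c.
  by rewrite E (thetaE _ E).
by rewrite tE mulmxDl mul1mx -mulmxA [r *m c]mx11_scalar mul_mx_scalar scalerDl scale1r !mxE.
Qed.

Lemma hstab_zcM : {in hstab &, {morph zc : x y / (x * y)%g >-> x * y}}.
Proof.
move=> x y xT yT; apply: (scale_vect_inj c0).
rewrite -hstab_eigen ?(groupM (G := hstab_group)) //.
by rewrite repM -mulmxA (hstab_eigen yT) -scalemxAr hstab_eigen // scalerA mulrC.
Qed.

Lemma hstab_zc1 : zc 1%g = 1.
Proof. by apply: thetaE => //; rewrite rep1 mul1mx scale1r. Qed.

Lemma hstab_zc_eq1 t : t \in hstab -> zc t = 1 -> t = 1%g.
Proof.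
move=> tT z1; have [r tE] := hstabP tT; apply: (rank1_eigen1 charK0 rep tE).
have := hstab_eigen tT; rewrite z1 scale1r tE mulmxDl mul1mx -mulmxA => /eqP.
rewrite addrC -subr_eq0 addrK => /eqP.
rewrite [r *m c]mx11_scalar mul_mx_scalar => /eqP.
by rewrite scaler_eq0 (negbTE c0) orbF => /eqP ->; rewrite raddf0.
Qed.

Lemma hstab_zc_neq0 t : t \in hstab -> zc t != 0.
Proof.
move=> tT; apply/eqP => z0; have := oner_neq0 K; rewrite -hstab_zc1 -(mulgV t).
by rewrite hstab_zcM ?(groupV hstab_group) // z0 mul0r eqxx.
Qed.

Lemma hstab_zc_inj : {in hstab &, injective zc}.
Proof.
move=> x y xT yT xy; have yT' : y^-1%g \in hstab by rewrite (groupV hstab_group).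
apply/eqP; rewrite eq_mulgV1; apply/eqP; apply: hstab_zc_eq1.
  by rewrite (groupM (G := hstab_group)).
by rewrite hstab_zcM // xy -hstab_zcM // mulgV hstab_zc1.
Qed.

Lemma hstab_zcX t : t \in hstab -> zc t ^+ #|hstab| = 1.
Proof.
move=> tT; have zX k : zc (t ^+ k)%g = zc t ^+ k.
  elim: k => [|k IH]; first by rewrite expg0 hstab_zc1.
  by rewrite expgS exprS hstab_zcM ?IH // (groupX (G := hstab_group)).
have /dvdnP[k ->] : (#[t]%g %| #|hstab|)%N.
  by rewrite -[X in (_ %| X)%N]/(#|hstab_group|) cardSg // cycle_subG.
by rewrite mulnC exprM -zX expg_order hstab_zc1 expr1n.
Qed.

Lemma hstab_zeta t : t \in hstab -> t != 1%g -> is_reflection sigma t /\ zeta sigma t = zc t.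
Proof.
move=> tT t1; have [r tE] := hstabP tT.
have r0 : r != 0.
  apply: contraNneq t1 => r0; case: rep => _ _ inj; apply/eqP/inj.
  by rewrite tE r0 mulmx0 addr0 rep1.
have [tR _] := is_reflectionE c0 r0 tE; split=> //; rewrite (zetaE c0 r0 tE).
apply/esym/thetaE => //; rewrite tE mulmxDl mul1mx -mulmxA [r *m c]mx11_scalar.
by rewrite mul_mx_scalar scalerDl scale1r !mxE.
Qed.

Lemma refls_hstab t : t \in refls W -> (t \in hstab) = (hproj c *m rootv t == 0).
Proof.
rewrite !inE => /andP[-> /root_vecP[v0 [r r0 tE]]] /=.
rewrite tE [1%:M + _]addrC addrK mulmxA; apply/eqP/eqP => [cvr|->]; last by rewrite mul0mx.
apply/eqP; apply: contraTT isT => cv0; by move: r0; rewrite (mulcr_eq0 cv0 cvr) eqxx.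
Qed.

(** The nontrivial elements of the stabiliser are exactly the reflections with root proportional to
    [c], so the multiplicity of [lin c] in [jac W] is the order of the stabiliser minus one. *)
Lemma card_refls_hstab : #|[set t in refls W | hproj c *m rootv t == 0]|.+1 = #|hstab|.
Proof.
rewrite (cardsD1 1%g hstab) (group1 hstab_group) add1n; congr (_.+1); apply: eq_card => t.
rewrite [LHS]inE; case: (boolP (t \in refls W)) => tW /=.
  by rewrite -refls_hstab // in_setD1 (refl_neq1 tW).
apply/esym/negbTE; apply: contra tW; rewrite !inE => /andP[t1 tT].
have tW : t \in W by case/andP: tT.
rewrite tW; apply: (hstab_zeta _ t1).1; by rewrite inE.
Qed.

End HyperplaneStabilizer.

Lemma hstab_self W s : s \in refls W -> s \in hstab W (rootv s).
Proof.
move=> sW; have sW' := sW; move: sW'; rewrite inE => /andP[_ /root_vecP[v0 _]].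
by rewrite refls_hstab // hproj_self.
Qed.

Lemma zeta_root W s : s \in refls W -> zeta sigma s != 0 /\
  sigma s *m rootv s = zeta sigma s *: rootv s.
Proof.
move=> sW; have v0 : rootv s != 0 by move: sW; rewrite inE => /andP[_ /root_vecP[]].
have sT := hstab_self sW.
by split; [exact (hstab_zc_neq0 v0 sT)|exact (hstab_eigen v0 sT)].
Qed.

(** Let e be the order of the hyperplane stabiliser. The e - 1 factors proportional to the root
    contribute zeta^(e-1) = zeta^-1. The product of the others is nonzero and unchanged modulo the
    root form, so it contributes 1. *)
Lemma jchi_refl W s : s \in refls W -> jchi W s = (zeta sigma s)^-1.
Proof.
move=> sW; have v0 : rootv s != 0 by move: sW; rewrite inE => /andP[_ /root_vecP[]].
set c := rootv s in v0; have sT : s \in hstab W c := hstab_self sW.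
have sN : s \in 'N(W)%g by apply: (subsetP (normG W)); move: sW; rewrite inE => /andP[].
have [z0 sc] := zeta_root sW.
pose A := \prod_(t in refls W | hproj c *m rootv t == 0) lin (rootv t).
pose B := \prod_(t in refls W | hproj c *m rootv t != 0) lin (rootv t).
have JAB : jac W = A * B by rewrite /jac (bigID (fun t => hproj c *m rootv t == 0)).
have sA : lsub (sigma s) A = zeta sigma s ^+ #|hstab W c|.-1 *: A.
  rewrite rmorph_prod -(card_refls_hstab W v0) -prodr_const /=.
  have -> : A = \prod_(t in [set t in refls W | hproj c *m rootv t == 0]) lin (rootv t).
    by apply: eq_bigl => t; rewrite [RHS]inE.
  rewrite -scaler_prod; apply: eq_big => t; first by rewrite [RHS]inE.
  case/andP => tW /eqP/hprojE[a tE]; rewrite lsub_lin tE -scalemxAr sc.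
  by rewrite scalerA mulrC -scalerA linearZ.
have sB : lsub (hproj c) (lsub (sigma s) B) = lsub (hproj c) B.
  by rewrite -lsubM (hproj_rep sT).
have B0 : lsub (hproj c) B != 0.
  rewrite rmorph_prod; apply/prodf_neq0 => t /andP[_].
  by rewrite /= lsub_lin lin_eq0.
have A0 : A != 0.
  by have := jac_neq0 W; rewrite JAB mulf_eq0 negb_or => /andP[].
have := lsub_jac sN; rewrite JAB rmorphM /= sA -scalerAl !scalerAr.
move=> /(mulfI A0) /(congr1 (lsub (hproj c))); rewrite !linearZ /= sB.
move=> /(scale_vect_inj B0) <-; apply: (mulfI z0).
rewrite -exprS prednK ?(cardG_gt0 (hstab_group W c)) // mulfV //.
have s1 := refl_neq1 sW.
by have [_ ->] := hstab_zeta v0 sT s1; rewrite hstab_zcX.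
Qed.

(** Write p = (lin d)^k q with [q] nonzero modulo [lin d]. Semi-invariance, read modulo [lin d],
    gives z^(k+1) = 1 for each eigenvalue z of the hyperplane stabiliser on [d]. These eigenvalues
    are distinct, so the stabiliser has at most k + 1 elements and [lin d] already occurs often
    enough. *)
Lemma jac_dvd W p :
  (forall s, s \in refls W -> lsub (sigma s) p = (zeta sigma s)^-1 *: p) ->
  dvdm (jac W) p.
Proof.
move=> ps; rewrite /jac -big_enum -(big_map rootv predT (@lin K n)).
apply: dvdm_prod_lin => c /mapP[s]; rewrite mem_enum => sW ->; have := sW.
  by rewrite inE => /andP[_ /root_vecP[]].
rewrite inE => /andP[_ /root_vecP[c0 _]]; set d := rootv s in c0 *.
rewrite count_map.
have -> : count (preim rootv [pred d0 | hproj d *m d0 == 0]) (enum (refls W)) = #|hstab W d|.-1.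
  rewrite -(card_refls_hstab W c0) /= cardE -size_filter.
  rewrite /enum_mem -!filter_predI; congr size; apply: eq_filter => t /=.
  by rewrite [RHS]inE andbC.
suff H k : (k < #|hstab W d|)%N -> dvdm (lin d ^+ k) p.
  by apply: H; rewrite ltn_predL (cardG_gt0 (hstab_group W d)).
elim: k => [_|k IH kT]; first by exists p; rewrite expr0 mul1r.
have [q pq] := IH (ltnW kT).
suff [r qr] : dvdm (lin d) q by exists r; rewrite pq qr exprSr mulrA.
apply: dvdm_lin => //; apply/eqP; apply: contraTT kT => b0; rewrite -leqNgt.
have ld0 : lin d ^+ k != 0 by rewrite expf_neq0 // lin_eq0.
pose rs := [seq theta sigma d t | t <- enum (hstab W d)].
have -> : #|hstab W d| = size rs by rewrite size_map -cardE.
apply: (@max_unity_roots _ k.+1 rs) => //; last first.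
  by rewrite map_inj_in_uniq ?enum_uniq // => x y; rewrite !mem_enum; apply: hstab_zc_inj.
apply/allP => z /mapP[t]; rewrite mem_enum => tT ->{z}; rewrite unity_rootE.
have z0 := hstab_zc_neq0 c0 tT.
have tp : lsub (sigma t) p = (theta sigma d t)^-1 *: p.
  have [->|t1] := eqVneq t 1%g; first by rewrite rep1 lsub1 hstab_zc1 // invr1 scale1r.
  have [tR <-] := hstab_zeta c0 tT t1; apply: ps; rewrite inE tR andbT.
  by move: tT; rewrite inE => /andP[].
move: tp; rewrite pq rmorphM rmorphXn /= lsub_lin (hstab_eigen c0 tT) linearZ /=.
rewrite exprZn -scalerAl !scalerAr => /(mulfI ld0) /(congr1 (lsub (hproj d))).
rewrite !linearZ /= -lsubM (hproj_rep tT) => /(scale_vect_inj b0) E.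
by rewrite exprSr E mulVf.
Qed.

End Jacobian.

(** * Coinvariants and harmonic polynomials *)

Section Order.
Variables (K : fieldType) (n : nat).
Implicit Types (p q f : {mpoly K[n]}) (m : 'X_{1..n}).

Definition order_ge d p := forall m, (mdeg m < d)%N -> p@_m = 0.

Lemma msize_leP k p : (forall m, (k <= mdeg m)%N -> p@_m = 0) -> (msize p <= k)%N.
Proof.
move=> pk; rewrite msizeE; apply/bigmax_leqP_seq => m mp _.
by rewrite ltnNge; apply: contraL mp => /pk/eqP; rewrite mcoeff_eq0.
Qed.

Lemma mcoeff_msize p m : (msize p <= mdeg m)%N -> p@_m = 0.
Proof. by move=> pm; apply: memN_msupp_eq0; apply: msize_mdeg_ge. Qed.

Lemma msize_Dop_lt p f : p@_0%MM = 0 -> f != 0 -> (msize (Dop p f) < msize f)%N.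
Proof.
move=> p0 f0; rewrite (mpolySpred mdeg f0) ltnS; apply: msize_leP => m fm.
rewrite /Dop raddf_sum /= big_seq big1 // => m' m'p.
rewrite mcoeffZ mcoeff_mderivm (@mcoeff_msize f) ?mul0rn ?mulr0 //.
have m'0 : m' != 0%MM by apply: contraTneq m'p => ->; rewrite mcoeff_msupp p0 eqxx.
rewrite mdegD; rewrite -mdeg_eq0 -lt0n in m'0.
rewrite (mpolySpred mdeg f0); exact: (leq_add m'0 fm).
Qed.

Lemma msize_Dop p f : (msize (Dop p f) <= msize f)%N.
Proof.
apply: msize_leP => m fm; rewrite /Dop raddf_sum /= big1 // => m' _.
rewrite mcoeffZ mcoeff_mderivm (@mcoeff_msize f) ?mul0rn ?mulr0 //.
by rewrite mdegD (leq_trans fm) // leq_addl.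
Qed.

Lemma order_geM d e p q : order_ge d p -> order_ge e q -> order_ge (d + e) (p * q).
Proof.
move=> pd qe m md; rewrite mcoeffM big1 // => -[m1 m2] /= /eqP mE.
have [/pd->|dm1] := ltnP (mdeg m1) d; first by rewrite mul0r.
have [/qe->|em2] := ltnP (mdeg m2) e; first by rewrite mulr0.
have mE' : mdeg m = (mdeg m1 + mdeg m2)%N by rewrite -mdegD -mE.
by have := leq_trans md (leq_add dm1 em2); rewrite -mE' ltnn.
Qed.

Lemma order_geX d p k : order_ge d p -> order_ge (k * d) (p ^+ k).
Proof.
by move=> pd; elim: k => [//|k IH]; rewrite exprS mulSn; apply: order_geM.
Qed.

End Order.

Section SemiInvariants.
Variables (K : fieldType) (n : nat) (gT : finGroupType).
Hypothesis charK0 : [pchar K] =i pred0.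
Variable sigma : gT -> 'M[K]_n.
Hypothesis rep : faithful_rep sigma.
Implicit Types (p q f : {mpoly K[n]}).
Let rep1 : sigma 1%g = 1%:M. Proof. by case: rep. Qed.
Let repM x y : sigma (x * y)%g = sigma x *m sigma y. Proof. by case: rep. Qed.
Local Notation tau := (dual_rep sigma).

Definition minvariant (W : {set gT}) q := forall w, w \in W -> lsub (sigma w) q = q.

Lemma lsub_rep1 p : lsub (sigma 1%g) p = p. Proof. by rewrite rep1 lsub1. Qed.

Lemma lsub_repK g : cancel (lsub (sigma g)) (lsub (sigma g^-1)%g).
Proof. by move=> p; rewrite -lsubM repVK // lsub1. Qed.

Lemma lsub_repVK g : cancel (lsub (sigma g^-1)%g) (lsub (sigma g)).
Proof. by move=> p; rewrite -lsubM repKV // lsub1. Qed.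

Lemma invariantD (W : {set gT}) p q : minvariant W p -> minvariant W q -> minvariant W (p + q).
Proof. by move=> pI qI w wW; rewrite rmorphD /= pI ?qI. Qed.

Lemma invariantC (W : {set gT}) a : minvariant W a%:MP.
Proof. by move=> w _; rewrite lsubC. Qed.

Lemma invariant_norm (W : {group gT}) g q : g \in 'N(W)%g -> minvariant W q ->
  minvariant W (lsub (sigma g) q).
Proof.
move=> gN qI w wW; rewrite -lsubM -repM.
have -> : (w * g = g * w ^ g)%g by rewrite conjgE !mulgA mulgV mul1g.
by rewrite repM lsubM qI // memJ_norm.
Qed.

Lemma reflection_dual s : is_reflection sigma s ->
  is_reflection tau s /\ zeta tau s = (zeta sigma s)^-1.
Proof.
move=> sR; have [c0 [r r0 sE]] := root_vecP sR.
have sG : s \in refls sigma [set: gT] by rewrite inE sR in_setT.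
have [z0 _] := zeta_root rep (W := [set: gT]%G) sG.
have zE := zetaE c0 r0 sE; set c := root_vec sigma s in c0 sE zE *.
set z := zeta sigma s in z0 zE *.
have rc : r *m c = (z - 1)%:M by rewrite zE addrC addKr -mx11_scalar.
(* The inverse of 1 + c r is 1 - z^-1 c r, because r c = z - 1. *)
have sV : sigma s^-1%g = 1%:M - z^-1 *: (c *m r).
  rewrite -[LHS]mul1mx -[X in X *m _](_ : (1%:M - z^-1 *: (c *m r)) *m sigma s = _).
    by rewrite -mulmxA repKV // mulmx1.
  rewrite sE mulmxDr mulmx1 mulmxBl mul1mx -scalemxAl -mulmxA (mulmxA r) rc.
  rewrite mul_scalar_mx -scalemxAr scalerA mulrBr mulVf // mulr1 scalerBl scale1r.
  by rewrite addrACA -opprD addrCA subrr addr0 addrK.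
have rT0 : r^T != 0 by rewrite -trmx0 (inj_eq trmx_inj).
have cT0 : - z^-1 *: c^T != 0.
  by rewrite scaler_eq0 oppr_eq0 invr_eq0 (negbTE z0) -trmx0 (inj_eq trmx_inj).
have tE : tau s = 1%:M + r^T *m (- z^-1 *: c^T).
  by rewrite /dual_rep sV linearB /= trmx1 linearZ /= trmx_mul -scalemxAr scaleNr.
split; first by have [] := is_reflectionE rT0 cT0 tE.
rewrite (zetaE rT0 cT0 tE) -scalemxAl -trmx_mul rc tr_scalar_mx !mxE eqxx mulr1n.
by rewrite mulNr mulrBr mulVf // mulr1 opprB addrCA subrr addr0.
Qed.

Section ReflectionGroup.
Variable W : {group gT}.
Hypothesis Wgen : W :=: (<<refls sigma W>>)%g.
Local Notation J' := (jac sigma W).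
Local Notation chi' := (jchi sigma W).
Let WN := subsetP (normG W).

Lemma refls_ind (P : gT -> Prop) : P 1%g ->
  (forall x y, x \in W -> y \in W -> P x -> P y -> P (x * y)%g) ->
  (forall s, s \in refls sigma W -> P s) -> forall g, g \in W -> P g.
Proof.
move=> P1 PM PR g; rewrite {1}Wgen => /gen_prodgP[k [c cR ->]].
suff [] : (\prod_(i < k) c i)%g \in W /\ P (\prod_(i < k) c i)%g by [].
apply: (big_ind (fun x => x \in W /\ P x)) => [|x y [xW Px] [yW Py]|i _].
- by rewrite group1.
- by rewrite groupM //; split=> //; apply: PM.
- by split; [move: (cR i); rewrite inE => /andP[]|apply: PR].
Qed.

Lemma semi_dvd p : (forall g, g \in W -> lsub (sigma g) p = chi' g *: p) ->
  exists2 q, minvariant W q & p = J' * q.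
Proof.
move=> ps; have [|q pE] := @jac_dvd _ _ _ charK0 _ rep W p.
  move=> s sR; rewrite -(jchi_refl rep sR) ps //.
  by move: sR; rewrite inE => /andP[].
exists q => // w wW; have := ps w wW; rewrite pE rmorphM /= lsub_jac ?WN //.
rewrite -!scalerAl => /(scalerI (jchi_neq0 rep (WN wW))).
by move/(mulfI (jac_neq0 sigma W)).
Qed.

End ReflectionGroup.
End SemiInvariants.

Lemma reflection_dualE (K : fieldType) n (gT : finGroupType) (sigma : gT -> 'M[K]_n) :
  faithful_rep sigma -> is_reflection (dual_rep sigma) =1 is_reflection sigma.
Proof.
move=> rep s; apply/idP/idP; last by case/(reflection_dual rep).
by case/(reflection_dual (faithful_dual rep)); rewrite /is_reflection dual_repK.
Qed.

Section Coinvariants.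
Variables (K : fieldType) (n : nat) (gT : finGroupType).
Hypothesis charK0 : [pchar K] =i pred0.
Variable sigma : gT -> 'M[K]_n.
Hypothesis rep : faithful_rep sigma.
Implicit Types (p q f : {mpoly K[n]}).
Let rep1 : sigma 1%g = 1%:M. Proof. by case: rep. Qed.
Let repM x y : sigma (x * y)%g = sigma x *m sigma y. Proof. by case: rep. Qed.
Local Notation tau := (dual_rep sigma).
Let trep : faithful_rep tau := faithful_dual rep.

(** Invariance is imposed on symbols instead of commutation on operators; [harmonicE] identifies the
    two conditions. *)
Definition harm (W : {set gT}) f :=
  forall q, minvariant sigma W q -> q@_0%MM = 0 -> Dop q f = 0.

Lemma Dop_rep g p f : Dop (lsub (sigma g) p) (lsub (tau g) f) = lsub (tau g) (Dop p f).
Proof. by rewrite Dop_lsub /dual_rep trmxK lsub_repK. Qed.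

Lemma pair_rep g p f : pair (lsub (sigma g) p) (lsub (tau g) f) = pair p f.
Proof. by rewrite /pair Dop_rep mcoeff0_lsub. Qed.

Lemma harm_linear (W : {set gT}) a f g : harm W f -> harm W g -> harm W (a *: f + g).
Proof. by move=> fH gH q qI q0; rewrite linearP /= fH // gH // scaler0 addr0. Qed.

Lemma harm0 (W : {set gT}) : harm W 0. Proof. by move=> q _ _; rewrite linear0. Qed.

Lemma harm_sum (W : {set gT}) (I : Type) (r : seq I) (P : pred I) (F : I -> {mpoly K[n]}) :
  (forall i, P i -> harm W (F i)) -> harm W (\sum_(i <- r | P i) F i).
Proof.
move=> FH; apply: big_ind => // [|f g fH gH]; first exact: harm0.
by rewrite -[f]scale1r; apply: harm_linear.
Qed.

Lemma harm_scale (W : {set gT}) a f : harm W f -> harm W (a *: f).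
Proof. by move=> fH; rewrite -[_ *: _]addr0; apply: harm_linear => //; apply: harm0. Qed.

Lemma harm_Dop (W : {set gT}) p f : harm W f -> harm W (Dop p f).
Proof. by move=> fH q qI q0; rewrite DopCA fH // linear0. Qed.

Lemma harm_inv (W : {set gT}) q f : harm W f -> minvariant sigma W q -> Dop q f = q@_0%MM *: f.
Proof.
move=> fH qI; rewrite -[q in LHS](subrK (q@_0%MM)%:MP) DopDl DopC fH ?add0r //.
  rewrite -mpolyCN; apply: invariantD => //; exact: invariantC.
by rewrite mcoeffB mcoeffC eqxx mulr1 subrr.
Qed.

Lemma harm_norm (W : {group gT}) g f : g \in 'N(W)%g -> harm W f -> harm W (lsub (tau g) f).
Proof.
move=> gN fH q qI q0; have -> : q = lsub (sigma g) (lsub (sigma g^-1)%g q).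
  by rewrite lsub_repVK.
rewrite Dop_rep fH ?linear0 //; last by rewrite mcoeff0_lsub.
by apply: invariant_norm; rewrite ?groupV.
Qed.

(** The ideal generated by the invariants without constant term, whose quotient is the coinvariant
    algebra. *)
Inductive coinv (W : {set gT}) : {mpoly K[n]} -> Prop :=
| coinv_gen q : minvariant sigma W q -> q@_0%MM = 0 -> coinv W q
| coinv_add p q : coinv W p -> coinv W q -> coinv W (p + q)
| coinv_mul r p : coinv W p -> coinv W (r * p).

Lemma coinv0 (W : {set gT}) : coinv W 0.
Proof. by apply: coinv_gen; rewrite ?mcoeff0 // => w _; rewrite linear0. Qed.

Lemma coinv_sum (W : {set gT}) (I : Type) (r : seq I) (P : pred I) (F : I -> {mpoly K[n]}) :
  (forall i, P i -> coinv W (F i)) -> coinv W (\sum_(i <- r | P i) F i).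
Proof.
by move=> FH; apply: big_ind => //; [apply: coinv0|apply: coinv_add].
Qed.

Lemma coinv_scale (W : {set gT}) a p : coinv W p -> coinv W (a *: p).
Proof. by rewrite -mul_mpolyC; apply: coinv_mul. Qed.

Lemma coinv_harm (W : {set gT}) p f : harm W f -> coinv W p -> Dop p f = 0.
Proof.
move=> fH; elim=> [q qI q0|{}p q _ pf _ qf|r {}p _ pf]; first exact: fH.
  by rewrite DopDl pf qf addr0.
by rewrite DopM pf linear0.
Qed.

Lemma coinv_rep (W : {set gT}) g p : g \in W -> coinv W p -> coinv W (lsub (sigma g) p).
Proof.
move=> gW; elim=> [q qI q0|{}p q _ pI _ qI|r {}p _ pI].
- by rewrite qI //; apply: coinv_gen.
- by rewrite rmorphD /=; apply: coinv_add.
- by rewrite rmorphM /=; apply: coinv_mul.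
Qed.

Section Nilpotent.
Variable W : {group gT}.

(** The variable is a root of its orbit polynomial [Q]. Taking constant terms turns [Q] into a pure
    power, so its lower coefficients are invariants without constant term, and the leading power
    lies in the ideal. *)
Lemma coinv_Xn i : coinv W ('X_i ^+ #|W|).
Proof.
pose F g := 'X - (lsub (sigma g) 'X_i)%:P.
pose Q := \prod_(g in W) F g.
have Qinv j : minvariant sigma W Q`_j.
  move=> w wW; rewrite -coef_map /=; suff -> : map_poly (lsub (sigma w)) Q = Q by [].
  rewrite rmorph_prod /=.
  rewrite /Q [RHS](reindex_inj (mulgI w)) /=; apply: eq_big => [g|g _].
    by rewrite groupMl.
  by rewrite rmorphB /= map_polyX map_polyC /= -lsubM -repM.
have Q0 : map_poly (mcoeff 0%MM) Q = 'X^#|W|.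
  rewrite rmorph_prod /= -prodr_const; apply: eq_bigr => g _.
  rewrite rmorphB /= map_polyX map_polyC /= mcoeff0_lsub mcoeffX mnm1_eq0.
  by rewrite polyC0 subr0.
have QE : Q = \prod_(a <- [seq lsub (sigma g) 'X_i | g <- enum W]) ('X - a%:P).
  by rewrite big_map big_enum.
have szQ : size Q = #|W|.+1 by rewrite QE size_prod_XsubC size_map -cardE.
have /monicP := monic_prod_XsubC [seq lsub (sigma g) 'X_i | g <- enum W] predT id.
rewrite -QE lead_coefE szQ /= => Qlead.
have : Q.['X_i] = 0.
  apply/eqP; rewrite -[_ == 0]/(root Q _) QE root_prod_XsubC; apply/mapP; exists 1%g.
    by rewrite mem_enum group1.
  by rewrite lsub_rep1.
rewrite horner_coef szQ big_ord_recr /= Qlead mul1r addrC => /eqP.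
rewrite addr_eq0 => /eqP ->; rewrite -sumrN; apply: coinv_sum => j _.
rewrite -scaleN1r mulrC; apply: coinv_scale; apply: coinv_mul; apply: coinv_gen => //.
rewrite -(coef_map (mcoeff 0%MM)) /= Q0 coefXn eqn_leq [(_ <= j)%N]leqNgt ltn_ord andbF.
by [].
Qed.

(** Pigeonhole: in a monomial of degree above [n * #|W|], some exponent reaches [#|W|]. *)
Lemma coinv_order p : order_ge (n * #|W|).+1 p -> coinv W p.
Proof.
move=> pn; rewrite [p]mpolyE big_seq; apply: coinv_sum => m mp; apply: coinv_scale.
have mn : (n * #|W| < mdeg m)%N.
  by rewrite ltnNge -ltnS; apply: contraL mp => /pn/eqP; rewrite mcoeff_eq0.
have [i mi] : exists i, (#|W| <= m i)%N.
  apply/existsP; apply: contraTT mn; rewrite negb_exists -leqNgt => /forallP mW.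
  rewrite mdegE; apply: leq_trans (_ : \sum_(i < n) #|W| <= _)%N.
    by apply: leq_sum => i _; rewrite ltnW // ltnNge mW.
  by rewrite sum_nat_const card_ord.
have -> : m = (m - U_(i) *+ #|W| + U_(i) *+ #|W|)%MM.
  rewrite submK //; apply/mnm_lepP => j; rewrite mulmnE mnm1E.
  by case: eqP => [<-|_]; rewrite ?mul1n ?mul0n.
by rewrite mpolyXD -mpolyXn; apply: coinv_mul; apply: coinv_Xn.
Qed.

End Nilpotent.

Section ReflectionGroup.
Variable W : {group gT}.
Hypothesis Wgen : W :=: (<<refls sigma W>>)%g.
Local Notation J := (jac tau W).
Local Notation J' := (jac sigma W).
Local Notation chi := (jchi tau W).
Local Notation chi' := (jchi sigma W).
Let WN := subsetP (normG W).

Lemma refls_dual (V : {set gT}) : refls tau V = refls sigma V.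
Proof. by apply/setP => s; rewrite !inE reflection_dualE. Qed.

Lemma chi_dual g : g \in W -> chi' g * chi g = 1.
Proof.
apply: (refls_ind Wgen (P := fun g => chi' g * chi g = 1)) => [|x y xW yW px py|s sR].
- by rewrite !jchi1 // mul1r.
- by rewrite !jchiM ?WN // mulrACA px py mul1r.
- have sR' : s \in refls tau W by rewrite refls_dual.
  rewrite (jchi_refl rep sR) (jchi_refl trep sR').
  have [_ ->] : is_reflection tau s /\ zeta tau s = (zeta sigma s)^-1.
    by apply: reflection_dual; move: sR; rewrite inE => /andP[].
  by rewrite divff // invr_eq0; case: (zeta_root rep sR).
Qed.

Lemma jac_semi g : g \in W -> lsub (tau g) J = chi g *: J.
Proof. by move=> gW; rewrite lsub_jac ?WN. Qed.

(** An invariant operator preserves the character of [J], so its value is a multiple of [J]; as the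
    degree drops, this value is 0. *)
Lemma jac_harm : harm W J.
Proof.
move=> q qI q0; have [|r _ DE] := semi_dvd charK0 trep (W := W) (p := Dop q J).
  by move=> g gW; rewrite -Dop_rep qI // jac_semi // linearZ.
rewrite DE; apply/eqP; rewrite mulf_eq0 (negbTE (jac_neq0 _ _)) /=.
apply: contraT => r0; have := msize_Dop_lt q0 (jac_neq0 tau W).
by rewrite DE msizeM ?jac_neq0 // ltnNge (mpolySpred mdeg r0) addnS leq_addr.
Qed.

Definition semi_avg p := #|W|%:R^-1 *: \sum_(g in W) (chi' g)^-1 *: lsub (sigma g) p.

Lemma cardW_neq0 : #|W|%:R != 0 :> K. Proof. exact: natK_neq0. Qed.

Lemma semi_avgP p g : g \in W -> lsub (sigma g) (semi_avg p) = chi' g *: semi_avg p.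
Proof.
move=> gW; rewrite /semi_avg linearZ /= [RHS]scalerA [chi' g * _]mulrC -[RHS]scalerA.
congr (_ *: _).
rewrite linear_sum scaler_sumr [RHS](reindex_inj (mulgI g)) /=; apply: eq_big => [h|h hW].
  by rewrite groupMl.
rewrite linearZ /= -lsubM -repM jchiM ?WN // (invfM (chi' g)) scalerA mulVKf //.
by rewrite jchi_neq0 ?WN.
Qed.

Lemma pair_semi_avg p : pair (semi_avg p) J = pair p J.
Proof.
rewrite /semi_avg pairZl pair_suml (eq_bigr (fun=> pair p J)) => [|g gW].
  by rewrite sumr_const -(mulr_natl (pair p J)) mulKf // cardW_neq0.
have c0 := jchi_neq0 rep (WN gW).
have JE : J = chi' g *: lsub (tau g) J by rewrite jac_semi // scalerA chi_dual // scale1r.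
by rewrite pairZl {1}JE linearZ /= pair_rep mulKf.
Qed.

(** Were it 0, all pairings with [J] would vanish: average the symbol to a semi-invariant, write
    that as [J'] times an invariant, and let the invariant act on the harmonic [J] by its constant
    term. *)
Lemma pair_jac_neq0 : pair J' J != 0.
Proof.
apply/eqP => J0; have /eqP := jac_neq0 tau W; apply; apply: (pair_inj charK0) => p.
rewrite -pair_semi_avg; have [q qI ->] := semi_dvd charK0 rep (semi_avgP p).
by rewrite pairM (harm_inv jac_harm qI) linearZ /= J0 mulr0.
Qed.

(** The divided difference along a root preserves the ideal: it kills invariants and obeys a twisted
    Leibniz rule. *)
Lemma coinv_demazure s p : s \in refls sigma W -> coinv W p ->
  exists2 w, coinv W w & p - lsub (sigma s) p = lin (root_vec sigma s) * w.
Proof.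
move=> sR; have sW : s \in W by move: sR; rewrite inE => /andP[].
have c0 : root_vec sigma s != 0 by move: sR; rewrite inE => /andP[_ /root_vecP[]].
elim=> [q qI _|{}p q _ [w wI pE] _ [w' w'I qE]|r {}p pI [w wI pE]].
- by exists 0; [apply: coinv0|rewrite qI // subrr mulr0].
- by exists (w + w'); [apply: coinv_add|rewrite rmorphD opprD addrACA pE qE mulrDr].
have [t rE] : dvdm (lin (root_vec sigma s)) (r - lsub (sigma s) r).
  apply: dvdm_lin => //; rewrite linearB /= -lsubM (hproj_rep (W := W)) ?subrr //.
  exact: hstab_self.
exists (t * p + lsub (sigma s) r * w).
  by apply: coinv_add; apply: coinv_mul.
by rewrite rmorphM /= mulrDr mulrA -rE mulrCA -pE mulrBl mulrBr addrA subrK.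
Qed.

Lemma coinv_lin p c : (forall i, coinv W ('X_i * p)) -> coinv W (lin c * p).
Proof.
move=> pI; rewrite /lin mulr_suml; apply: coinv_sum => i _.
by rewrite -scalerAl; apply: coinv_scale.
Qed.

(** The root form times [p] lies in the ideal. Its divided difference, after cancelling the root, is
    [p] minus the twist of [p] by [s]. *)
Lemma socle_refl p s : (forall i, coinv W ('X_i * p)) -> s \in refls sigma W ->
  coinv W (p - (chi' s)^-1 *: lsub (sigma s) p).
Proof.
move=> pI sR; have [w wI] := coinv_demazure sR (coinv_lin (root_vec sigma s) pI).
have [z0 sc] := zeta_root rep sR.
have c0 : root_vec sigma s != 0 by move: sR; rewrite inE => /andP[_ /root_vecP[]].
rewrite rmorphM /= lsub_lin sc linearZ /= -scalerAl scalerAr -mulrBr.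
have lc0 : lin (root_vec sigma s) != 0 by rewrite lin_eq0.
by move/(mulfI lc0); rewrite jchi_refl // invrK => ->.
Qed.

(** Modulo the ideal, reflections act on the socle by [chi'], and such congruences compose. *)
Lemma socle_avg p : (forall i, coinv W ('X_i * p)) -> coinv W (p - semi_avg p).
Proof.
move=> pI; have H : forall g, g \in W -> coinv W (p - (chi' g)^-1 *: lsub (sigma g) p).
  apply: (refls_ind Wgen) => [|x y xW yW px py|s sR]; last exact: socle_refl.
    by rewrite jchi1 // invr1 scale1r lsub_rep1 // subrr; apply: coinv0.
  have -> : p - (chi' (x * y)%g)^-1 *: lsub (sigma (x * y)%g) p =
     (p - (chi' x)^-1 *: lsub (sigma x) p) +
     (chi' x)^-1 *: lsub (sigma x) (p - (chi' y)^-1 *: lsub (sigma y) p).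
    rewrite repM lsubM jchiM ?WN // (invfM (chi' x)).
    rewrite linearB /= [lsub _ (_ *: _)]linearZ /= scalerBr.
    by rewrite scalerA addrA subrK.
  by apply: coinv_add => //; apply: coinv_scale; apply: coinv_rep.
have -> : p - semi_avg p =
    #|W|%:R^-1 *: \sum_(g in W) (p - (chi' g)^-1 *: lsub (sigma g) p).
  rewrite sumrB scalerBr; congr (_ - _); rewrite sumr_const -scaler_nat scalerA.
  by rewrite mulVf ?cardW_neq0 // scale1r.
by apply: coinv_scale; apply: coinv_sum.
Qed.

(* Descending induction on the order of [p]: the products ['X_i * p] also kill [J],
   so [p] represents a socle element, and modulo the ideal it is a semi-invariant,
   that is, [q * J'] with [q] invariant; [q] has no constant term as [pair J' J != 0]. *)
Lemma Dop_jac_eq0 p : Dop p J = 0 -> coinv W p.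
Proof.
pose D := (n * #|W|).+1.
suff H k d : (D <= d + k)%N -> order_ge d p -> Dop p J = 0 -> coinv W p.
  by apply: (H D 0%N) => //; rewrite add0n.
elim: k d p => [|k IH] d {}p; first rewrite addn0 => Dd pd _.
  by apply: coinv_order => m mD; apply: pd; apply: leq_trans Dd.
rewrite addnS -addSn => Dd pd pJ; have XI i : coinv W ('X_i * p).
  apply: (IH d.+1) => //; last by rewrite DopM pJ linear0.
  rewrite -add1n; apply: order_geM => // m; rewrite ltnS leqn0 mdeg_eq0 => /eqP->.
  by rewrite mcoeffX mnm1_eq0.
have pI := socle_avg XI.
have [q qI qE] := semi_dvd charK0 rep (semi_avgP p).
suff q0 : q@_0%MM = 0.
  rewrite -(subrK (semi_avg p) p); apply: coinv_add => //; rewrite qE.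
  by apply: coinv_mul; apply: coinv_gen.
have := coinv_harm jac_harm pI; rewrite DopBl pJ sub0r => /eqP; rewrite oppr_eq0 => /eqP.
rewrite qE DopM (harm_inv jac_harm) // linearZ /= => /(congr1 (mcoeff 0%MM))/eqP.
by rewrite mcoeffZ mcoeff0 mulf_eq0 (negbTE pair_jac_neq0) orbF => /eqP.
Qed.

End ReflectionGroup.
End Coinvariants.

(** * Equivariant projection onto the harmonic polynomials *)

Section Grading.
Variables (K : fieldType) (n : nat).
Implicit Types (p q f : {mpoly K[n]}) (m : 'X_{1..n}) (B : 'M[K]_n).

HB.instance Definition _ d := GRing.isLinear.Build K {mpoly K[n]} {mpoly K[n]} _
  (@hcomp K n d) (@pihomog_is_linear n K mdeg d).

Lemma hcomp_sum p k : (msize p <= k)%N -> p = \sum_(d < k) hcomp d p.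
Proof. exact: pihomog_partitionE. Qed.

Lemma hcomp_eqP p q : (forall d, hcomp d p = hcomp d q) -> p = q.
Proof.
move=> pq; apply/mpolyP => m; have := congr1 (mcoeff m) (pq (mdeg m)).
by rewrite !mcoeff_hcomp eqxx.
Qed.

Lemma hcomp_hcomp d e p : hcomp d (hcomp e p) = if d == e then hcomp d p else 0.
Proof.
apply/mpolyP => m; rewrite !mcoeff_hcomp.
have [<-|/negbTE de] := eqVneq d e; first by rewrite mcoeff_hcomp; case: (mdeg m == d).
by rewrite mcoeff0; case: (eqVneq (mdeg m) d) => // ->; rewrite de.
Qed.

Lemma hcomp_mderivm d m f : hcomp d (mderivm m f) = mderivm m (hcomp (d + mdeg m) f).
Proof.
apply/mpolyP => m'; rewrite mcoeff_hcomp !mcoeff_mderivm mcoeff_hcomp mdegD addnC.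
by rewrite eqn_add2r; case: ifP => //; rewrite mul0rn.
Qed.

Lemma hcomp_Dop d e p f : hcomp d (Dop (hcomp e p) f) = Dop (hcomp e p) (hcomp (d + e) f).
Proof.
rewrite /Dop linear_sum big_seq [RHS]big_seq; apply: eq_bigr => m.
rewrite mcoeff_msupp mcoeff_hcomp linearZ /= hcomp_mderivm.
by case: (mdeg m =P e) => [<-//|_]; rewrite eqxx.
Qed.

Lemma lsub_homog B m : lsub B 'X_[m] \is (mdeg m).-homog.
Proof.
rewrite /lsub comp_mpolyX mdegE; apply: (big_ind2 (fun p d => p \is d.-homog)).
- exact: dhomog1.
- by move=> p d q e; apply: dhomogM.
- move=> i _; rewrite -[X in X.-homog]mul1n; apply: dhomogMn; rewrite tnth_mktuple.
  by apply: rpred_sum => j _; apply: rpredZ; rewrite dhomogX /= mdeg1.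
Qed.

Lemma hcomp_lsub B d p : hcomp d (lsub B p) = lsub B (hcomp d p).
Proof.
elim/mpolyind: p => [|c m p _ _ IH]; first by rewrite !linear0.
rewrite !linearP /= IH; congr (_ *: _ + _).
rewrite {2}/hcomp pihomogX; case: eqP => [<-|/eqP md].
  by rewrite /hcomp pihomog_dE // lsub_homog.
by rewrite linear0 /hcomp (@pihomog_ne0 _ _ _ (mdeg m)) // lsub_homog.
Qed.

Lemma hcomp_lsub_scalar a p d : hcomp d (lsub a%:M p) = a ^+ d *: hcomp d p.
Proof.
elim/mpolyind: p => [|c m p _ _ IH]; first by rewrite !linear0.
rewrite !linearP /= IH; congr (_ *: _ + _).
have -> : lsub a%:M 'X_[m] = a ^+ mdeg m *: 'X_[m] :> {mpoly K[n]}.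
  rewrite mpolyXE_id rmorph_prod mdegE -prodrXr -scaler_prod.
  apply: eq_bigr => i _; rewrite rmorphXn -exprZn /=; congr (_ ^+ _).
  have -> : 'X_i = lin (col i 1%:M) :> {mpoly K[n]} by rewrite -lsubX lsub1.
  by rewrite lsub_lin mul_scalar_mx linearZ.
by rewrite linearZ /= /hcomp pihomogX; case: eqP => [->//|_]; rewrite !scaler0.
Qed.

Lemma msize_hcomp_le d p : (msize (hcomp d p) <= d.+1)%N.
Proof.
by apply: msize_leP => m dm; rewrite mcoeff_hcomp; case: eqP dm => // ->; rewrite ltnn.
Qed.

Lemma order_msize_eq0 d p : order_ge d p -> (msize p <= d)%N -> p = 0.
Proof.
move=> pd sd; apply/mpolyP => m; rewrite mcoeff0.
have [/pd//|dm] := ltnP (mdeg m) d; by apply: mcoeff_msize; apply: leq_trans dm.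
Qed.

Lemma hcomp_msize d p : (msize p <= d)%N -> hcomp d p = 0.
Proof.
move=> pd; apply/mpolyP => m; rewrite mcoeff_hcomp mcoeff0; case: eqP => // md.
by apply: mcoeff_msize; rewrite md.
Qed.

Lemma jac_homog (gT : finGroupType) (sigma : gT -> 'M[K]_n) (W : {set gT}) :
  jac sigma W \is #|refls sigma W|.-homog.
Proof.
rewrite /jac -sum1_card; apply: (big_ind2 (fun p d => p \is d.-homog)).
- exact: dhomog1.
- by move=> p d q e; apply: dhomogM.
- move=> i _; apply: rpred_sum => j _; apply: rpredZ; by rewrite dhomogX /= mdeg1.
Qed.

End Grading.

(** * Functionals represented by polynomials of bounded degree *)

Section Truncation.
Variables (K : fieldType) (n M : nat).
Hypothesis charK0 : [pchar K] =i pred0.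
Local Notation D := 'X_{1..n < M}.
Implicit Types (p f : {mpoly K[n]}).

Definition mpoly_row p : 'rV[K]_#|{: D}| := \row_i p@_(enum_val i : D).
Definition row_mpoly (u : 'rV[K]_#|{: D}|) : {mpoly K[n]} :=
  \sum_i u 0 i *: 'X_[(enum_val i : D)].

Lemma mpoly_row_linear : linear mpoly_row.
Proof. by move=> a p q; apply/rowP => i; rewrite !mxE mcoeffD mcoeffZ. Qed.
HB.instance Definition _ := GRing.isLinear.Build K {mpoly K[n]} 'rV[K]_#|{: D}| _
  mpoly_row mpoly_row_linear.

Lemma row_mpoly_linear : linear row_mpoly.
Proof.
move=> a u v; rewrite /row_mpoly scaler_sumr -big_split; apply: eq_bigr => i _ /=.
by rewrite !mxE scalerDl scalerA.
Qed.
HB.instance Definition _ := GRing.isLinear.Build K 'rV[K]_#|{: D}| {mpoly K[n]} _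
  row_mpoly row_mpoly_linear.

Lemma mpoly_rowK p : (msize p <= M)%N -> row_mpoly (mpoly_row p) = p.
Proof.
move=> pM; rewrite [RHS](mpolywE pM) [RHS](reindex _ (onW_bij _ (@enum_val_bij {: D}))) /=.
by apply: eq_bigr => i _; rewrite mxE.
Qed.

(** Represents [phi] through [pair] on symbols of size at most [M]; the factorials normalise the
    dual basis of monomials. *)
Definition truncate (phi : {mpoly K[n]} -> K) : {mpoly K[n]} :=
  \sum_(m : D) (phi 'X_[m] / (mfact m)%:R) *: 'X_[m].

Lemma mcoeff_truncate phi m :
  (truncate phi)@_m = if (mdeg m < M)%N then phi 'X_[m] / (mfact m)%:R else 0.
Proof.
case: ifP => mM; first by rewrite (mcoeff_mpoly (fun m => phi 'X_[m] / (mfact m)%:R)).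
rewrite raddf_sum /= big1 // => m' _; rewrite mcoeffZ mcoeffX.
by case: eqP mM => [<-|_]; rewrite ?bmdeg ?mulr0.
Qed.

Lemma msize_truncate phi : (msize (truncate phi) <= M)%N.
Proof. by apply: msize_leP => m Mm; rewrite mcoeff_truncate ltnNge Mm. Qed.

Lemma pair_truncate (phi : {scalar {mpoly K[n]}}) p : (msize p <= M)%N ->
  pair p (truncate phi) = phi p.
Proof.
move=> pM; rewrite pairE [in RHS](mpolyE p) [RHS]linear_sum big_seq [RHS]big_seq.
apply: eq_bigr => m mp; rewrite [RHS]linearZ /= mcoeff_truncate.
rewrite (leq_trans (msize_mdeg_lt mp) pM) -[_ / _ *+ _]mulr_natr divfK //.
exact: mfact_neq0.
Qed.

Lemma truncate_linear a phi psi :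
  truncate (fun p => a * phi p + psi p) = a *: truncate phi + truncate psi.
Proof.
rewrite /truncate scaler_sumr -big_split; apply: eq_bigr => m _ /=.
by rewrite scalerA -scalerDl mulrDl mulrA.
Qed.

Lemma eq_truncate phi psi : phi =1 psi -> truncate phi = truncate psi.
Proof. by move=> E; apply: eq_bigr => m _; rewrite E. Qed.

End Truncation.

Section Projection.
Variables (K : fieldType) (n : nat) (gT : finGroupType).
Hypothesis charK0 : [pchar K] =i pred0.
Variable sigma : gT -> 'M[K]_n.
Hypothesis rep : faithful_rep sigma.
Local Notation tau := (dual_rep sigma).
Variable W : {group gT}.
Hypothesis Wgen : W :=: (<<refls sigma W>>)%g.
Implicit Types (p q f : {mpoly K[n]}).
Local Notation J := (jac tau W).

Lemma invariant_hcomp q d : minvariant sigma W q -> minvariant sigma W (hcomp d q).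
Proof. by move=> qI w wW; rewrite -hcomp_lsub qI. Qed.

Lemma harm_hcomp f d : harm sigma W f -> harm sigma W (hcomp d f).
Proof.
move=> fH q qI q0; rewrite [q](hcomp_sum (leqnn _)) Dop_suml big1 // => e _.
apply: hcomp_eqP => j; rewrite linear0 hcomp_Dop hcomp_hcomp; case: eqP => [jd|_].
  rewrite -hcomp_Dop fH ?linear0 //; first exact: invariant_hcomp.
  by rewrite mcoeff_hcomp q0; case: ifP.
by rewrite linear0.
Qed.

Definition jac_mx M : 'M[K]_#|{: 'X_{1..n < M}}| :=
  \matrix_i mpoly_row M (Dop 'X_[(enum_val i : 'X_{1..n < M})] J).

Lemma row_jac_mx M u : (msize J <= M)%N ->
  row_mpoly (u *m jac_mx M) = Dop (row_mpoly u) J.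
Proof.
move=> JM; rewrite mulmx_sum_row linear_sum Dop_suml; apply: eq_bigr => i _ /=.
by rewrite linearZ /= rowK mpoly_rowK ?DopZl // (leq_trans (msize_Dop _ _)).
Qed.

(* A linear functional vanishing on the derivatives of [J] is the pairing with an
   operator killing [J], which then lies in the coinvariant ideal and kills [f]. *)
Lemma harm_jac_mx M f : (msize J <= M)%N -> harm sigma W f ->
  (mpoly_row M f <= jac_mx M)%MS.
Proof.
move=> JM fH; rewrite submxE; apply/eqP/rowP => k; rewrite [RHS]mxE.
pose u := col k (cokermx (jac_mx M)).
pose p : {mpoly K[n]} :=
  \sum_i (u i 0 / (mfact (enum_val i : 'X_{1..n < M}))%:R) *: 'X_[(enum_val i : 'X_{1..n < M})].
have pE g : pair p g = (mpoly_row M g *m u) 0 0.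
  rewrite mxE pair_suml; apply: eq_bigr => i _; rewrite pairZl pairX -[_@__ *+ _]mulr_natr !mxE.
  by rewrite mulrCA divfK ?mfact_neq0.
have -> : (mpoly_row M f *m cokermx (jac_mx M)) 0 k = pair p f.
  by rewrite pE !mxE; apply: eq_bigr => i _; rewrite !mxE.
suff pJ : Dop p J = 0 by rewrite /pair (coinv_harm fH) ?mcoeff0 //; apply: Dop_jac_eq0 pJ.
apply/(Dop_eq0P charK0) => q; rewrite [q]mpolyE mulr_suml pair_suml big1 // => m _.
rewrite -scalerAl pairZl mulrC [_ * p]mulrC pairM pE; apply/eqP; rewrite mulf_eq0.
apply/orP; left; apply/eqP; have [mM|Mm] := ltnP (mdeg m) M.
  have -> : mpoly_row M (Dop 'X_[m] J) = row (enum_rank (BMultinom mM)) (jac_mx M).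
    by rewrite rowK enum_rankK.
  by rewrite /u colE mulmxA -row_mul mulmx_coker linear0 mul0mx mxE.
have -> : Dop 'X_[m] J = 0; last by rewrite linear0 mul0mx mxE.
apply/mpolyP => m'; rewrite DopXm mcoeff_mderivm mcoeff0 mcoeff_msize ?mul0rn //.
by rewrite (leq_trans JM) // mdegD (leq_trans Mm) // leq_addr.
Qed.

Lemma harm_jac f : harm sigma W f -> exists p, f = Dop p J.
Proof.
move=> fH; pose M := maxn (msize J) (msize f).
have /submxP[u uE] := harm_jac_mx (leq_maxl _ _ : _ <= M)%N fH.
exists (row_mpoly u); rewrite -(row_jac_mx _ (leq_maxl _ _ : _ <= M)%N) -uE mpoly_rowK //.
exact: leq_maxr.
Qed.

Lemma msize_harm f : harm sigma W f -> (msize f <= msize J)%N.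
Proof. by case/harm_jac => p ->; apply: msize_Dop. Qed.

Local Notation M := (msize J).

(** A linear projection onto the span of the derivatives of [J], with neither grading nor
    equivariance yet. *)
Definition harm_retract f := row_mpoly (mpoly_row M f *m pinvmx (jac_mx M) *m jac_mx M).

Lemma harm_retract_linear : linear harm_retract.
Proof. by move=> a f g; rewrite /harm_retract linearP /= !mulmxDl -!scalemxAl linearP. Qed.
HB.instance Definition _ := GRing.isLinear.Build K {mpoly K[n]} {mpoly K[n]} _ harm_retract
  harm_retract_linear.

Lemma harm_retract_harm f : harm sigma W (harm_retract f).
Proof. by rewrite /harm_retract row_jac_mx //; apply: harm_Dop; apply: jac_harm. Qed.

Lemma harm_retract_id f : harm sigma W f -> harm_retract f = f.
Proof.
move=> fH; rewrite /harm_retract mulmxKpV ?mpoly_rowK ?msize_harm //.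
exact: harm_jac_mx.
Qed.

(** Keeping only the diagonal blocks makes the projection commute with homogeneous components. *)
Definition gr_harm_retract f := \sum_(i < M) hcomp i (harm_retract (hcomp i f)).

Lemma gr_harm_retract_linear : linear gr_harm_retract.
Proof.
move=> a f g; rewrite /gr_harm_retract scaler_sumr -big_split; apply: eq_bigr => i _ /=.
by rewrite !linearP.
Qed.
HB.instance Definition _ := GRing.isLinear.Build K {mpoly K[n]} {mpoly K[n]} _ gr_harm_retract
  gr_harm_retract_linear.

Lemma gr_harm_retract_harm f : harm sigma W (gr_harm_retract f).
Proof. by apply: harm_sum => i _; apply: harm_hcomp; apply: harm_retract_harm. Qed.

Lemma gr_harm_retract_id f : harm sigma W f -> gr_harm_retract f = f.
Proof.
move=> fH; rewrite [RHS](hcomp_sum (msize_harm fH)); apply: eq_bigr => i _.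
rewrite harm_retract_id; first by rewrite hcomp_hcomp eqxx.
exact: harm_hcomp.
Qed.

Lemma hcomp_gr_harm_retract d f : hcomp d (gr_harm_retract f) = gr_harm_retract (hcomp d f).
Proof.
rewrite /gr_harm_retract linear_sum; apply: eq_bigr => i _ /=.
rewrite !hcomp_hcomp eq_sym; case: eqP => [->//|_].
by rewrite !linear0.
Qed.

Variable X : {group gT}.
Hypothesis XN : X \subset 'N(W)%g.

(** Maschke's averaging, which keeps the grading because substitutions preserve degrees. *)
Definition harm_proj f :=
  #|X|%:R^-1 *: \sum_(x in X) lsub (tau x^-1%g) (gr_harm_retract (lsub (tau x) f)).

Lemma harm_proj_linear : linear harm_proj.
Proof.
move=> a f g; rewrite /harm_proj scalerA mulrC -scalerA -scalerDr; congr (_ *: _).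
rewrite scaler_sumr -big_split; apply: eq_bigr => i _ /=.
by rewrite !linearP.
Qed.
HB.instance Definition _ := GRing.isLinear.Build K {mpoly K[n]} {mpoly K[n]} _ harm_proj
  harm_proj_linear.

Lemma harm_proj_harm f : harm sigma W (harm_proj f).
Proof.
apply: harm_scale; apply: harm_sum => x xX; apply: harm_norm => //.
  by rewrite groupV (subsetP XN).
exact: gr_harm_retract_harm.
Qed.

Lemma harm_proj_id f : harm sigma W f -> harm_proj f = f.
Proof.
move=> fH; rewrite /harm_proj (eq_bigr (fun=> f)) => [|x xX]; last first.
  rewrite gr_harm_retract_id ?lsub_repK //; first exact: faithful_dual.
  by apply: harm_norm => //; apply: (subsetP XN).
by rewrite sumr_const -scaler_nat scalerA mulVf ?scale1r // natK_neq0.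
Qed.

Lemma hcomp_harm_proj d f : hcomp d (harm_proj f) = harm_proj (hcomp d f).
Proof.
rewrite /harm_proj [LHS]linearZ; congr (_ *: _); rewrite [LHS]linear_sum.
apply: eq_bigr => x _ /=.
by rewrite hcomp_lsub hcomp_gr_harm_retract hcomp_lsub.
Qed.

Lemma harm_proj_rep x f : x \in X -> harm_proj (lsub (tau x) f) = lsub (tau x) (harm_proj f).
Proof.
move=> xX; have [_ tM _] := faithful_dual rep.
rewrite /harm_proj [RHS]linearZ; congr (_ *: _); rewrite [RHS]linear_sum /=.
rewrite (reindex_inj (mulIg x^-1%g)) /=; apply: eq_big => [y|y yX].
  by rewrite groupMr ?groupV.
by rewrite -!lsubM -!tM invMg invgK mulgKV.
Qed.

End Projection.

(** * Exponential families *)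

Section MoreOrder.
Variables (K : fieldType) (n : nat).
Hypothesis charK0 : [pchar K] =i pred0.
Implicit Types (p q f : {mpoly K[n]}) (u v : 'rV[K]_n) (c : 'cV[K]_n).

Lemma trans_trans u v p : trans u (trans v p) = trans (u + v) p.
Proof.
apply: (mpoly_lrmorph_ext (f := trans u \o trans v) (g := trans (u + v))) => i /=.
by rewrite !transX rmorphD /= transX transC mxE mpolyCD addrA.
Qed.

Lemma transKV u : cancel (trans (- u)) (trans u).
Proof. by move=> p; rewrite trans_trans subrr trans0. Qed.

Lemma Dop_unit p f : p@_0%MM != 0 -> Dop p f = 0 -> f = 0.
Proof.
move=> p0 pf; apply/eqP; apply: contraT => f0.
have : Dop (p - (p@_0%MM)%:MP) f = - p@_0%MM *: f by rewrite DopBl DopC pf sub0r scaleNr.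
have p1 : (p - (p@_0%MM)%:MP)@_0%MM = 0 by rewrite mcoeffB mcoeffC eqxx mulr1 subrr.
have := msize_Dop_lt p1 f0 => + E; rewrite E msizeZ ?oppr_eq0 // ltnn.
by [].
Qed.

Lemma Dop_const p a : Dop p a%:MP = (p@_0%MM * a)%:MP.
Proof.
have [->|a0] := eqVneq a 0; first by rewrite mpolyC0 linear0 mulr0 mpolyC0.
have C0 : a%:MP != 0 :> {mpoly K[n]} by rewrite mpolyC_eq0.
rewrite -[p in LHS](subrK (p@_0%MM)%:MP) DopDl DopC mpolyCM mul_mpolyC.
have p1 : (p - (p@_0%MM)%:MP)@_0%MM = 0 by rewrite mcoeffB mcoeffC eqxx mulr1 subrr.
have := msize_Dop_lt p1 C0; rewrite msizeC a0 ltnS leqn0 msize_poly_eq0 => /eqP->.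
by rewrite add0r.
Qed.

Lemma order_ge_hcomp d p : order_ge d p <-> forall e, (e < d)%N -> hcomp e p = 0.
Proof.
split=> [pd e ed|pd m md].
  by apply/mpolyP => m; rewrite mcoeff_hcomp mcoeff0; case: eqP => // me; rewrite pd ?me.
by have := congr1 (mcoeff m) (pd _ md); rewrite mcoeff_hcomp eqxx mcoeff0.
Qed.

Lemma pair_order d p f : order_ge d p -> (msize f <= d)%N -> pair p f = 0.
Proof.
move=> pd fd; rewrite pairE big1 // => m _; have [md|dm] := ltnP (mdeg m) d.
  by rewrite pd // mul0r.
by rewrite (mcoeff_msize (leq_trans fd dm)) mul0rn mulr0.
Qed.

Lemma order_lin c : order_ge 1 (lin c).
Proof.
move=> m; rewrite ltnS leqn0 mdeg_eq0 => /eqP->; rewrite /lin raddf_sum big1 //= => i _.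
by rewrite mcoeffZ mcoeffX mnm1_eq0 mulr0.
Qed.

Lemma order_geB d p q : order_ge d p -> order_ge d q -> order_ge d (p - q).
Proof. by move=> pd qd m md; rewrite mcoeffB pd // qd // subrr. Qed.

(** For each point to avoid, take an affine form vanishing there and not at [u], and raise it to the
    power [k]. *)
Lemma separating_poly (I : finType) (P : pred I) u (v : I -> 'rV[K]_n) k :
  (forall i, P i -> v i != u) ->
  exists2 p, p.@[u 0] != 0 & forall i, P i -> order_ge k (trans (v i) p).
Proof.
move=> vu; have sep i : exists c : 'cV[K]_n, P i -> ((u - v i) *m c) 0 0 != 0.
  have [Pi|_] := boolP (P i); last by exists 0.
  have : u - v i != 0 by rewrite subr_eq0 eq_sym vu.
  case/rV0Pn => j uj; exists (delta_mx j 0) => _; rewrite -colE mxE; exact: uj.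
have [c cP] : exists c : I -> 'cV[K]_n, forall i, P i -> ((u - v i) *m c i) 0 0 != 0.
  have := fin_all_exists sep; by case=> c cP; exists c.
exists (\prod_(i | P i) (lin (c i) - ((v i *m c i) 0 0)%:MP) ^+ k) => [|i Pi].
  rewrite rmorph_prod; apply/prodf_neq0 => i Pi; rewrite rmorphXn expf_neq0 //=.
  rewrite rmorphB /= meval_lin mevalC; have := cP i Pi.
  by rewrite mulmxBl !mxE.
rewrite (bigD1 i) //= rmorphM rmorphXn rmorphB /= trans_lin transC addrK.
rewrite -[X in order_ge X]addn0; apply: order_geM => //.
by rewrite -[X in order_ge X]muln1; apply: order_geX; apply: order_lin.
Qed.

Lemma pair_inj_msize M f : (msize f <= M)%N ->
  (forall p, (msize p <= M)%N -> pair p f = 0) -> f = 0.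
Proof.
move=> fM f0; apply/mpolyP => m; rewrite mcoeff0; have [mM|Mm] := ltnP (mdeg m) M.
  have := f0 'X_[m]; rewrite msizeX => /(_ mM); rewrite pairX -[_ *+ _]mulr_natr => /eqP.
  by rewrite mulf_eq0 (negbTE (mfact_neq0 charK0 m)) orbF => /eqP.
by apply: mcoeff_msize; apply: leq_trans Mm.
Qed.

Lemma msize_lsub B p : (msize (lsub B p) <= msize p)%N.
Proof.
apply: msize_leP => m pm; have := congr1 (mcoeff m) (hcomp_lsub B (mdeg m) p).
by rewrite mcoeff_hcomp eqxx hcomp_msize // linear0 mcoeff0.
Qed.

Lemma truncate_lsub M B (phi : {scalar {mpoly K[n]}}) :
  truncate M (fun p => phi (lsub B^T p)) = lsub B (truncate M phi).
Proof.
apply/eqP; rewrite -subr_eq0; apply/eqP; apply: (@pair_inj_msize M).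
  rewrite (leq_trans (msizeD_le _ _)) // geq_max msizeN msize_truncate.
  by rewrite (leq_trans (msize_lsub _ _)) // msize_truncate.
move=> p pM; rewrite linearB /= pair_lsub (pair_truncate charK0 (phi \o lsub B^T)) //=.
by rewrite pair_truncate ?subrr // (leq_trans (msize_lsub _ _)).
Qed.

Lemma hcomp_truncate M d phi : (d < M)%N ->
  hcomp d (truncate M phi) = hcomp d (truncate d.+1 phi) :> {mpoly K[n]}.
Proof.
move=> dM; apply/mpolyP => m; rewrite !mcoeff_hcomp; case: eqP => // md.
by rewrite !mcoeff_truncate md dM ltnSn.
Qed.

End MoreOrder.

(** * Series attached to families, and their lowest terms *)

Section Deformation.
Variables (K : fieldType) (n : nat) (gT : finGroupType).
Hypothesis charK0 : [pchar K] =i pred0.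
Variable sigma : gT -> 'M[K]_n.
Hypothesis rep : faithful_rep sigma.
Let rep1 : sigma 1%g = 1%:M. Proof. by case: rep. Qed.
Let repM x y : sigma (x * y)%g = sigma x *m sigma y. Proof. by case: rep. Qed.
Variable W : {group gT}.
Variable lam : 'rV[K]_n.
Implicit Types (p q r h : {mpoly K[n]}) (f : gT -> {mpoly K[n]}).

(* [family_form f] is the pairing with the formal power series
   [\sum_(x in W) x^-1 (exp(lam) (f x))]. *)
Definition family_form f p : K := \sum_(x in W) pair (trans lam (lsub (sigma x) p)) (f x).

Local Notation Phi := family_form.

Lemma Phi_linear f : linear_for *%R (Phi f).
Proof.
move=> a p q; rewrite /family_form mulr_sumr -big_split; apply: eq_bigr => x _ /=.
by rewrite !linearP pairDl pairZl.
Qed.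
HB.instance Definition _ f := GRing.isLinear.Build K {mpoly K[n]} K _ (Phi f) (Phi_linear f).

Lemma eq_Phi f g : {in W, f =1 g} -> Phi f =1 Phi g.
Proof. by move=> fg p; apply: eq_bigr => x xW; rewrite fg. Qed.

Lemma Phi_linearl a f g p : Phi (fun x => a *: f x + g x) p = a * Phi f p + Phi g p.
Proof.
rewrite /family_form mulr_sumr -big_split; apply: eq_bigr => x _ /=.
by rewrite linearP.
Qed.

Lemma Phi_shift f g p : g \in W -> Phi (fun x => f (x * g)%g) p = Phi f (lsub (sigma g^-1%g) p).
Proof.
move=> gW; rewrite /family_form [RHS](reindex_inj (mulIg g)) /=; apply: eq_big => [x|x _].
  by rewrite groupMr.
by rewrite -lsubM -repM mulgK.
Qed.

Definition stab_refls := [set s in refls sigma W | lam *m sigma s == lam].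
Definition stab_group := <<stab_refls>>%G.
Local Notation R := stab_group.

Lemma stab_group_sub : R \subset W.
Proof.
rewrite gen_subG; apply/subsetP => s; rewrite inE => /andP[]; by rewrite inE => /andP[].
Qed.

Lemma stab_group_fix y : y \in R -> lam *m sigma y = lam.
Proof.
move=> /gen_prodgP[k [c cR ->]]; apply: (big_ind (fun x => lam *m sigma x = lam)).
- by rewrite rep1 mulmx1.
- by move=> x z xl zl; rewrite repM mulmxA xl zl.
- by move=> i _; have := cR i; rewrite inE => /andP[_ /eqP].
Qed.

Lemma refls_stab : refls sigma R = stab_refls.
Proof.
apply/setP => s; apply/idP/idP => sR; last first.
  rewrite inE mem_gen //=; by move: sR; rewrite !inE => /andP[/andP[]].
move: sR; rewrite inE => /andP[sR sr]; rewrite !inE sr (subsetP stab_group_sub) //=.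
by rewrite stab_group_fix.
Qed.

Lemma stab_gen : R :=: <<refls sigma R>>%g.
Proof. by rewrite refls_stab. Qed.

(** As [R] fixes [lam], the translate of [q] by [lam] is [R]-invariant; it acts on [R]-harmonic
    values by its constant term, which is q(lam). *)
Lemma Phi_inv f q r : (forall x, x \in W -> harm sigma R (f x)) -> minvariant sigma W q ->
  Phi f (q * r) = q.@[lam 0] * Phi f r.
Proof.
move=> fH qI; rewrite /family_form mulr_sumr; apply: eq_bigr => x xW.
rewrite !rmorphM /= qI // mulrC pairM.
have TI : minvariant sigma R (trans lam q).
  move=> y yR; rewrite -{1}[lam](stab_group_fix yR) -trans_lsub qI //.
  exact: (subsetP stab_group_sub).
by rewrite (harm_inv (fH x xW) TI) linearZ /= mcoeff0_trans.
Qed.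

(** The invariants act on [phi] by their values at [lam]. If [q] is a homogeneous invariant of
    positive degree and [q * r] sits in the lowest degree of [phi], then [r] sits below it, where
    [phi] vanishes; so [q] kills the lowest term. *)
Lemma lowest_term (phi : {scalar {mpoly K[n]}}) p0 :
  (forall q r, minvariant sigma W q -> phi (q * r) = q.@[lam 0] * phi r) ->
  phi p0 != 0 -> exists d F, [/\ harm sigma W F, F != 0, hcomp d F = F,
    F = hcomp d (truncate d.+1 phi) &
    forall p, (msize p <= d.+1)%N -> pair p F = phi p].
Proof.
move=> phiI p00; have ex : exists k, truncate k phi != 0.
  exists (msize p0); apply: contraNneq p00 => t0.
  by rewrite -(pair_truncate charK0 _ (leqnn _)) t0 linear0.
(* The bound [d.+1] is the least one with a nonzero truncation, so [F] is concentrated in degree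
   [d]. *)
case: (ex_minnP ex) => -[|d] F0 dmin.
  by case/eqP: F0; apply/mpolyP => m; rewrite mcoeff_truncate mcoeff0.
set F := truncate d.+1 phi in F0.
have td : truncate d phi = 0.
  by apply/eqP; apply: contraT => /dmin; rewrite ltnn.
have pF p : (msize p <= d.+1)%N -> pair p F = phi p by move=> pd; apply: pair_truncate.
have phi0 p : (msize p <= d)%N -> phi p = 0.
  by move=> pd; rewrite -(pair_truncate charK0 _ pd) td linear0.
have FdF : hcomp d F = F.
  apply/mpolyP => m; rewrite mcoeff_hcomp; case: eqP => // md.
  rewrite mcoeff_truncate ltnS leq_eqVlt; move/eqP/negbTE: md => -> /=.
  case: ifP => // md; by rewrite phi0 ?mul0r // msizeX.
exists d, F; split=> // q qI q0; apply: (pair_inj charK0) => r; rewrite -pairM.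
rewrite [q](hcomp_sum (leqnn _)) [r](hcomp_sum (leqnn _)) mulr_suml pair_suml big1 // => i _.
rewrite mulr_sumr pair_suml big1 // => j _; set ri := hcomp i r; set qj := hcomp j q.
have hom : ri * qj \is (i + j).-homog by apply: dhomogM; apply: pihomogP.
rewrite -FdF -pair_hcomp; have [ijd|ijd] := eqVneq (i + j)%N d; last first.
  by rewrite /hcomp (@pihomog_ne0 _ _ _ (i + j)%N) // /pair Dop0l mcoeff0.
rewrite pF; last exact: msize_hcomp_le.
rewrite /hcomp -[in pihomog mdeg d]ijd pihomog_dE // mulrC phiI; last exact: invariant_hcomp.
have [j0|j0] := posnP j; last first.
  rewrite [phi ri]phi0 ?mulr0 // (leq_trans (msize_hcomp_le _ _)) // -ijd -addn1.
  by rewrite leq_add2l.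
have -> : qj = 0; last by rewrite meval0 mul0r.
apply/mpolyP => m; rewrite mcoeff_hcomp mcoeff0 j0; case: eqP => // /eqP.
by rewrite mdeg_eq0 => /eqP ->.
Qed.

End Deformation.

Section StabilizerCharacter.
Variables (K : fieldType) (n : nat) (gT : finGroupType).
Hypothesis charK0 : [pchar K] =i pred0.
Variable sigma : gT -> 'M[K]_n.
Hypothesis rep : faithful_rep sigma.
Local Notation tau := (dual_rep sigma).
Let trep : faithful_rep tau := faithful_dual rep.
Let repM x y : sigma (x * y)%g = sigma x *m sigma y. Proof. by case: rep. Qed.
Variable W : {group gT}.
Hypothesis Wgen : W :=: (<<refls sigma W>>)%g.
Variable lam : 'rV[K]_n.
Local Notation R := (stab_group sigma W lam).
Let WN := subsetP (normG W).

Lemma rep_fixV q : lam *m sigma q = lam -> lam *m sigma q^-1%g = lam.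
Proof. by move=> ql; rewrite -{1}ql -mulmxA repKV // mulmx1. Qed.

Lemma stab_group_norm q : q \in W -> lam *m sigma q = lam -> q \in 'N(R)%g.
Proof.
move=> qW ql; suff qN : q \in 'N(stab_refls sigma W lam)%g by exact: (subsetP (norms_gen _) _ qN).
rewrite inE; apply/subsetP => _ /imsetP[s sR ->].
move: sR; rewrite inE => /andP[sR /eqP sl].
rewrite inE refls_conj ?WN // sR /= conjgE !repM !mulmxA rep_fixV // sl.
by rewrite ql.
Qed.

Lemma jac_stab_factor : exists2 u : {mpoly K[n]}, u.@[lam 0] != 0 &
  jac sigma W = jac sigma R * u.
Proof.
exists (\prod_(s in refls sigma W | lam *m sigma s != lam) lin (root_vec sigma s)).
  rewrite rmorph_prod; apply/prodf_neq0 => s /andP[]; rewrite inE => /andP[_ sr] sl.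
  rewrite /= meval_lin; have [c0 [r r0 sE]] := root_vecP sr.
  apply: contraNneq sl => lc; rewrite sE mulmxDr mulmx1 mulmxA.
  by rewrite [lam *m root_vec sigma s]mx11_scalar lc mul_scalar_mx scale0r addr0.
rewrite /jac (bigID (fun s => lam *m sigma s == lam)) /=; congr (_ * _).
by apply: eq_bigl => s; rewrite refls_stab // [RHS]inE.
Qed.

(** Split [jac W] into [jac R] and the root forms not vanishing at [lam]. The latter product is
    nonzero at [lam], a point fixed by [q], so evaluation there shows that it contributes nothing to
    the character. *)
Lemma jchi_stab q : q \in W -> lam *m sigma q = lam -> jchi sigma R q = jchi sigma W q.
Proof.
move=> qW ql; have qN := stab_group_norm qW ql; have [u u0 JE] := jac_stab_factor.
have := lsub_jac rep (WN qW); rewrite JE rmorphM /= (lsub_jac rep qN).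
rewrite -scalerAl !scalerAr => /(mulfI (jac_neq0 _ _)) E.
have := congr1 (meval (lam 0)) E; rewrite !mevalZ meval_lsub ql.
by move/(mulIf u0).
Qed.

Lemma lsub_jac_stab q : q \in W -> lam *m sigma q = lam ->
  lsub (tau q) (jac tau R) = jchi tau W q *: jac tau R.
Proof.
move=> qW ql; have qN := stab_group_norm qW ql.
rewrite (lsub_jac trep qN); congr (_ *: _); apply: (mulfI (jchi_neq0 rep (WN qW))).
rewrite (chi_dual rep Wgen qW) -(jchi_stab qW ql).
(* The pairing of the two products for [R] is a nonzero number and is invariant, so their characters
   are mutually inverse at [q] as well. *)
have p0 := pair_jac_neq0 charK0 rep (stab_gen rep W lam).
have := pair_rep rep q (jac sigma R) (jac tau R).
rewrite (lsub_jac rep qN) (lsub_jac trep qN) pairZl linearZ /= mulrA.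
by rewrite -[RHS]mul1r => /(mulIf p0).
Qed.

End StabilizerCharacter.

(** * The semi-invariant series and its lowest term *)

Section Surjectivity.
Variables (K : fieldType) (n : nat) (gT : finGroupType).
Hypothesis charK0 : [pchar K] =i pred0.
Variable sigma : gT -> 'M[K]_n.
Hypothesis rep : faithful_rep sigma.
Local Notation tau := (dual_rep sigma).
Let trep : faithful_rep tau := faithful_dual rep.
Let rep1 : sigma 1%g = 1%:M. Proof. by case: rep. Qed.
Let repM x y : sigma (x * y)%g = sigma x *m sigma y. Proof. by case: rep. Qed.
Variable W : {group gT}.
Hypothesis Wgen : W :=: (<<refls sigma W>>)%g.
Variable lam : 'rV[K]_n.
Implicit Types (p q r h : {mpoly K[n]}) (f : gT -> {mpoly K[n]}).
Local Notation J := (jac tau W).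
Local Notation M := (msize J).
Local Notation chi := (jchi tau W).
Local Notation R := (stab_group sigma W lam).
Local Notation JR := (jac tau R).
Local Notation Phi := (family_form sigma W lam).
Let WN := subsetP (normG W).

Lemma stab_act y p : lam *m sigma y = lam ->
  trans lam (lsub (sigma y) p) = lsub (sigma y) (trans lam p).
Proof. by move=> ql; rewrite trans_lsub ql. Qed.

(** The operator [p] applied to the series of [chi x *: JR]. The factor [chi] makes the family
    equivariant under [R] and, for p = 1, its series semi-invariant under [W]. *)
Definition jac_family p x := Dop (trans lam (lsub (sigma x) p)) (chi x *: JR).

Local Notation fam := jac_family.

Lemma fam_linear a p q x : fam (a *: p + q) x = a *: fam p x + fam q x.
Proof. by rewrite /jac_family !linearP DopDl DopZl. Qed.

Lemma fam_harm p x : harm sigma R (fam p x).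
Proof. by apply: harm_Dop; apply: harm_scale; apply: jac_harm. Qed.

Lemma fam_rep p y x : y \in R -> x \in W -> fam p (y * x)%g = lsub (tau y) (fam p x).
Proof.
move=> yR xW; have yW := subsetP (stab_group_sub sigma W lam) _ yR.
have yl := stab_group_fix rep yR.
have E : chi (y * x)%g *: JR = lsub (tau y) (chi x *: JR).
  rewrite linearZ /= (lsub_jac_stab charK0 rep Wgen yW yl) scalerA mulrC.
  by rewrite jchiM ?WN.
by rewrite /jac_family E repM lsubM stab_act // Dop_rep.
Qed.

Lemma Phi_fam p r : Phi (fam p) r = Phi (fam 1) (p * r).
Proof.
apply: eq_bigr => x xW; rewrite /jac_family !rmorphM !rmorph1 mulrC pairM.
by rewrite -[1]mpolyC1 DopC scale1r.
Qed.

Lemma fam1 x : fam 1 x = chi x *: JR.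
Proof. by rewrite /jac_family !rmorph1 -mpolyC1 DopC scale1r. Qed.

Lemma Phi_fam_semi g p : g \in W -> Phi (fam 1) (lsub (sigma g^-1%g) p) = chi g * Phi (fam 1) p.
Proof.
move=> gW; rewrite -Phi_shift // /family_form mulr_sumr; apply: eq_bigr => x xW.
by rewrite !fam1 jchiM ?WN // mulrC -scalerA [LHS]linearZ.
Qed.

(** A polynomial [u] of high order at the other points of the orbit isolates the exponent [lam].
    Thanks to the character, all elements fixing [lam] contribute the same number, so nothing
    cancels. *)
Lemma Phi_fam_neq0 : exists p, Phi (fam 1) p != 0.
Proof.
pose m := msize JR.
have [i|u u0 uord] := @separating_poly _ _ _ (fun x => (x \in W) && (lam *m sigma x != lam)) lam
    (fun x => lam *m sigma x) m; first by case/andP.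
have g0 : Dop (trans lam u) JR != 0.
  apply: contraTneq (jac_neq0 tau R) => /(Dop_unit _) ->; first by rewrite eqxx.
  by rewrite mcoeff0_trans.
(* The second factor becomes the leading monomial of [g] after translation by [lam]; paired with
   [g], it gives the leading coefficient times a product of factorials. *)
set g := Dop _ JR in g0; exists (u * trans (- lam) 'X_[mlead g]).
pose Q := [set x in W | lam *m sigma x == lam].
rewrite /family_form (bigID (fun x => lam *m sigma x == lam)) /=.
rewrite [X in _ + X]big1 ?addr0 => [|x xP]; last first.
  have [xW xl] := andP xP; rewrite fam1 linearZ /= trans_lsub rmorphM rmorphM /=.
  rewrite (@pair_order _ _ m) ?mulr0 //.
  rewrite -[X in order_ge X]addn0; apply: order_geM => //.
  rewrite order_ge_hcomp => e em; rewrite hcomp_lsub.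
  by have /order_ge_hcomp -> := uord x xP; rewrite ?linear0.
rewrite (eq_bigr (fun=> pair 'X_[mlead g] g)) => [|x /andP[xW /eqP xl]]; last first.
  rewrite fam1 -(lsub_jac_stab charK0 rep Wgen xW xl) stab_act // pair_rep //.
  by rewrite rmorphM /= transKV mulrC pairM.
rewrite (eq_bigl (mem Q)) => [|x]; last by rewrite [RHS]inE.
rewrite sumr_const pairX -mulrnA -mulr_natr mulf_neq0 ?mleadc_eq0 //.
rewrite natrM mulf_neq0 ?mfact_neq0 ?natK_neq0 //.
by rewrite (cardD1 1%g) inE group1 rep1 mulmx1 eqxx.
Qed.

Lemma Phi_fam_jac : exists2 c, c != 0 & forall p, (msize p <= M)%N -> Phi (fam 1) p = c * pair p J.
Proof.
have [p0 p00] := Phi_fam_neq0.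
have Pinv q r : minvariant sigma W q -> Phi (fam 1) (q * r) = q.@[lam 0] * Phi (fam 1) r.
  by move=> qI; apply: Phi_inv => // x xW; apply: fam_harm.
have [d [F [FH F0 FdF _ Fp]]] := lowest_term charK0 Pinv p00.
have Fsemi g : g \in W -> lsub (tau g) F = chi g *: F.
  move=> gW; apply/eqP; rewrite -subr_eq0; apply/eqP; apply: (pair_inj charK0) => p.
  have -> : lsub (tau g) F - chi g *: F = hcomp d (lsub (tau g) F - chi g *: F).
    rewrite [RHS]linearB /= hcomp_lsub FdF; congr (_ - _).
    by rewrite [RHS]linearZ /= FdF.
  rewrite -pair_hcomp; set pd := hcomp d p.
  have pdm : (msize pd <= d.+1)%N := msize_hcomp_le d p.
  rewrite linearB /= pair_lsub [pair _ (_ *: _)]linearZ /= !Fp ?(leq_trans (msize_lsub _ _)) //.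
  by rewrite /= {1}/dual_rep trmxK Phi_fam_semi // subrr.
have [p1 Fp1] := harm_jac charK0 rep Wgen FH.
(* As [F] and [J] share the character [chi], averaging [p1] does not change its value on [J], and
   the average acts on the harmonic [J] as a scalar. *)
pose pavg := #|W|%:R^-1 *: \sum_(g in W) lsub (sigma g) p1.
have pI : minvariant sigma W pavg.
  move=> w wW; rewrite /pavg linearZ linear_sum; congr (_ *: _) => /=.
  rewrite [RHS](reindex_inj (mulgI w)) /=; apply: eq_big => [x|x _].
    by rewrite groupMl.
  by rewrite -lsubM -repM.
have FE : F = pavg@_0%MM *: J.
  rewrite -(harm_inv (jac_harm charK0 rep (W := W)) pI) /pavg DopZl Dop_suml.
  rewrite (eq_bigr (fun=> F)) => [|g gW].
    by rewrite sumr_const -scaler_nat scalerA mulVf ?scale1r // natK_neq0.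
  have gJ : J = (chi g)^-1 *: lsub (tau g) J.
    by rewrite jac_semi // scalerA mulVf ?scale1r // (jchi_neq0 trep (WN gW)).
  rewrite {1}gJ linearZ /= Dop_rep // -Fp1 Fsemi // scalerA mulVf ?scale1r //.
  exact: (jchi_neq0 trep (WN gW)).
have c0 : pavg@_0%MM != 0 by apply: contraNneq F0 => c0; rewrite FE c0 scale0r.
exists (pavg@_0%MM) => // p pM; rewrite -Fp; first by rewrite {1}FE linearZ.
(* The nonzero multiple [F] of [J] has degree [d], hence so does [J], and [M] is at most [d.+1]. *)
rewrite (leq_trans pM) //; suff <- : hcomp d J = J by apply: msize_hcomp_le.
apply: (scalerI c0); rewrite -FE -[in RHS]FdF [in RHS]FE.
by rewrite [RHS]linearZ.
Qed.

End Surjectivity.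

Section Specialization.
Variables (K : fieldType) (n : nat) (gT : finGroupType).
Hypothesis charK0 : [pchar K] =i pred0.
Variable sigma : gT -> 'M[K]_n.
Hypothesis rep : faithful_rep sigma.
Local Notation tau := (dual_rep sigma).
Variable W : {group gT}.
Hypothesis Wgen : W :=: (<<refls sigma W>>)%g.
Variable lam : 'rV[K]_n.
Variable X : {group gT}.
Hypothesis XN : X \subset 'N(W)%g.
Implicit Types (p q r h : {mpoly K[n]}) (f : gT -> {mpoly K[n]}).
Local Notation J := (jac tau W).
Local Notation M := (msize J).
Local Notation Phi := (family_form sigma W lam).
Local Notation kappa := (harm_proj sigma W X).
Local Notation fam := (jac_family sigma W lam).

Definition harm_of_family f := kappa (truncate M (Phi f)).

Local Notation Psi := harm_of_family.

Lemma eq_Psi f g : {in W, f =1 g} -> Psi f = Psi g.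
Proof.
by move=> fg; rewrite /harm_of_family; congr harm_proj; apply: eq_truncate; apply: eq_Phi.
Qed.

Lemma Psi_harm f : harm sigma W (Psi f).
Proof. exact: harm_proj_harm. Qed.

Lemma Psi_linear a f g : Psi (fun x => a *: f x + g x) = a *: Psi f + Psi g.
Proof.
rewrite /harm_of_family -linearP -truncate_linear; congr harm_proj; apply: eq_truncate => p.
exact: Phi_linearl.
Qed.

Lemma Psi_scale a f : Psi (fun x => a *: f x) = a *: Psi f.
Proof.
have E0 : Psi (fun=> 0) = 0.
  have := Psi_linear 1 (fun=> 0) (fun=> 0); rewrite !scale1r addr0.
  by move=> /eqP; rewrite -subr_eq0 opprD addrA subrr sub0r oppr_eq0 => /eqP.
rewrite -[RHS]addr0 -E0 -Psi_linear; apply: eq_Psi => x _.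
by rewrite addr0.
Qed.

Lemma Psi_sum (I : Type) (r : seq I) (P : pred I) (F : I -> gT -> {mpoly K[n]}) :
  Psi (fun x => \sum_(i <- r | P i) F i x) = \sum_(i <- r | P i) Psi (F i).
Proof.
elim: r => [|i r IH].
  rewrite big_nil -[RHS](scale0r (Psi (fun=> 0))) -Psi_scale.
  by apply: eq_Psi => x _; rewrite big_nil scaler0.
rewrite big_cons -IH; case: ifP => Pi.
  rewrite -[Psi (F i)]scale1r -Psi_linear; apply: eq_Psi => x _.
  by rewrite big_cons Pi scale1r.
by apply: eq_Psi => x _; rewrite big_cons Pi.
Qed.

(** Serves for group elements, for rescalings and for their products alike. *)
Lemma Psi_semilinear f f' B (a : K) :
  (forall p, Phi f' p = a * Phi f (lsub B^T p)) ->
  (forall h, kappa (lsub B h) = lsub B (kappa h)) ->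
  Psi f' = a *: lsub B (Psi f).
Proof.
move=> ff' kB; rewrite /harm_of_family -kB -truncate_lsub // -linearZ /=; congr harm_proj.
rewrite (eq_truncate _ ff') /truncate scaler_sumr; apply: eq_bigr => m _ /=.
by rewrite scalerA mulrA.
Qed.

(** Induction on the order of [h], which ends once the order reaches [M]. Up to the degree of [J],
    the series of [fam 1] is [c] times [J]; a suitable derivative of it matches the lowest component
    of [h], and the remainder has larger order. *)
Lemma Psi_surj h : harm sigma W h -> exists p, Psi (fam p) = h.
Proof.
have [c c0 Pc] := Phi_fam_jac charK0 rep Wgen lam.
have IH0 d g : (M <= d)%N -> order_ge d g -> harm sigma W g -> exists p, Psi (fam p) = g.
  move=> Md gd gH; exists 0.
  have -> : g = 0.
    by apply: (order_msize_eq0 gd); rewrite (leq_trans (msize_harm charK0 rep Wgen gH)).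
  rewrite -[RHS](scale0r (Psi (fun=> 0))) -Psi_scale; apply: eq_Psi => x _.
  by rewrite /jac_family !rmorph0 Dop0l scaler0.
suff H k d h' : (M <= d + k)%N -> order_ge d h' -> harm sigma W h' ->
    exists p, Psi (fam p) = h'.
  by move=> hH; apply: (H M 0%N).
elim: k d h' => [|k IH] d {}h; first by rewrite addn0; exact: IH0.
have [dM|Md'] := ltnP d M; last by move=> _ hd hH; exact: IH0 hd hH.
rewrite addnS -addSn => Md hd hH; have [p1 hE] := harm_jac charK0 rep Wgen hH.
set N := #|refls tau W|.
have JN : hcomp N J = J by apply: pihomog_dE; apply: jac_homog.
have MN : (M <= N.+1)%N by rewrite -JN msize_hcomp_le.
(* [h] is [p1] applied to [J], which has degree [N], so its component of degree [d] comes from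
   degree [N - d] in [p1]. The test excludes truncated subtraction. *)
pose p2 := if (d <= N)%N then hcomp (N - d) p1 else 0.
have hdE : hcomp d h = Dop p2 J.
  pose k0 := maxn (msize p1) N.+1.
  rewrite hE [p1 in LHS](@hcomp_sum _ _ _ k0 (leq_maxl _ _)) Dop_suml linear_sum /=.
  have E e : hcomp d (Dop (hcomp e p1) J) = if (d + e == N)%N then Dop (hcomp e p1) J else 0.
    rewrite hcomp_Dop -[in LHS]JN hcomp_hcomp; case: eqP => [->|_]; first by rewrite JN.
    by rewrite linear0.
  under eq_bigr => e _ do rewrite E.
  rewrite -big_mkcond /p2; case: leqP => dN; last first.
    rewrite big_pred0 ?Dop0l // => e; apply/negbTE; rewrite neq_ltn.
    by rewrite (leq_trans dN) ?leq_addr ?orbT.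
  have Nk : (N - d < k0)%N by rewrite (leq_trans _ (leq_maxr _ _)) // ltnS leq_subr.
  rewrite (big_pred1 (Ordinal Nk)) // => e; rewrite /= -val_eqE /=.
  by rewrite -[RHS](eqn_add2l d) subnKC.
have NM : (N < M)%N.
  rewrite ltnNge; apply: contraTN isT => MN'; have := jac_neq0 tau W.
  by rewrite -JN hcomp_msize ?eqxx.
have p2N r : (msize r <= d.+1)%N -> (msize (p2 * r) <= M)%N.
  move=> rd; rewrite /p2; case: (leqP d N) => dN; last by rewrite mul0r msize0.
  have [a0|a0] := eqVneq (hcomp (N - d) p1) 0; first by rewrite a0 mul0r msize0.
  have [r0|r0] := eqVneq r 0; first by rewrite r0 mulr0 msize0.
  rewrite msizeM //; apply: leq_trans NM;
  rewrite -ltnS prednK ?addn_gt0 ?lt0n ?msize_poly_eq0 ?a0 //.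
  by rewrite (leq_trans (leq_add (msize_hcomp_le _ _) rd)) // addSn addnS subnK.
pose f := fam (c^-1 *: p2); set F := truncate M (Phi f).
have FE r : (msize r <= d.+1)%N -> pair r (F - hcomp d h) = 0.
  move=> rd; rewrite linearB /= pair_truncate // ?(leq_trans rd) //=.
  rewrite /f Phi_fam Pc; last first.
    by rewrite -scalerAl (leq_trans (msizeZ_le _ _)) // p2N.
  by rewrite -scalerAl pairZl mulVKf // mulrC pairM -hdE subrr.
have ord : order_ge d.+1 (h - Psi f).
  have -> : h - Psi f = kappa (h - F).
    by rewrite linearB /= harm_proj_id.
  have hF : order_ge d.+1 (h - F).
    have -> : h - F = (h - hcomp d h) - (F - hcomp d h) by rewrite opprB addrA subrK.
    apply: order_geB => m md.
      rewrite mcoeffB mcoeff_hcomp; case: eqP => [_|/eqP md']; first by rewrite subrr.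
      by rewrite hd ?subrr // ltn_neqAle md' -ltnS.
    have := FE 'X_[m]; rewrite msizeX => /(_ md); rewrite pairX -[_ *+ _]mulr_natr => /eqP.
    by rewrite mulf_eq0 (negbTE (mfact_neq0 charK0 m)) orbF => /eqP.
  apply/order_ge_hcomp => e ed; rewrite hcomp_harm_proj.
  by have /order_ge_hcomp -> := hF; rewrite ?linear0.
have [|p' p'E] := IH d.+1 (h - Psi f) Md ord.
  by rewrite -scaleN1r addrC; apply: harm_linear => //; apply: Psi_harm.
exists (p' + c^-1 *: p2); rewrite -(subrK (Psi f) h) -p'E -[Psi (fam p')]scale1r -Psi_linear.
by apply: eq_Psi => x _; rewrite -fam_linear scale1r.
Qed.

End Specialization.

(** * The regular representation and injectivity *)

Section GenericPoints.
Variable K : fieldType.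
Hypothesis charK0 : [pchar K] =i pred0.

Lemma natK_inj : injective (fun i : nat => i%:R : K).
Proof.
move=> i j; wlog ij : i j / (i <= j)%N => [H|].
  by case/orP: (leq_total i j) => ij E; [apply: H|apply/esym/H].
move=> E; have : (j - i)%:R = 0 :> K by rewrite natrB // E subrr.
by move/eqP; rewrite (iffLR (pcharf0P K) charK0) subn_eq0 => ji; apply/eqP; rewrite eqn_leq ij.
Qed.

Lemma poly_nonroot (q : {poly K}) : q != 0 -> exists t, q.[t] != 0.
Proof.
move=> q0; pose rs := [seq i%:R : K | i <- iota 0 (size q)].
have : ~~ all (root q) rs.
  apply: contraTN isT => qr; have := max_poly_roots q0 qr.
  by rewrite map_inj_uniq ?iota_uniq ?size_map ?size_iota ?ltnn //; [move/(_ isT)|exact: natK_inj].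
by case/allPn => t _ qt; exists t.
Qed.

Lemma generic_row (I : finType) (P : pred I) n m (A : I -> 'M[K]_(n, m)) :
  (forall i, P i -> A i != 0) -> exists u : 'rV[K]_n, forall i, P i -> u *m A i != 0.
Proof.
(* Along the moment curve (1, t, t^2, ...), the entries of the product are polynomials in [t] whose
   coefficients are the entries of [A i]; it remains to avoid finitely many roots. *)
move=> A0; pose q i j : {poly K} := \sum_(k < n) A i k j *: 'X^k.
have q_eval i j t : (q i j).[t] = ((\row_(k < n) t ^+ k) *m A i) 0 j.
  rewrite horner_sum mxE; apply: eq_bigr => k _.
  by rewrite hornerZ hornerXn mxE mulrC.
have q_coef i j k : (q i j)`_(nat_of_ord k) = A i k j.
  rewrite coef_sum (bigD1 k) //= coefZ coefXn eqxx mulr1 big1 ?addr0 // => l lk.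
  by rewrite coefZ coefXn eq_sym [_ == _ :> nat](negbTE lk) mulr0.
have ex i : exists r : {poly K}, r != 0 /\ forall t, P i -> r.[t] != 0 ->
    (\row_(k < n) t ^+ k) *m A i != 0.
  have [Pi|_] := boolP (P i); last by exists 1; rewrite oner_neq0.
  have /matrix0Pn[k [j kj]] := A0 i Pi; exists (q i j); split=> [|t _].
    by apply: contraNneq kj => q0; rewrite -q_coef q0 coef0.
  by rewrite q_eval; apply: contraNneq => ->; rewrite mxE.
have [r rE] := fin_all_exists ex.
have [|t tE] := @poly_nonroot (\prod_(i : I) r i).
  by apply/prodf_neq0 => i _; case: (rE i).
exists (\row_(k < n) t ^+ k) => i Pi; apply: (rE i).2 => //.
by move: tE; rewrite (bigD1 i) //= hornerM mulf_eq0 negb_or => /andP[].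
Qed.

(** The square matrix expressing the free family [u] through [v] has no kernel on rows, so it is
    invertible and turns a relation among the [v] into one among the [u]. *)
Lemma dual_basis_dim (V : lmodType K) (T : finType) (A : {set T}) (u v : T -> V) :
  (forall c : T -> K, \sum_(x in A) c x *: u x = 0 -> forall x, x \in A -> c x = 0) ->
  (forall x, x \in A -> exists d : T -> K, u x = \sum_(y in A) d y *: v y) ->
  forall c : T -> K, \sum_(x in A) c x *: v x = 0 -> forall x, x \in A -> c x = 0.
Proof.
move=> ufree uspan c cv.
have [D DE] : exists D : T -> T -> K, forall x, x \in A -> u x = \sum_(y in A) D x y *: v y.
  have : forall x, exists d : T -> K, x \in A -> u x = \sum_(y in A) d y *: v y.
    move=> x; have [xA|_] := boolP (x \in A); last by exists (fun=> 0).
    by have [d dE] := uspan x xA; exists d.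
  by case/fin_all_exists => D DE; exists D.
pose B := \matrix_(i, j < #|A|) D (enum_val i) (enum_val j).
have sumA (F : T -> V) : \sum_(x in A) F x = \sum_(i < #|A|) F (enum_val i).
  by rewrite big_enum_val.
pose fun_of (w : 'rV[K]_#|A|) x : K :=
  if [pick i | enum_val i == x :> T] is Some i then w 0 i else 0.
have fun_ofE (w : 'rV[K]_#|A|) i : fun_of w (enum_val i) = w 0 i.
  rewrite /fun_of; case: pickP => [j /eqP/enum_val_inj->//|/(_ i)].
  by rewrite eqxx.
have uB (w : 'rV[K]_#|A|) : \sum_(i < #|A|) w 0 i *: u (enum_val i) =
            \sum_(j < #|A|) (w *m B) 0 j *: v (enum_val j).
  under eq_bigr => i _ do rewrite (DE _ (enum_valP i)) sumA scaler_sumr.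
  rewrite exchange_big; apply: eq_bigr => j _ /=; rewrite mxE scaler_suml.
  by apply: eq_bigr => i _; rewrite scalerA mxE.
have winj (w : 'rV[K]_#|A|) : \sum_(i < #|A|) w 0 i *: u (enum_val i) = 0 -> w = 0.
  move=> w0; apply/rowP => i; rewrite mxE -fun_ofE; apply: (ufree (fun_of w) _ _ (enum_valP i)).
  by rewrite sumA -[RHS]w0; apply: eq_bigr => j _; rewrite fun_ofE.
have Bu : B \in unitmx.
  rewrite -row_free_unit -kermx_eq0; apply/eqP/row_matrixP => i; rewrite row0.
  apply: winj; rewrite uB big1 // => j _.
  by rewrite -row_mul mulmx_ker row0 mxE scale0r.
pose r : 'rV[K]_#|A| := \row_i c (enum_val i); pose w := r *m invmx B.
have w0 : w = 0.
  apply: winj; rewrite uB mulmxKV // -[RHS]cv sumA; apply: eq_bigr => i _.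
  by rewrite mxE.
have r0 : r = 0 by rewrite -[r](mulmxKV Bu) -/w w0 mul0mx.
move=> x xA; move: r0.
by move/rowP/(_ (enum_rank_in xA x)); rewrite !mxE enum_rankK_in.
Qed.

End GenericPoints.

(** * Harmonic polynomials as the regular representation *)

Section NormalBasis.
Variables (K : fieldType) (n : nat) (gT : finGroupType).
Hypothesis charK0 : [pchar K] =i pred0.
Variable sigma : gT -> 'M[K]_n.
Hypothesis rep : faithful_rep sigma.
Local Notation tau := (dual_rep sigma).
Let trep : faithful_rep tau := faithful_dual rep.
Let rep1 : sigma 1%g = 1%:M. Proof. by case: rep. Qed.
Let repM x y : sigma (x * y)%g = sigma x *m sigma y. Proof. by case: rep. Qed.
Let trepM x y : tau (x * y)%g = tau x *m tau y. Proof. by case: trep. Qed.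
Implicit Types (p q r h : {mpoly K[n]}) (f : gT -> {mpoly K[n]}).

Lemma dual_rep_tr g : (tau g)^T = sigma g^-1%g. Proof. by rewrite /dual_rep trmxK. Qed.

Section Generic.
Variable W : {group gT}.
Hypothesis Wgen : W :=: (<<refls sigma W>>)%g.
Variable lam : 'rV[K]_n.
Hypothesis lam_generic : forall x, x \in W -> lam *m sigma x = lam -> x = 1%g.
Local Notation J := (jac tau W).
Local Notation M := (msize J).
Local Notation Phi := (family_form sigma W lam).
Local Notation Psi := (harm_of_family sigma W lam W).

(** A nonzero series would have a nonzero harmonic lowest term, which the projection fixes. So the
    series itself vanishes, and exponentials at the distinct points of the orbit are independent. *)
Lemma Psi_generic_inj (c : gT -> K) : Psi (fun x => (c x)%:MP) = 0 ->
  forall x, x \in W -> c x = 0.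
Proof.
set f := fun x => _; move=> Psi0 x0 x0W.
have fH x : x \in W -> harm sigma (stab_group sigma W lam) (f x).
  by move=> _ q _ q0; rewrite Dop_const q0 mul0r mpolyC0.
have Pinv q r : minvariant sigma W q -> Phi f (q * r) = q.@[lam 0] * Phi f r.
  by move=> qI; apply: Phi_inv.
have Phi0 p : Phi f p = 0.
  apply/eqP; apply: contraTT isT => p0.
  have [d [F [FH F0 FdF FE _]]] := lowest_term charK0 Pinv p0.
  have dM : (d < M)%N.
    rewrite ltnNge; apply: contraNN F0 => Md; rewrite -FdF; apply/eqP/hcomp_msize.
    by rewrite (leq_trans (msize_harm charK0 rep Wgen FH)).
  have := congr1 (@hcomp K n d) Psi0; rewrite linear0 hcomp_harm_proj hcomp_truncate // -FE.
  rewrite harm_proj_id // ?normG // => F00; by rewrite F00 eqxx in F0.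
have [|p px0 pord] := @separating_poly K n _ (fun x => (x \in W) && (x != x0))
    (lam *m sigma x0) (fun x => lam *m sigma x) 1.
  move=> x /andP[xW xx0]; apply: contraNneq xx0 => xl; rewrite eq_mulgV1; apply/eqP.
  apply: lam_generic; first by rewrite groupM // groupV.
  by rewrite repM mulmxA xl -mulmxA repKV // mulmx1.
have ev x : pair (trans lam (lsub (sigma x) p)) (f x) = p.@[(lam *m sigma x) 0] * c x.
  by rewrite /pair /f Dop_const mcoeffC eqxx mulr1 mcoeff0_trans meval_lsub.
have := Phi0 p; rewrite /family_form (bigD1 x0) //= big1 ?addr0 => [|x xP]; last first.
  by rewrite ev -mcoeff0_trans pord ?mul0r // mdeg0.
by rewrite ev => /eqP; rewrite mulf_eq0 (negbTE px0) => /eqP.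
Qed.

Lemma stab_generic : stab_group sigma W lam :=: 1%g.
Proof.
apply/trivgP/subsetP => y yR; rewrite inE; apply/eqP/lam_generic.
  exact: (subsetP (stab_group_sub sigma W lam)).
exact: stab_group_fix yR.
Qed.

Lemma Psi_generic_surj h : harm sigma W h -> exists c : gT -> K, h = Psi (fun x => (c x)%:MP).
Proof.
move=> hH; have [p <-] := Psi_surj charK0 rep Wgen lam (normG W) hH.
exists (fun x => (trans lam (lsub (sigma x) p))@_0%MM * jchi tau W x).
apply: eq_Psi => x _; rewrite /jac_family; set R := stab_group _ _ _.
have -> : jac tau R = 1.
  rewrite /jac big_pred0 // => s; apply/negbTE; apply: contraTN isT => sR.
  have := refl_neq1 trep sR; move: sR; rewrite inE => /andP[].
  by rewrite /= stab_generic inE => ->.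
by rewrite -mul_mpolyC mulr1 Dop_const.
Qed.

Lemma Psi_shift f g : g \in W -> Psi (fun x => f (x * g)%g) = lsub (tau g) (Psi f).
Proof.
move=> gW; have E := @Psi_semilinear K n gT charK0 sigma W lam W f
  (fun x => f (x * g)%g) (tau g) 1.
rewrite E; first by rewrite scale1r.
  by move=> p; rewrite mul1r (Phi_shift rep lam f p gW) dual_rep_tr.
by move=> h; rewrite (harm_proj_rep rep).
Qed.

End Generic.

Lemma generic_exists (W : {group gT}) : exists lam : 'rV[K]_n,
  forall x, x \in W -> lam *m sigma x = lam -> x = 1%g.
Proof.
have [|lam lamP] := @generic_row K charK0 _ (fun x => x != 1%g) n n (fun x => sigma x - 1%:M).
  move=> x; apply: contraNneq => /eqP; rewrite subr_eq0 => /eqP x1.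
  by case: rep => _ _ inj; apply/eqP/inj; rewrite x1 rep1.
exists lam => x _ xl; apply/eqP; apply: contraT => /lamP.
by rewrite mulmxBr mulmx1 xl subrr eqxx.
Qed.

(** The generator is the image of the constant family supported at the identity, whose translates
    form a basis of the constant families. *)
Lemma harm_normal_basis (W : {group gT}) : W :=: (<<refls sigma W>>)%g ->
  exists b, [/\ harm sigma W b,
    forall h, harm sigma W h -> exists c : gT -> K, h = \sum_(x in W) c x *: lsub (tau x) b &
    forall c : gT -> K, \sum_(x in W) c x *: lsub (tau x) b = 0 ->
      forall x, x \in W -> c x = 0].
Proof.
move=> Wgen; have [lam lamP] := generic_exists W.
pose dl (x : gT) : {mpoly K[n]} := (x == 1%g)%:R%:MP.
pose Ps := harm_of_family sigma W lam W.
have sumE (c : gT -> K) : \sum_(x in W) c x *: lsub (tau x) (Ps dl) =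
    Ps (fun x => (c x^-1%g)%:MP).
  transitivity (\sum_(g in W) Ps (fun x => c g *: dl (x * g)%g)).
    by apply: eq_bigr => g gW; rewrite /Ps Psi_scale Psi_shift.
  rewrite -[LHS]Psi_sum; apply: eq_Psi => x xW.
  rewrite (bigD1 x^-1%g) ?groupV //= big1 ?addr0 => [|g /andP[_ gx]].
    by rewrite /dl mulgV eqxx -mul_mpolyC mulr1.
  rewrite /dl (_ : _ == _ = false) ?mpolyC0 ?scaler0 //; apply: contraNF gx => /eqP E.
  by rewrite -[g](mulKg x) E mulg1.
exists (Ps dl); split=> [|h hH|c]; first exact: Psi_harm (normG W) _.
- have [c ->] := Psi_generic_surj Wgen lamP hH; exists (fun x => c x^-1%g).
  rewrite sumE; apply: eq_Psi => x _; by rewrite invgK.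
rewrite sumE => /(Psi_generic_inj Wgen lamP) c0 x xW.
by rewrite -[x]invgK c0 ?groupV.
Qed.

Section Injectivity.
Variable W : {group gT}.
Hypothesis Wgen : W :=: (<<refls sigma W>>)%g.
Variable lam : 'rV[K]_n.
Variable X : {group gT}.
Hypothesis XN : X \subset 'N(W)%g.
Local Notation R := (stab_group sigma W lam).
Local Notation Psi := (harm_of_family sigma W lam X).

(* By normal bases, the equivariant families and the harmonic polynomials both have
   dimension [#|W|], so that surjectivity suffices. *)
Lemma Psi_inj f : (forall x, x \in W -> harm sigma R (f x)) ->
  (forall y x, y \in R -> x \in W -> f (y * x)%g = lsub (tau y) (f x)) ->
  Psi f = 0 -> forall x, x \in W -> f x = 0.
Proof.
have [bR [bRH bRs bRf]] := harm_normal_basis (stab_gen rep W lam).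
have [bW [bWH bWs bWf]] := harm_normal_basis Wgen.
have RW := subsetP (stab_group_sub sigma W lam).
(* In a normal basis for [R], an equivariant family is encoded by a single function on [W]. *)
pose fd (d : gT -> K) x := \sum_(r in R) d (r^-1 * x)%g *: lsub (tau r) bR.
have fdE g : (forall x, x \in W -> harm sigma R (g x)) ->
    (forall y x, y \in R -> x \in W -> g (y * x)%g = lsub (tau y) (g x)) ->
    exists d, {in W, g =1 fd d}.
  move=> gH gR; have [c cE] : exists c : gT -> gT -> K, forall x, x \in W ->
      g x = \sum_(r in R) c x r *: lsub (tau r) bR.
    have : forall x, exists c : gT -> K, x \in W -> g x = \sum_(r in R) c r *: lsub (tau r) bR.
      move=> x; have [xW|_] := boolP (x \in W); last by exists (fun=> 0).
      by have [c cE] := bRs _ (gH x xW); exists c.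
    by case/fin_all_exists => c cE; exists c.
  (* Equivariance under r^-1 gives c x r = c (r^-1 x) 1, so the coefficients at the identity
     determine the rest. *)
  exists (fun x => c x 1%g) => x xW; rewrite cE //; apply: eq_bigr => r rR; congr (_ *: _).
  have rxW : (r^-1 * x)%g \in W by rewrite groupM // groupV RW.
  have rVR : r^-1%g \in R by rewrite groupV.
  have := gR r^-1%g x rVR xW; rewrite !cE // linear_sum /= => /eqP.
  rewrite -subr_eq0 [X in _ - X](reindex_inj (mulgI r)) /=.
  rewrite [X in _ - X](eq_bigl (mem R)) => [|s]; last by rewrite groupMl.
  rewrite -sumrB => /eqP E.
  have /bRf/(_ _ (group1 _))/eqP : \sum_(s in R)
      (c (r^-1 * x)%g s - c x (r * s)%g) *: lsub (tau s) bR = 0.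
    rewrite -[RHS]E; apply: eq_bigr => s _; rewrite scalerBl; congr (_ - _).
    by rewrite linearZ /= -lsubM -trepM mulKg.
  by rewrite mulg1 subr_eq0 => /eqP.
pose v y := Psi (fd (fun x => (x == y)%:R)).
have fdsum d : Psi (fd d) = \sum_(y in W) d y *: v y.
  transitivity (Psi (fun x => \sum_(y in W) d y *: fd (fun z => (z == y)%:R) x)); last first.
    by rewrite Psi_sum; apply: eq_bigr => y _; rewrite Psi_scale.
  apply: eq_Psi => x xW; under [RHS]eq_bigr => y _ do rewrite scaler_sumr.
  rewrite exchange_big; apply: eq_bigr => r rR /=.
  have rxW : (r^-1 * x)%g \in W by rewrite groupM // groupV RW.
  rewrite (bigD1 _ rxW) /= eqxx scale1r big1 ?addr0 // => y /andP[_ /negbTE yx].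
  by rewrite eq_sym yx scale0r scaler0.
have vfree := @dual_basis_dim K _ _ W (fun x => lsub (tau x) bW) v bWf.
move=> fH fR Pf; have [d dE] := fdE f fH fR.
have d0 : forall x, x \in W -> d x = 0.
  apply: vfree => [x xW|]; last by rewrite -fdsum -Pf; apply: eq_Psi => x xW; rewrite dE.
  have xH : harm sigma W (lsub (tau x) bW).
    by apply: harm_norm => //; apply: (subsetP (normG W)).
  have [p pE] := Psi_surj charK0 rep Wgen lam XN xH.
  have [||d' d'E] := fdE (jac_family sigma W lam p).
  - by move=> y _; apply: fam_harm.
  - by move=> y z yR zW; apply: fam_rep.
  by exists d'; rewrite -pE -fdsum; apply: eq_Psi.
move=> x xW; rewrite dE // /fd big1 // => r rR.
by rewrite d0 ?scale0r // groupM // groupV RW.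
Qed.

End Injectivity.
End NormalBasis.

(** * A semi-invariant linear form attached to an eigenvector *)

Section RationalEmbedding.
Import Order.TTheory Num.Theory.
Variable K : fieldType.
Hypothesis charK0 : [pchar K] =i pred0.

Lemma intr_eq0_char0 (z : int) : (z%:~R == 0 :> K) = (z == 0).
Proof.
case: z => m; rewrite ?NegzE ?mulrNz ?oppr_eq0 -pmulrn (iffLR (pcharf0P K) charK0) //.
Qed.

Lemma ratr_frac (a b : int) : b != 0 -> ratr (a%:~R / b%:~R) = a%:~R / b%:~R :> K.
Proof.
move=> b0; set x : rat := a%:~R / b%:~R.
have b0K : b%:~R != 0 :> K by rewrite intr_eq0_char0.
have d0K : (denq x)%:~R != 0 :> K by rewrite intr_eq0_char0 denq_eq0.
have : numq x * b = a * denq x.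
  apply: (@intr_inj rat); rewrite !intrM numqE /x.
  by rewrite mulrAC divfK ?intr_eq0.
move/(congr1 (intr : int -> K)); rewrite !intrM => E; rewrite /ratr.
by apply/eqP; rewrite eqr_div // E.
Qed.

Lemma ratr_add_char0 : {morph (ratr : rat -> K) : x y / x + y}.
Proof.
move=> x y; rewrite -[x]divq_num_den -[y]divq_num_den.
have dx := denq_neq0 x; have dy := denq_neq0 y.
rewrite addf_div ?intr_eq0 // -!intrM -intrD !ratr_frac ?mulf_neq0 //.
by rewrite addf_div ?intr_eq0_char0 // -!intrM -intrD.
Qed.

Lemma ratr_mul_char0 : {morph (ratr : rat -> K) : x y / x * y}.
Proof.
move=> x y; rewrite -[x]divq_num_den -[y]divq_num_den.
have dx := denq_neq0 x; have dy := denq_neq0 y.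
by rewrite mulf_div -!intrM !ratr_frac ?mulf_neq0 // mulf_div -!intrM.
Qed.

Lemma rat_rmorphism : exists f : {rmorphism rat -> K}, True.
Proof.
have rn : nmod_morphism (ratr : rat -> K).
  split; last exact: ratr_add_char0.
  by rewrite /ratr mul0r.
have rm : monoid_morphism (ratr : rat -> K).
  split; last exact: ratr_mul_char0.
  by rewrite /ratr (_ : numq 1 = 1) // (_ : denq 1 = 1) // divr1.
pose i1 := GRing.isNmodMorphism.Build rat K (ratr : rat -> K) rn.
pose i2 := GRing.isMonoidMorphism.Build rat K (ratr : rat -> K) rm.
pose f : {rmorphism rat -> K} := HB.pack (ratr : rat -> K) i1 i2.
by exists f.
Qed.

End RationalEmbedding.

(** * Functions on a finite group that equal their averages *)

Section Averaging.
Import Order.TTheory Num.Theory.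
Variable K : fieldType.
Hypothesis charK0 : [pchar K] =i pred0.
Variables (gT : finGroupType) (I : finType) (c : I -> gT).

(** A discrete energy argument: by the averaging hypothesis the total of the squared differences
    reduces to a difference of two sums, which translation in the group makes equal. So each square
    vanishes. *)
Lemma avg_const_rat (u : gT -> rat) :
  (forall x, \sum_i u (x * c i)%g = #|I|%:R * u x) -> forall x i, u (x * c i)%g = u x.
Proof.
move=> uavg x i; apply/eqP; rewrite -subr_eq0 -sqrf_eq0.
have sq_ge0 x' i' : 0 <= (u (x' * c i')%g - u x') ^+ 2 by apply: sqr_ge0.
have : \sum_x' \sum_i' (u (x' * c i')%g - u x') ^+ 2 == 0.
  have inner x' : \sum_i' (u (x' * c i')%g - u x') ^+ 2 =
      \sum_i' u (x' * c i')%g ^+ 2 - #|I|%:R * u x' ^+ 2.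
    rewrite (eq_bigr (fun i' => u (x' * c i')%g ^+ 2 -
        (u (x' * c i')%g * (2 * u x') - u x' ^+ 2))) => [|i' _]; last by ring.
    rewrite sumrB sumrB -mulr_suml uavg sumr_const -mulr_natl; congr (_ - _).
    by rewrite -/(#|I|); ring.
  under eq_bigr => x' _ do rewrite inner.
  rewrite sumrB exchange_big /= -mulr_sumr subr_eq0; apply/eqP.
  rewrite mulr_natl -sumr_const; apply: eq_bigr => i' _.
  by rewrite [RHS](reindex_inj (mulIg (c i'))).
rewrite psumr_eq0 => [|x' _]; last by apply: sumr_ge0.
move/allP/(_ x (mem_index_enum x)); rewrite /= psumr_eq0 //.
by move/allP/(_ i (mem_index_enum i)).
Qed.

(* The system is defined over the rationals, where it has only the obvious
   solutions by positivity of sums of squares; its rank does not change over [K]. *)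
Lemma avg_const (u : gT -> K) :
  (forall x, \sum_i u (x * c i)%g = #|I|%:R * u x) -> forall x i, u (x * c i)%g = u x.
Proof.
move=> uavg x i; have [f _] := rat_rmorphism charK0.
pose N := #|{: gT}|.
pose shift (F : comPzRingType) (y : gT) : 'M[F]_N :=
  \matrix_(a, b) (enum_val a == enum_val b * y :> gT)%g%:R.
have shiftE (F : comPzRingType) (w : gT -> F) y b :
    ((\row_(a < N) w (enum_val a)) *m shift F y) 0 b = w (enum_val b * y)%g.
  rewrite mxE (bigD1 (enum_rank (enum_val b * y)%g)) //= big1 => [|a ab].
    by rewrite !mxE enum_rankK eqxx mulr1 addr0.
  rewrite !mxE (_ : _ == _ = false) ?mulr0 //; apply: contraNF ab => /eqP <-.
  by rewrite enum_valK.
(* With functions on the group as rows, [Z] is the averaging equation and [D] the claimed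
   conclusion; the kernel of [Z] is compatible with field extension. *)
pose Z (F : comPzRingType) : 'M[F]_N := \sum_i shift F (c i) - #|I|%:R%:M.
pose D (F : comPzRingType) : 'M[F]_N := shift F (c i) - 1%:M.
have shift_map y : map_mx f (shift rat y) = shift K y.
  by apply/matrixP => a b; rewrite !mxE rmorph_nat.
have Zmap : map_mx f (Z rat) = Z K.
  rewrite /Z rmorphB /= rmorph_sum /= map_scalar_mx rmorph_nat; congr (_ - _).
  by apply: eq_bigr => j _; apply: shift_map.
have Dmap : map_mx f (D rat) = D K by rewrite /D rmorphB /= map_mx1 shift_map.
have ZE (F : comPzRingType) (w : gT -> F) b : ((\row_(a < N) w (enum_val a)) *m Z F) 0 b =
    \sum_j w (enum_val b * c j)%g - #|I|%:R * w (enum_val b).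
  rewrite mulmxBr mulmx_sumr mul_mx_scalar mxE summxE; congr (_ + _); last by rewrite !mxE.
  by apply: eq_bigr => j _; apply: shiftE.
have kerQ : kermx (Z rat) *m D rat = 0.
  apply/row_matrixP => a; rewrite row_mul row0; set r := row a _.
  have rZ : r *m Z rat = 0 by rewrite -row_mul mulmx_ker row0.
  pose w (y : gT) : rat := r 0 (enum_rank y).
  have rw : r = \row_(b < N) w (enum_val b) by apply/rowP => b; rewrite [RHS]mxE /w enum_valK.
  have wavg y : \sum_j w (y * c j)%g = #|I|%:R * w y.
    have := congr1 (fun A : 'rV_N => A 0 (enum_rank y)) rZ; rewrite rw ZE enum_rankK mxE.
    by move/eqP; rewrite subr_eq0 => /eqP.
  rewrite rw mulmxBr mulmx1; apply/rowP => b; rewrite mxE shiftE !mxE.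
  by rewrite (avg_const_rat wavg) subrr.
have kerK : kermx (Z K) *m D K = 0.
  by rewrite -Zmap -Dmap -map_kermx -map_mxM kerQ map_mx0.
pose ur := \row_(a < N) u (enum_val a).
have : (ur <= kermx (Z K))%MS.
  by apply/sub_kermxP/rowP => b; rewrite ZE uavg subrr mxE.
case/submxP => A urE.
have : ur *m D K = 0 by rewrite urE -mulmxA kerK mulmx0.
move/rowP/(_ (enum_rank x)); rewrite mulmxBr mulmx1 mxE shiftE !mxE enum_rankK.
by move/eqP; rewrite subr_eq0 => /eqP.
Qed.

End Averaging.

Section LineCharacter.
Variables (K : fieldType) (n : nat) (gT : finGroupType).
Variable rho : gT -> 'M[K]_n.
Hypothesis rep : faithful_rep rho.
Variables (v : 'cV[K]_n) (L : {group gT}).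
Hypothesis v0 : v != 0.
Hypothesis Lv : forall x, x \in L -> exists c : K, rho x *m v = c *: v.
Local Notation th := (theta rho v).
Let rep1 : rho 1%g = 1%:M. Proof. by case: rep. Qed.
Let repM x y : rho (x * y)%g = rho x *m rho y. Proof. by case: rep. Qed.

Lemma line_theta x : x \in L -> rho x *m v = th x *: v.
Proof. by move=> xL; have [c xv] := Lv xL; rewrite xv (thetaE v0 xv). Qed.

Lemma theta1 : th 1%g = 1.
Proof. by apply: thetaE; rewrite // rep1 mul1mx scale1r. Qed.

Lemma thetaM : {in L &, {morph th : x y / (x * y)%g >-> x * y}}.
Proof.
move=> x y xL yL; apply: (scale_vect_inj v0).
rewrite /= -line_theta ?groupM // repM -mulmxA (line_theta yL) -scalemxAr.
by rewrite line_theta // scalerA mulrC.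
Qed.

Lemma theta_neq0 x : x \in L -> th x != 0.
Proof.
move=> xL; apply/eqP => x0; have := oner_neq0 K.
by rewrite -theta1 -(mulgV x) thetaM ?groupV // x0 mul0r eqxx.
Qed.

End LineCharacter.

Section Averages.
Variables (K : fieldType) (n : nat) (gT : finGroupType).
Hypothesis charK0 : [pchar K] =i pred0.
Variable sigma : gT -> 'M[K]_n.
Hypothesis rep : faithful_rep sigma.
Let rep1 : sigma 1%g = 1%:M. Proof. by case: rep. Qed.
Let repM x y : sigma (x * y)%g = sigma x *m sigma y. Proof. by case: rep. Qed.

(** Every coordinate of [sigma x *m v] is a function of [x] equal to its averages along the [c i];
    evaluate at the identity. *)
Lemma avg_fixed (I : finType) (c : I -> gT) (v : 'cV[K]_n) :
  \sum_i sigma (c i) *m v = #|I|%:R *: v -> forall i, sigma (c i) *m v = v.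
Proof.
move=> cv i; apply/colP => a.
have := @avg_const K charK0 gT I c (fun x => (sigma x *m v) a 0) _ 1%g i.
rewrite mul1g rep1 mul1mx; apply=> x.
have -> : #|I|%:R * (sigma x *m v) a 0 = (sigma x *m (#|I|%:R *: v)) a 0.
  by rewrite -scalemxAr [RHS]mxE.
rewrite -cv mulmx_sumr summxE; apply: eq_bigr => j _.
by rewrite repM mulmxA.
Qed.

(* [lam] is a generic member of the space of [theta]-semi-invariant linear forms;
   the averaging argument shows that no reflection moving [v] fixes all of it. *)
Lemma dual_eigenvector (Y G : {group gT}) (v : 'cV[K]_n) : v != 0 ->
  (forall y, y \in Y -> exists c, sigma y *m v = c *: v) ->
  exists lam : 'rV[K]_n,
    (forall y, y \in Y -> lam *m sigma y = theta sigma v y *: lam) /\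
    (forall s, s \in G -> sigma s *m v != v -> lam *m sigma s != lam).
Proof.
move=> v0 Yv; have thE := line_theta v0 Yv.
have thM := thetaM rep v0 Yv; have th0 := theta_neq0 rep v0 Yv.
(* Up to a scalar, the projector onto the semi-invariant rows. *)
pose e := \sum_(y in Y) (theta sigma v y)^-1 *: sigma y.
have eY y : y \in Y -> e *m sigma y = theta sigma v y *: e.
  move=> yY; rewrite /e mulmx_suml scaler_sumr [RHS](reindex_inj (mulIg y)) /=.
  apply: eq_big => [x|x xY]; first by rewrite groupMr.
  rewrite -scalemxAl -repM scalerA thM // invfM [_^-1 * _]mulrC mulrA divff ?mul1r //.
  exact: th0.
pose bad s := (s \in G) && (sigma s *m v != v).
have [|mu muP] := @generic_row K charK0 _ bad n n (fun s => e *m (sigma s - 1%:M)).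
  move=> s /andP[sG sv]; apply: contraNneq sv => es0; apply/eqP.
  (* Applied to [v], the relation e (s - 1) = 0 says that the average over [Y] of the conjugates of
     [s] fixes [v]; [s] is the conjugate by the identity. *)
  have := congr1 (mulmx^~ v) es0; rewrite mul0mx /e mulmx_suml mulmx_suml => E.
  pose cj (i : 'I_#|Y|) := (enum_val i * s * (enum_val i)^-1)%g.
  have -> : s = cj (enum_rank_in (group1 Y) 1%g).
    by rewrite /cj enum_rankK_in ?group1 // mul1g invg1 mulg1.
  apply: avg_fixed; rewrite card_ord -(big_enum_val (fun y => sigma (y * s * y^-1)%g *m v)).
  apply/eqP; rewrite -subr_eq0 scaler_nat -sumr_const -sumrB; apply/eqP; rewrite -[RHS]E.
  apply: eq_bigr => y yY; have yV : sigma y^-1%g *m v = (theta sigma v y)^-1 *: v.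
    apply: (scalerI (th0 y yY)); rewrite scalerA divff ?th0 // scale1r.
    by rewrite scalemxAr -thE // mulmxA repVK // mul1mx.
  rewrite !repM -mulmxA yV -scalemxAr -!scalemxAl mulmxBr mulmx1 mulmxBl scalerBr.
  by rewrite thE // scalerA mulVf ?th0 // scale1r.
exists (mu *m e); split=> [y yY|s sG sv].
  by rewrite -mulmxA eY // -scalemxAr.
have /muP : bad s by rewrite /bad sG.
by rewrite mulmxBr mulmx1 mulmxBr subr_eq0 mulmxA.
Qed.

End Averages.

(** * The twisted induced module *)

Section Harmonics.
Variables (K : fieldType) (n : nat) (gT : finGroupType).
Hypothesis charK0 : [pchar K] =i pred0.
Variable rho : gT -> 'M[K]_n.
Hypothesis rep : faithful_rep rho.
Local Notation tau := (dual_rep rho).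
Implicit Types (p q f h : {mpoly K[n]}).

Lemma actE g f : Defs.act rho g f = lsub (tau g) f.
Proof.
rewrite /Defs.act /lsub; congr (_ \mPo _); apply: eq_from_tnth => i; rewrite !tnth_mktuple.
by apply: eq_bigr => j _; rewrite mxE.
Qed.

(** Commuting with [w] means that [p] and its transform by [w] are the same operator, and the
    pairing separates symbols. *)
Lemma harmonicE (W : {set gT}) f : harmonic rho W f <-> harm rho W f.
Proof.
have E p : minvariant rho W p <-> forall w q, w \in W ->
    Defs.act rho w (Dop p q) = Dop p (Defs.act rho w q).
  split=> [pI w q wW|pC w wW]; first by rewrite !actE -(Dop_rep rep) pI.
  apply/eqP; rewrite -subr_eq0; apply/eqP; apply: (pair_injl charK0) => q.
  have := pC w (lsub (tau w^-1%g) q) wW; rewrite !actE -(Dop_rep rep).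
  rewrite -lsubM; have [t1 tM _] := faithful_dual rep.
  rewrite -tM mulgV t1 lsub1 => D; by rewrite pairBl /pair D subrr.
by split=> fH p; [move=> pI p0; apply: fH p0 _; apply/E|move=> p0 /E pI; apply: fH].
Qed.

(** This turns the graded twist by a scalar into a substitution. *)
Lemma lsub_scalarE t f : lsub t%:M f = \sum_(i < msize f) t ^+ i *: hcomp i f.
Proof.
rewrite [LHS](@hcomp_sum _ _ _ (msize f) (msize_lsub _ _)).
by apply: eq_bigr => i _; rewrite hcomp_lsub_scalar.
Qed.

Lemma harm_scalar (W : {group gT}) t f : harm rho W f -> harm rho W (lsub t%:M f).
Proof.
move=> fH; rewrite lsub_scalarE; apply: harm_sum => i _; apply: harm_scale.
exact: harm_hcomp.
Qed.

Lemma harm_proj_scalar (W X : {group gT}) t f :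
  harm_proj rho W X (lsub t%:M f) = lsub t%:M (harm_proj rho W X f).
Proof.
apply: hcomp_eqP => d; rewrite hcomp_harm_proj !hcomp_lsub_scalar linearZ /=.
by rewrite hcomp_harm_proj.
Qed.

Lemma lsub_scalar_comm t (B : 'M[K]_n) f : lsub t%:M (lsub B f) = lsub B (lsub t%:M f).
Proof. by rewrite -!lsubM scalar_mxC. Qed.

Lemma hcomp_twist t (k : int) i f : t != 0 ->
  hcomp i (t ^ k *: lsub t%:M f) = t ^ (k + i%:Z) *: hcomp i f.
Proof.
by move=> t0; rewrite linearZ /= hcomp_lsub_scalar scalerA expfzDr.
Qed.

Lemma twactE (A Gamma : {set gT}) v k x f : thetaExt rho A Gamma v x != 0 ->
  twact rho A Gamma v k x f =
  thetaExt rho A Gamma v x ^ k *: lsub (thetaExt rho A Gamma v x)%:M (lsub (tau x) f).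
Proof.
move=> t0; rewrite /twact actE lsub_scalarE scaler_sumr; apply: eq_bigr => i _.
by rewrite scalerA expfzDr.
Qed.

End Harmonics.

(** * Equivariance, kernel and image on the induced module *)

Section Induction.
Variables (K : fieldType) (n : nat) (gT : finGroupType).
Hypothesis charK0 : [pchar K] =i pred0.
Variable rho : gT -> 'M[K]_n.
Hypothesis rep : faithful_rep rho.
Local Notation tau := (dual_rep rho).
Implicit Types (p q h : {mpoly K[n]}) (f : gT -> {mpoly K[n]}).
Let rep1 : rho 1%g = 1%:M. Proof. by case: rep. Qed.
Let repM x y : rho (x * y)%g = rho x *m rho y. Proof. by case: rep. Qed.

Variables (G Gamma : {group gT}).
Hypothesis Ggen : G :=: (<<refls rho G>>)%g.
Variable v : 'cV[K]_n.
Hypothesis v0 : v != 0.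
Hypothesis Gamma_norm : Gamma \subset 'N(G)%g.
Hypothesis Gamma_line : forall x, x \in Gamma -> exists c : K, rho x *m v = c *: v.
Variable k : int.

Definition Gv := <<refl_fixing rho G v>>%G.
Definition Xg := (G <*> Gamma)%G.
Definition Yg := (Gv <*> Gamma)%G.
Local Notation th := (theta rho v).

Lemma Gv_fix a : a \in Gv -> rho a *m v = v.
Proof.
move=> /gen_prodgP[m [c cR ->]]; apply: (big_ind (fun x => rho x *m v = v)).
- by rewrite rep1 mul1mx.
- by move=> x z xl zl; rewrite repM -mulmxA zl xl.
- by move=> i _; have := cR i; rewrite inE => /and3P[_ _ /eqP].
Qed.

Lemma Gv_sub : Gv \subset G.
Proof. by rewrite gen_subG; apply/subsetP => s; rewrite inE => /andP[]. Qed.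

Lemma Gamma_norm_Gv : Gamma \subset 'N(Gv)%g.
Proof.
suff H : Gamma \subset 'N(refl_fixing rho G v)%g by exact: subset_trans H (norms_gen _).
apply/subsetP => g gG; rewrite inE; apply/subsetP => _ /imsetP[s sR ->].
move: sR; rewrite !inE => /and3P[sG sr /eqP sv].
rewrite memJ_norm ?(subsetP Gamma_norm) // sG (reflection_conj rep g sr).1 /=.
have gv := line_theta v0 Gamma_line gG.
rewrite conjgE !repM -!mulmxA gv -!scalemxAr sv; apply/eqP.
by rewrite scalemxAr -gv mulmxA repVK // mul1mx.
Qed.

Lemma XgE x : x \in Xg -> exists a g, [/\ a \in G, g \in Gamma & x = (a * g)%g].
Proof.
by rewrite /= norm_joinEr // => /mulsgP[a g aG gG ->]; exists a, g.
Qed.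

Lemma YgE y : y \in Yg -> exists a g, [/\ a \in Gv, g \in Gamma & y = (a * g)%g].
Proof.
rewrite /= norm_joinEr; last exact: Gamma_norm_Gv.
by case/mulsgP => a g aG gG ->; exists a, g.
Qed.

Lemma Yg_line y : y \in Yg -> exists c : K, rho y *m v = c *: v.
Proof.
case/YgE => a [g [aG gG ->]]; exists (th g).
by rewrite repM -mulmxA (line_theta v0 Gamma_line gG) -scalemxAr Gv_fix.
Qed.

Lemma Xg_norm : Xg \subset 'N(G)%g.
Proof. by rewrite join_subG normG. Qed.

Lemma Gv_Yg : Gv \subset Yg. Proof. exact: joing_subl. Qed.
Lemma Gamma_Yg : Gamma \subset Yg. Proof. exact: joing_subr. Qed.
Lemma Yg_Xg : Yg \subset Xg. Proof. by rewrite genS // setSU // Gv_sub. Qed.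
Lemma G_Xg : G \subset Xg. Proof. exact: joing_subl. Qed.

Lemma theta_Gv a g : a \in Gv -> g \in Gamma -> th (a * g)%g = th g.
Proof.
move=> aG gG; apply: thetaE => //.
by rewrite repM -mulmxA (line_theta v0 Gamma_line gG) -scalemxAr Gv_fix.
Qed.

Lemma thetaExt_Gv y : y \in Yg -> thetaExt rho Gv Gamma v y = th y.
Proof.
case/YgE => a [g [aG gG ->]]; rewrite theta_Gv // /thetaExt.
case: pickP => [g' /andP[g'G agG]|/(_ g)]; last by rewrite gG mulgK aG.
by rewrite -(theta_Gv agG g'G) mulgKV theta_Gv.
Qed.

(** The value depends on the element picked when [theta] is nontrivial on [G :&: Gamma]. Some
    admissible [g] is enough, since [Psi_twist] holds for every factorisation. *)
Lemma thetaExt_G x : x \in Xg -> exists2 g, g \in Gamma /\ (x * g^-1)%g \in G &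
  thetaExt rho G Gamma v x = th g.
Proof.
case/XgE => a [g [aG gG ->]]; rewrite /thetaExt.
case: pickP => [g' /andP[g'G agG]|/(_ g)]; last by rewrite gG mulgK aG.
by exists g'.
Qed.

Let thM := thetaM rep v0 Yg_line.
Let th0 := theta_neq0 rep v0 Yg_line.

Definition star y h := th y ^ k *: lsub (th y)%:M (lsub (tau y) h).

Lemma star_linear y : linear (star y).
Proof. by move=> a p q; rewrite /star !linearP. Qed.
HB.instance Definition _ y := GRing.isLinear.Build K {mpoly K[n]} {mpoly K[n]} _ (star y)
  (star_linear y).

Lemma twact_Gv y h : y \in Yg -> twact rho Gv Gamma v k y h = star y h.
Proof.
move=> yY; have T := @twactE K n gT rho Gv Gamma v k y h.
by rewrite thetaExt_Gv // in T; apply: T; apply: th0.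
Qed.

Lemma starM x y h : x \in Yg -> y \in Yg -> star (x * y)%g h = star x (star y h).
Proof.
move=> xY yY; have [_ tM _] := faithful_dual rep.
rewrite /star (thM xY yY) expfzMl !lsubZ scalerA; congr (_ *: _).
by rewrite scalar_mxM tM !lsubM (lsub_scalar_comm (th y) (tau x)).
Qed.

Variable lam : 'rV[K]_n.
Hypothesis lamY : forall y, y \in Yg -> lam *m rho y = th y *: lam.
Hypothesis lam_move : forall s, s \in G -> rho s *m v != v -> lam *m rho s != lam.
Local Notation Psi := (harm_of_family rho G lam Xg).

Lemma stab_group_Gv : stab_group rho G lam = Gv.
Proof.
apply/val_inj; rewrite /=; congr <<_>>%g; apply/setP => s; rewrite !inE.
case sG : (s \in G) => //=; case sr : (is_reflection rho s) => //=.
apply/eqP/eqP => [sl|sv]; first by apply/eqP; apply: contraTT isT => /(lam_move sG)/eqP.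
have sY : s \in Yg by rewrite (subsetP Gv_Yg) // mem_gen // inE sG sr sv eqxx.
by rewrite lamY // (thetaE v0 (a := 1)) ?scale1r.
Qed.

Lemma pair_star y q h : y \in Yg ->
  pair (trans lam (lsub (rho y) q)) (star y h) =
  th y ^ k * pair (trans lam (lsub (th y)%:M q)) h.
Proof.
have E a t B r : pair r (a *: lsub t%:M (lsub B h)) = a * pair (lsub B^T (lsub t%:M r)) h.
  by rewrite pairZr !pair_lsub tr_scalar_mx.
move=> yY.
rewrite [LHS]E.
have -> : lsub (tau y)^T (lsub (th y)%:M (trans lam (lsub (rho y) q))) =
    trans lam (lsub (th y)%:M q); last by [].
rewrite dual_rep_tr (trans_lsub lam (rho y)) (trans_lsub lam (th y)%:M).
rewrite (lamY yY) mul_mx_scalar (lsub_scalar_comm (th y) (rho y)) -lsubM (repVK rep).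
by rewrite lsub1.
Qed.

Lemma pair_star_shift y z w q h : y \in Yg ->
  pair (trans lam (lsub (rho (y * (z * w))%g) q)) (star y h) =
  th y ^ k * pair (trans lam (lsub (rho z) (lsub (th y)%:M (lsub (rho w) q)))) h.
Proof.
move=> yY; rewrite repM lsubM; apply: (etrans (pair_star _ _ yY)).
by rewrite repM lsubM (lsub_scalar_comm (th y) (rho z)).
Qed.

Lemma harm_star y h : y \in Yg -> harm rho Gv h -> harm rho Gv (star y h).
Proof.
move=> yY hH; apply: harm_scale; apply: harm_scalar; apply: harm_norm => //.
by apply: (subsetP _ _ yY); rewrite join_subG normG Gamma_norm_Gv.
Qed.

Definition induced f := (forall x, x \in Xg -> harm rho Gv (f x)) /\
  (forall y x, y \in Yg -> x \in Xg -> f (y * x)%g = star y (f x)).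

(** Reindexing [G] turns the argument of [f] into [g * z]; equivariance then takes [g] out of [f]
    and leaves the rescaling. *)
Lemma Psi_twist f a g : induced f -> a \in G -> g \in Gamma ->
  Psi (fun z => f (z * (a * g))%g) =
  th g ^ k *: lsub (th g)%:M (lsub (tau (a * g)%g) (Psi f)).
Proof.
move=> [_ fY] aG gG; have gY := subsetP Gamma_Yg _ gG.
have gN := subsetP Gamma_norm _ gG.
have xX : (a * g)%g \in Xg by rewrite groupM //; [exact: (subsetP G_Xg)|exact: (subsetP Yg_Xg)].
have E := @Psi_semilinear K n gT charK0 rho G lam Xg f (fun z => f (z * (a * g))%g)
  (tau (a * g)%g *m (th g)%:M) (th g ^ k).
rewrite E; first by rewrite lsubM -lsub_scalar_comm.
  move=> p; rewrite trmx_mul tr_scalar_mx dual_rep_tr lsubM /family_form mulr_sumr.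
  have inj : injective (fun z => g * z * g^-1 * a^-1)%g.
    by move=> z z' /mulIg/mulIg/mulgI.
  have memE z : (g * z * g^-1 * a^-1 \in G)%g = (z \in G).
    have -> : (g * z * g^-1 * a^-1 = z ^ g^-1 * a^-1)%g by rewrite conjgE invgK mulgA.
    by rewrite groupMr ?groupV // memJ_norm ?groupV.
  rewrite (reindex_inj inj) /=; apply: eq_big => [z|z]; first exact: memE.
  rewrite memE => zG.
  have -> : (g * z * g^-1 * a^-1 * (a * g) = g * z)%g by rewrite !mulgA mulgKV mulgKV.
  rewrite fY ?(subsetP G_Xg) //.
  have -> : (g * z * g^-1 * a^-1 = g * (z * (a * g)^-1))%g by rewrite invMg !mulgA.
  exact: pair_star_shift.
by move=> h; rewrite !lsubM (harm_proj_rep rep) // harm_proj_scalar.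
Qed.

(** For [g] in both groups, 1 = g^-1 g is a nontrivial factorisation of the identity; by [Psi_twist]
    it multiplies degree [i] by a power of [th g] while changing nothing. *)
Lemma Psi_ok f i : induced f ->
  ~~ [forall x in G :&: Gamma, th x ^ (k + i%:Z) == 1] -> hcomp i (Psi f) = 0.
Proof.
move=> fI; rewrite negb_forall_in => /exists_inP[g]; rewrite inE => /andP[gG gGa] t1.
have [tau1 _ _] := faithful_dual rep.
have gV : g^-1%g \in G by rewrite groupV.
have := Psi_twist fI gV gGa; rewrite mulVg tau1 lsub1.
rewrite (@eq_Psi _ _ _ rho G lam Xg _ f) => [|x _]; last by rewrite mulg1.
move=> /(congr1 (hcomp i)); rewrite hcomp_twist; last first.
  by apply: th0; apply: (subsetP Gamma_Yg).
move/eqP; rewrite -subr_eq0 -{1}[hcomp i _]scale1r -scalerBl scaler_eq0 subr_eq0 eq_sym.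
by rewrite (negbTE t1) => /eqP.
Qed.

Lemma Psi_twact f x : induced f -> x \in Xg ->
  Psi (fun z => f (z * x)%g) = twact rho G Gamma v k x (Psi f).
Proof.
move=> fI xX; have [g [gG xgG] tE] := thetaExt_G xX.
rewrite twactE tE; last by apply: th0; apply: (subsetP Gamma_Yg).
have := Psi_twist fI xgG gG; by rewrite mulgKV.
Qed.

Lemma Psi_induced_inj f : induced f -> Psi f = 0 -> forall x, x \in Xg -> f x = 0.
Proof.
move=> [fH fY] Pf.
have f0 : forall x, x \in G -> f x = 0.
  apply: (Psi_inj charK0 rep Ggen Xg_norm (lam := lam)) Pf => [x xG|y x].
    by rewrite stab_group_Gv; apply: fH; apply: (subsetP G_Xg).
  rewrite stab_group_Gv => yG xG; rewrite fY ?(subsetP Gv_Yg) ?(subsetP G_Xg) //.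
  by rewrite /star (thetaE v0 (a := 1)) ?scale1r ?Gv_fix // exp1rz scale1r lsub1.
(* [Xg] is [Gamma] times [G], so equivariance spreads the vanishing from [G]. *)
move=> x xX; have := xX; rewrite /= (norm_joinEr Gamma_norm) -(normC Gamma_norm).
case/mulsgP => g a gG aG ->; rewrite fY ?(subsetP Gamma_Yg) ?(subsetP G_Xg) //.
by rewrite f0 // linear0.
Qed.

Lemma Psi_induced_surj h : harm rho G h ->
  (forall i : nat, ~~ [forall x in G :&: Gamma, th x ^ (k + i%:Z) == 1] -> hcomp i h = 0) ->
  exists2 f, induced f & Psi f = h.
Proof.
move=> hH hok; have [p pE] := Psi_surj charK0 rep Ggen lam Xg_norm hH.
pose f0 x := if x \in G then jac_family rho G lam p x else 0.
have f0H x : harm rho Gv (f0 x).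
  rewrite /f0; case: ifP => _; last exact: harm0.
  by rewrite -stab_group_Gv; apply: fam_harm.
(* As [f0] is supported on [G], only the [y] in [Z] contribute at points of [G]. Each of them
   contributes [h], whence the normalisation. *)
pose Z := (G :&: Yg)%G.
pose f x := #|Z|%:R^-1 *: \sum_(y in Yg) star y^-1%g (f0 (y * x)%g).
exists f.
  split=> [x xX|y x yY xX].
    by apply: harm_scale; apply: harm_sum => y yY; apply: harm_star; rewrite ?groupV.
  rewrite /f [RHS]linearZ /=; congr (_ *: _); rewrite [RHS]linear_sum /=.
  rewrite [RHS](reindex_inj (mulIg y)) /=; apply: eq_big => [z|z zY].
    by rewrite groupMr.
  have zyY : (z * y)^-1%g \in Yg by rewrite groupV groupM.
  have -> : z^-1%g = (y * (z * y)^-1)%g by rewrite invMg mulKVg.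
  by rewrite mulgA; exact: (starM _ yY zyY).
have -> : Psi f = Psi (fun x => #|Z|%:R^-1 *: \sum_(y in Z) star y^-1%g (f0 (y * x)%g)).
  apply: eq_Psi => x xG; rewrite /f (bigID (mem G)) /= [X in _ + X]big1 ?addr0.
    by congr (_ *: _); apply: eq_bigl => y; rewrite [RHS]inE andbC.
  by move=> y /andP[_ yG]; rewrite /f0 groupMr // (negbTE yG) linear0.
rewrite Psi_scale Psi_sum; rewrite (eq_bigr (fun=> h)) => [|y yZ].
  by rewrite sumr_const -scaler_nat scalerA mulVf ?scale1r // natK_neq0.
have [yG yY] := setIP yZ; have yVY : y^-1%g \in Yg by rewrite groupV.
set t := th y^-1%g; have t0 : t != 0 by apply: th0.
have E := @Psi_semilinear K n gT charK0 rho G lam Xg f0 (fun x => star y^-1%g (f0 (y * x)%g))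
  t%:M (t ^ k).
rewrite E.
- have -> : Psi f0 = h by rewrite -pE; apply: eq_Psi => x xG; rewrite /f0 xG.
  apply: hcomp_eqP => i; rewrite hcomp_twist //.
  case: (boolP [forall x in G :&: Gamma, th x ^ (k + i%:Z) == 1]) => [ok|/hok->]; last first.
    by rewrite scaler0.
  (* The factor [g] lies in [G :&: Gamma], where the twist is trivial in every degree retained by
     [h]. *)
  have [a [g [aG gG yE]]] := YgE yVY.
  have gGG : g \in G.
    by rewrite -(mulKg a g) -yE groupM ?groupV // (subsetP Gv_sub).
  have /forall_inP/(_ g) := ok; rewrite inE gGG gG => /(_ isT)/eqP.
  by rewrite /t yE theta_Gv // => ->; rewrite scale1r.
- move=> q; rewrite tr_scalar_mx /family_form mulr_sumr (reindex_inj (mulgI y^-1%g)) /=.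
  apply: eq_big => [x|x xG]; first by rewrite groupMl ?groupV.
  rewrite mulKVg repM lsubM; apply: (etrans (pair_star _ _ yVY)).
  by rewrite -/t (lsub_scalar_comm t (rho x)).
- by move=> q; rewrite harm_proj_scalar.
Qed.

End Induction.

(** The map constructed goes from the induced module to the harmonic polynomials, against the
    direction asked for. Its inverse is made total by [epsilon], with arbitrary values outside
    [PU]. *)
Lemma rep_iso_of_inverse (K : fieldType) (gT : finGroupType) (X : {set gT})
    (U W : lmodType K) (PU : U -> Prop) (aU : gT -> U -> U)
    (PW : W -> Prop) (aW : gT -> W -> W) (psi : W -> U) :
  (forall a w1 w2, PW w1 -> PW w2 -> PW (a *: w1 + w2)) ->
  (forall a w1 w2, PW w1 -> PW w2 -> psi (a *: w1 + w2) = a *: psi w1 + psi w2) ->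
  (forall w, PW w -> PU (psi w)) ->
  (forall w, PW w -> psi w = 0 -> w = 0) ->
  (forall u, PU u -> exists2 w, PW w & psi w = u) ->
  (forall x w, x \in X -> PW w -> PW (aW x w)) ->
  (forall x w, x \in X -> PW w -> psi (aW x w) = aU x (psi w)) ->
  rep_iso X PU aU PW aW.
Proof.
move=> Plin psilin psiP psi0 psis aWP psiaW.
have psi_inj w1 w2 : PW w1 -> PW w2 -> psi w1 = psi w2 -> w1 = w2.
  move=> P1 P2 E; apply/eqP; rewrite -subr_eq0 addrC -scaleN1r; apply/eqP.
  by apply: psi0; [exact: Plin|rewrite psilin // E scaleN1r addNr].
pose phi u := epsilon (inhabits 0) (fun w => PW w /\ psi w = u).
have phiP u : PU u -> PW (phi u) /\ psi (phi u) = u.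
  case/psis => w Pw E; pose Q w' := PW w' /\ psi w' = u.
  exact: (@epsilon_spec _ (inhabits 0) Q (ex_intro Q w (conj Pw E))).
have phi_psi w : PW w -> phi (psi w) = w.
  by move=> Pw; have [P E] := phiP _ (psiP _ Pw); apply: psi_inj.
exists phi; split.
- move=> a u1 u2 /phiP[P1 {1}<-] /phiP[P2 {1}<-]; rewrite -psilin // phi_psi //.
  exact: Plin.
- by move=> u /phiP[].
- by move=> u1 u2 /phiP[_ {2}<-] /phiP[_ {2}<-] ->.
- by move=> w Pw; exists (psi w); [exact: psiP|exact: phi_psi].
- move=> x u xX /phiP[P {1}<-]; rewrite -psiaW // phi_psi //.
  exact: aWP.
Qed.

Theorem theorem4p6
  (K : closedFieldType) (charK0 : [pchar K] =i pred0)
  (n : nat) (gT : finGroupType) (rho : gT -> 'M[K]_n)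
  (rho1 : rho 1%g = 1%:M)
  (rhoM : forall x y : gT, rho (x * y)%g = rho x *m rho y)
  (rho_inj : injective rho)
  (G Gamma : {group gT})
  (G_refl : G :=: (<<[set g in G | is_reflection rho g]>>)%g)
  (v : 'cV[K]_n) (v_neq0 : v != 0)
  (Gamma_norm : Gamma \subset 'N(G)%g)
  (Gamma_line : forall x, x \in Gamma -> exists c : K, rho x *m v = c *: v)
  (k : int) :
  let Gv := Gsub rho G v in
  let X := (G <*> Gamma)%g in
  let Y := (Gv <*> Gamma)%g in
  let ok (i : nat) := [forall x in G :&: Gamma, theta rho v x ^ (k + i%:Z) == 1] in
  rep_iso X
    (fun f : {mpoly K[n]} =>
       harmonic rho G f /\ (forall i : nat, ~~ ok i -> hcomp i f = 0))
    (twact rho G Gamma v k)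
    (Ind_carrier X Y (harmonic rho Gv) (twact rho Gv Gamma v k))
    (@Ind_act K n gT).
Proof.
move=> GvS X Y ok.
have rep : faithful_rep rho by split.
have Yline := Yg_line rep v_neq0 Gamma_norm Gamma_line.
have [lam [lamY lam_move]] := dual_eigenvector charK0 rep G v_neq0 Yline.
pose ind := induced rho G Gamma v k.
have twY y f : y \in Y -> twact rho GvS Gamma v k y f = star rho v k y f.
  exact: (twact_Gv rep v_neq0 Gamma_norm Gamma_line).
have indP (f : {ffun gT -> {mpoly K[n]}}) :
    Ind_carrier X Y (harmonic rho GvS) (twact rho GvS Gamma v k) f <->
    (forall x, x \notin X -> f x = 0) /\ ind f.
  split=> [[f0 [fH fY]]|[f0 [fH fY]]]; split=> //; split=> [x xX|y x yY xX].
  - by apply/(harmonicE charK0 rep); apply: fH.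
  - by rewrite fY // twY.
  - by apply/(harmonicE charK0 rep); apply: fH.
  - by rewrite fY // twY.
pose psi (f : {ffun gT -> {mpoly K[n]}}) 
  := harm_of_family rho G lam (Xg G Gamma) f.
apply: (@rep_iso_of_inverse _ _ _ _ _ _ _ _ _ psi).
- move=> a f1 f2 /indP[z1 [H1 E1]] /indP[z2 [H2 E2]]; apply/indP; split=> [x xX|].
    by rewrite !ffunE z1 // z2 // scaler0 addr0.
  split=> [x xX|y x yY xX]; first by rewrite !ffunE; apply: harm_linear; auto.
  by rewrite !ffunE E1 // E2 // -linearP.
- move=> a f1 f2 _ _; rewrite -Psi_linear; apply: eq_Psi => x _; by rewrite !ffunE.
- move=> f /indP[_ fI]; split=> [|i oki].
    by apply/(harmonicE charK0 rep); apply: Psi_harm => //; apply: Xg_norm.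
  exact: (Psi_ok charK0 rep v_neq0 Gamma_norm Gamma_line lamY fI oki).
- move=> f /indP[f0 fI] Pf; apply/ffunP => x; rewrite ffunE.
  have [xX|/f0//] := boolP (x \in X).
  exact: (Psi_induced_inj charK0 rep G_refl v_neq0 Gamma_norm lamY lam_move fI Pf xX).
- move=> h [/(harmonicE charK0 rep) hH hok].
  have [f [fH fY] fE] := Psi_induced_surj charK0 rep G_refl v_neq0 Gamma_norm Gamma_line
    lamY lam_move hH hok.
  (* The carrier of the induced module demands the value 0 outside [X]. *)
  pose F := [ffun x => if x \in X then f x else 0].
  exists F; last by rewrite -fE; apply: eq_Psi => x xG; rewrite ffunE (subsetP (G_Xg G Gamma)).
  apply/indP; split=> [x /negbTE xX|]; first by rewrite ffunE xX.
  split=> [x xX|y x yY xX]; rewrite !ffunE.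
    by rewrite (xX : x \in X); apply: fH.
  have yX : y \in Xg G Gamma by apply: (subsetP (Yg_Xg rho G Gamma v)).
  have yxX : (y * x)%g \in X by apply: (groupM (G := Xg G Gamma)).
  by rewrite yxX (xX : x \in X); apply: fY.
- move=> x f xX /indP[f0 [fH fY]]; apply/indP; split=> [z zX|].
    by rewrite ffunE f0 //; rewrite (groupMr (G := Xg G Gamma)).
  split=> [z zX|y z yY zX]; rewrite !ffunE; first by apply: fH; apply: groupM.
  by rewrite -mulgA fY // groupM.
- move=> x f xX /indP[_ fI].
  rewrite -(Psi_twact charK0 rep v_neq0 Gamma_norm Gamma_line lamY fI xX).
  by apply: eq_Psi => z _; rewrite ffunE.
Qed.
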